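(* Let $\kappa\in\mathbb R$, $d\ge2$, $\tau_0,\ldots,\tau_d>0$, and put $s=\tau_0^2+\cdots+\tau_d^2$. Let $v_0,\ldots,v_d\in\bar{\mathbb B}^d(\kappa)$ be points satisfying $$\langle v_j,v_k\rangle=-\frac1s\quad(0\le j\ne k\le d),\qquad \|v_j\|^2=-\frac1s+\frac1{\tau_j^2}\quad(0\le j\le d).$$ Consider the simplex $P:=\operatorname{conv}(v_0,\ldots,v_d)\subset\bar{\mathbb B}^d(\kappa)$. Let $F:=\operatorname{conv}(v_0,\ldots,v_k)$ for some $k\in\{0,\ldots,d-1\}$, and let $x\in\operatorname{relint}(F)\cap\mathbb B^d(\kappa)$. If $\kappa\ne s$, then the following assertions hold. (a) The normal cone $N_x(F,P)$ is isometric to the orthocentric cone $C_{d-k}\left(\frac{s^2}{\kappa-s};\tau_{k+1}^2,\ldots,\tau_d^2;1,\ldots,1\right)$. (b) The external angle at $F$ is $$\alpha_x(N_x(F,P))=\mathbf g_{d-k}\left(-\tfrac{s^2}{\kappa-s}-\tau_{k+1}^2-\cdots-\tau_d^2;\tau_{k+1}^2,\ldots,\tau_d^2;1,\ldots,1\right)$$ $$=\frac1{\sqrt{2\pi}}\int_{-\infty}^\infty\prod_{j=k+1}^d\Phi\left(\frac{\tau_j}{\sqrt{-\frac{s^2}{\kappa-s}-\tau_{k+1}^2-\cdots-\tau_d^2}}\,y\right)e^{-y^2/2}\,dy.$$ (c) The tangent cone $T_x(F,P)$ is isometric to the direct orthogonal sum of $\mathbb R^k$ and the orthocentric cone $C_{d-k}\left(-\frac{s^2}{\kappa-s}-\tau_{k+1}^2-\cdots-\tau_d^2;\tau_{k+1}^2,\ldots,\tau_d^2;1,\ldots,1\right)$.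 (d) The internal angle at $F$ is $$\alpha_x(T_x(F,P))=\mathbf g_{d-k}\left(\tfrac{s^2}{\kappa-s};\tau_{k+1}^2,\ldots,\tau_d^2;1,\ldots,1\right)=\frac1{\sqrt{2\pi}}\int_{-\infty}^\infty\prod_{j=k+1}^d\Phi\left(\frac{\tau_j\sqrt{\kappa-s}}{s}\,y\right)e^{-y^2/2}\,dy.$$ If $\kappa=s$, then $N_x(F,P)$ is isometric to the $(d-k)$-dimensional orthant and $T_x(F,P)$ is isometric to the direct orthogonal sum of $\mathbb R^k$ and the $(d-k)$-dimensional orthant; their angles are $\alpha_x(N_x(F,P))=\alpha_x(T_x(F,P))=\frac1{2^{d-k}}$. The integral formulas in (b) and (d) remain valid for $\kappa=s$ by continuous extension, with all arguments of $\Phi$ understood to be equal to $0$.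
   Context: Klein model. $\mathbb B^d(\kappa):=\mathbb R^d$ if $\kappa\ge0$ and $\mathbb B^d(\kappa):=\{x\in\mathbb R^d:\|x\|<1/\sqrt{-\kappa}\}$ if $\kappa<0$; $\bar{\mathbb B}^d(\kappa)$ is its Euclidean closure. The tangent space at $x\in\mathbb B^d(\kappa)$ is identified with $\mathbb R^d$ and carries the inner product $$g_x(u,v)=\frac{\langle u,v\rangle}{1+\kappa\|x\|^2}-\frac{\kappa\langle x,u\rangle\langle x,v\rangle}{(1+\kappa\|x\|^2)^2}.$$ Points $v_0,\dots,v_d\in\mathbb R^d$ with the stated scalar products exist and are affinely independent; $P$ is called an acute orthocentric simplex. Polytopes, cones, angles. Let $P=\{y\in\mathbb R^d:\langle a_r,y\rangle\le b_r,\ r=1,\ldots,m\}\subseteq\bar{\mathbb B}^d(\kappa)$ be a full-dimensional polytope with irredundant inequalities ($a_r\neq 0$), $F\ne P$ a (nonempty) face, $I(F)=\{r:\langle a_r,y\rangle=b_r\ \forall y\in F\}$. For $x\in\operatorname{relint}(F)\cap\mathbb B^d(\kappa)$: $T_x(F,P)=\{u\in\mathbb R^d:\langle a_r,u\rangle\le0\ \forall r\in I(F)\}$ and $N_x(F,P)=\{v\in\mathbb R^d: g_x(v,u)\le0\ \forall u\in T_x(F,P)\}$, both regarded as cones in $(\mathbb R^d,g_x)$. For a polyhedral cone $K$ in a finite-dimensional inner product space with linear hull $L$, its solid angle is the ratio of the $(\dim L)$-dimensional volumes of $K\cap B$ and $L\cap B$, $B$ the unit ball; $\alpha_x$ is the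 solid angle with respect to $g_x$. The internal and external angles at $F$ are $\alpha_x(T_x(F,P))$ and $\alpha_x(N_x(F,P))$. Two cones in inner product spaces are isometric if a linear isometry between their linear hulls maps one onto the other. The $m$-dimensional orthant is $[0,\infty)^m$. Orthocentric cones. For $m\in\mathbb N$, $\lambda_0,\ldots,\lambda_m\in\mathbb R\setminus\{0\}$ and $\varepsilon_1,\ldots,\varepsilon_m\in\{\pm1\}$, $C_m(\lambda_0;\lambda_1,\ldots,\lambda_m;\varepsilon_1,\ldots,\varepsilon_m)$ denotes any cone $\operatorname{pos}\{\varepsilon_1v_1,\ldots,\varepsilon_mv_m\}$ (the set of nonnegative linear combinations) with linearly independent $v_1,\ldots,v_m\in\mathbb R^N$, $N\ge m$, satisfying $\langle v_i,v_j\rangle=\frac1{\lambda_0}+\frac{\delta_{ij}}{\lambda_i}$; it is unique up to isometry. For $\lambda_1,\ldots,\lambda_m>0$ and either $\lambda_0>0$ or $\lambda_0<-(\lambda_1+\cdots+\lambda_m)$, $$\mathbf g_m(\lambda_0;\lambda_1,\ldots,\lambda_m;\varepsilon_1,\ldots,\varepsilon_m)=\frac1{\sqrt{2\pi}}\int_{-\infty}^\infty\prod_{j=1}^m\Phi\left(\varepsilon_j\sqrt{\tfrac{\lambda_j}{\lambda_0}}\,x\right)e^{-x^2/2}\,dx.$$ $\Phi$ is the entire function $\Phi(z)=\frac12+\frac1{\sqrt{2\pi}}\int_0^z e^{-t^2/2}\,dt$. Convention: $\sqrt{-a}:=\mathrm i\sqrt a$ for $a>0$. *)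

(* Defs.v *)
From HB Require Import structures.
From mathcomp Require Import all_boot all_order all_algebra.
From mathcomp Require Import all_classical all_reals all_analysis.
From mathcomp Require Import complex.
Import Order.TTheory GRing.Theory Num.Theory.
Import numFieldNormedType.Exports.

Set Implicit Arguments.
Unset Strict Implicit.
Unset Printing Implicit Defensive.

Local Open Scope classical_set_scope.
Local Open Scope complex_scope.
Local Open Scope ring_scope.

Section Euclidean.
Variable R : realType.

Definition dot n (u v : 'rV[R]_n) : R := \sum_(i < n) u 0 i * v 0 i.

Definition enorm n (u : 'rV[R]_n) : R := Num.sqrt (dot u u).

Definition klein_ball (kappa : R) d : set 'rV[R]_d :=
  [set x | 0 <= kappa \/ enorm x < (Num.sqrt (- kappa))^-1].

Definition klein_metric (kappa : R) d (x u v : 'rV[R]_d) : R :=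
  dot u v / (1 + kappa * enorm x ^+ 2)
  - kappa * dot x u * dot x v / (1 + kappa * enorm x ^+ 2) ^+ 2.

Definition conv_pts d n (w : 'I_n -> 'rV[R]_d) : set 'rV[R]_d :=
  [set x | exists c : 'I_n -> R,
     [/\ forall i, 0 <= c i, \sum_i c i = 1 & x = \sum_i c i *: w i]].

Definition pos_pts d n (w : 'I_n -> 'rV[R]_d) : set 'rV[R]_d :=
  [set x | exists2 c : 'I_n -> R,
     forall i, 0 <= c i & x = \sum_i c i *: w i].

Definition aff_hull d (A : set 'rV[R]_d) : set 'rV[R]_d :=
  [set x | exists n (w : 'I_n -> 'rV[R]_d) (c : 'I_n -> R),
     [/\ forall i, A (w i), \sum_i c i = 1 & x = \sum_i c i *: w i]].

Definition relint d (A : set 'rV[R]_d) : set 'rV[R]_d :=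
  [set x | A x /\ within (aff_hull A) (nbhs x) A].

Definition irredundant_rep d (P : set 'rV[R]_d) m
    (a : 'I_m -> 'rV[R]_d) (b : 'I_m -> R) : Prop :=
  [/\ P = [set y | forall r, dot (a r) y <= b r],
      forall r, a r != 0 &
      forall r, P <> [set y | forall r', r' != r -> dot (a r') y <= b r']].

(* The irredundant representation of a full-dimensional polytope is unique up
   to order and positive rescaling of each inequality, so the choice of
   (m, a, b) is immaterial.  The cone does not depend on the base point. *)
Definition tangent_cone d (F P : set 'rV[R]_d) : set 'rV[R]_d :=
  [set u | exists m (a : 'I_m -> 'rV[R]_d) (b : 'I_m -> R),
     irredundant_rep P a b /\
     forall r, (forall y, F y -> dot (a r) y = b r) -> dot (a r) u <= 0].

Definition normal_cone (kappa : R) d (x : 'rV[R]_d) (F P : set 'rV[R]_d) :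
    set 'rV[R]_d :=
  [set v | forall u, tangent_cone F P u -> klein_metric kappa x v u <= 0].

Definition lin_hull n (K : set 'rV[R]_n) : {vspace 'rV[R]_n} :=
  xget 0%VS [set U : {vspace 'rV[R]_n} | K `<=` [set` U] /\
    forall W : {vspace 'rV[R]_n}, K `<=` [set` W] -> (U <= W)%VS].

(* Inner products are given as functions g; a cone is a set together with the
   inner product of its ambient space.  Every linear map on the linear hull
   extends to the whole space, so a globally defined f loses nothing. *)
Definition isometric n (g : 'rV[R]_n -> 'rV[R]_n -> R) (K : set 'rV[R]_n)
    p (h : 'rV[R]_p -> 'rV[R]_p -> R) (L : set 'rV[R]_p) : Prop :=
  exists f : {linear 'rV[R]_n -> 'rV[R]_p},
    [/\ {in lin_hull K &, forall u v, h (f u) (f v) = g u v},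
        f @` [set` lin_hull K] = [set` lin_hull L] &
        f @` K = L].

(* Lebesgue measure on R^n as the n-fold product of [lebesgue_measure], i.e.
   the iterated integral by which the product measure [\x] is defined. *)
Fixpoint volume n : set 'rV[R]_n -> \bar R :=
  match n return set 'rV[R]_n -> \bar R with
  | 0 => fun A => (\1_A 0)%:E
  | n'.+1 => fun A =>
      (\int[lebesgue_measure]_t
         volume [set y : 'rV[R]_n' | A (row_mx (t%:M : 'rV[R]_1) y)])%E
  end.

(* The rows form a g-orthonormal basis of L; the volume below does not depend
   on the one selected. *)
Definition orthonormal_basis n (g : 'rV[R]_n -> 'rV[R]_n -> R)
    (L : {vspace 'rV[R]_n}) : 'M[R]_(\dim L, n) :=
  xget 0 [set e : 'M[R]_(\dim L, n) |
    (forall i j, g (row i e) (row j e) = (i == j)%:R) /\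
    (forall i, row i e \in L)].

Definition volume_in n (g : 'rV[R]_n -> 'rV[R]_n -> R)
    (L : {vspace 'rV[R]_n}) (A : set 'rV[R]_n) : R :=
  fine (volume [set c : 'rV[R]_(\dim L) | A (c *m orthonormal_basis g L)]).

Definition solid_angle n (g : 'rV[R]_n -> 'rV[R]_n -> R)
    (K : set 'rV[R]_n) : R :=
  let L := lin_hull K in
  let B := [set u | g u u <= 1] in
  volume_in g L (K `&` B) / volume_in g L ([set` L] `&` B).

Definition orthant m : set 'rV[R]_m := [set y | forall i, 0 <= y 0 i].

Definition orth_sum p q (A : set 'rV[R]_p) (B : set 'rV[R]_q) :
    set 'rV[R]_(p + q) :=
  [set y | exists a b, [/\ A a, B b & y = row_mx a b]].

Definition orthocentric_cone m (lambda0 : R) (lambda eps : 'I_m -> R)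
    N (C : set 'rV[R]_N) : Prop :=
  [/\ lambda0 != 0, forall i, lambda i != 0,
      forall i, eps i = 1 \/ eps i = -1 &
      exists v : 'I_m -> 'rV[R]_N,
        [/\ free (codom v),
            forall i j, dot (v i) (v j) =
                        lambda0^-1 + (i == j)%:R / lambda i &
            C = pos_pts (fun i => eps i *: v i)]].

(* "Q holds for the cone C_m(lambda0; lambda; eps)", which is only defined up
   to isometry: such cones exist and Q holds for each of them. *)
Definition for_orthocentric_cone m (lambda0 : R) (lambda eps : 'I_m -> R)
    (Q : forall N, set 'rV[R]_N -> Prop) : Prop :=
  (exists N (C : set 'rV[R]_N), orthocentric_cone lambda0 lambda eps C) /\
  forall N (C : set 'rV[R]_N), orthocentric_cone lambda0 lambda eps C -> Q N C.

End Euclidean.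

Section ComplexGaussian.
Variable R : realType.

Definition cexp (z : R[i]) : R[i] :=
  (expR (complex.Re z))%:C * (cos (complex.Im z) +i* sin (complex.Im z)).

Definition cintegral (D : set R) (f : R -> R[i]) : R[i] :=
  Rintegral lebesgue_measure D (fun t => complex.Re (f t)) +i*
  Rintegral lebesgue_measure D (fun t => complex.Im (f t)).

Definition csqrt (a : R) : R[i] :=
  if 0 <= a then (Num.sqrt a)%:C else 0 +i* Num.sqrt (- a).

(* The integral from 0 to z is taken along the segment t |-> t * z; the
   integrand is entire, so the path is irrelevant. *)
Definition Phi (z : R[i]) : R[i] :=
  2^-1 + (Num.sqrt (2 * pi))^-1%:C *
    cintegral `[0, 1] (fun t => z * cexp (- ((z * t%:C) ^+ 2 / 2))).

Definition Phi_gauss_integral n (J : pred 'I_n) (a : 'I_n -> R[i]) : R[i] :=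
  (Num.sqrt (2 * pi))^-1%:C *
    cintegral setT (fun y =>
      (\prod_(j < n | J j) Phi (a j * y%:C)) * (expR (- (y ^+ 2 / 2)))%:C).

Definition g_admissible m (lambda0 : R) (lambda : 'I_m -> R) : Prop :=
  (forall i, 0 < lambda i) /\
  (0 < lambda0 \/ lambda0 < - \sum_i lambda i).

(* Meaningful only under [g_admissible]. *)
Definition g_fun m (lambda0 : R) (lambda eps : 'I_m -> R) : R[i] :=
  Phi_gauss_integral xpredT (fun j => (eps j)%:C * csqrt (lambda j / lambda0)).

End ComplexGaussian.

(* Main.v *)
(* Let B have rows with Gram matrix 1 + q b^T b and let C be the cone of the [y *m B],
   [y] in an orthant (times a linear space).  By homogeneity the solid angle of C is a
   ratio of integrals of exp(-(|y|^2 + q <b,y>^2)/2), and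
     exp(- q <b,y>^2 / 2) = E exp(z <b,y> X),  z^2 = - q,  X standard normal,
   decouples the coordinates: each contributes a half-line Gaussian integral, which is a
   value of Phi at a complex argument.  This is the function [g_fun] in scaled form.
   In the Klein model, scaling the facet normals at F by the tau_j gives such a B with
   q = (kappa - s) / s^2 and b = (tau_j)_(j > k); its rows generate the normal cone, and
   the dual basis, completed by an orthonormal basis of the orthogonal complement,
   generates the tangent cone with q replaced by - q / (1 + q |b|^2). *)

Require Import Defs.
From HB Require Import structures.
From mathcomp Require Import all_boot all_order all_algebra.
From mathcomp Require Import all_classical all_reals all_analysis.
From mathcomp Require Import complex measurable_realfun.
From mathcomp Require Import ring lra.
Import Order.TTheory GRing.Theory Num.Theory.
Import numFieldNormedType.Exports.

Set Implicit Arguments.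
Unset Strict Implicit.
Unset Printing Implicit Defensive.

Local Open Scope classical_set_scope.
Local Open Scope complex_scope.
Local Open Scope ring_scope.

(** * Lebesgue measure on row vectors *)

(** The root z is real or purely imaginary according to the sign of q. In both cases the joint
    density of X and y is dominated by the density with Re z on the whole space, which is integrable
    when (Re z)^2 |b|^2 < 1; this follows from 1 + q |b|^2 > 0, itself a consequence of the positive
    definiteness of the Klein metric. Integrating out y leaves the weight exp(-(1 + q |b|^2) X^2 /
    2) on X. Rescaling X divides z by sqrt(1 + q |b|^2), so the arguments of Phi are c b_j X with
    c^2 = - q / (1 + q |b|^2). The map q |-> - q / (1 + q |b|^2) is an involution: this is why the
    parameter of the tangent cone appears in the external angle and that of the normal cone in the
    internal one. Only c^2 is prescribed, so either square root may be used. A solid angle is a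
    ratio, so no determinant and no volume of a ball is evaluated: unknown positive factors cancel.
    At kappa = s the root passes between real and imaginary; a Lipschitz estimate in |c| at c = 0
    handles both sides at once. *)

Definition rowv_display : measure_display -> measure_display.
Proof. exact. Qed.

Section rowv_measurable.
Context {R : realType} {n : nat}.

Let coors : 'I_n -> 'rV[R]_n -> R := fun i x => x 0 i.

Let rowv_set0 : g_sigma_preimage coors set0.
Proof. exact: sigma_algebra0. Qed.

Let rowv_setC A : g_sigma_preimage coors A -> g_sigma_preimage coors (~` A).
Proof. exact: sigma_algebraC. Qed.

Let rowv_bigcup (F : _^nat) : (forall i, g_sigma_preimage coors (F i)) ->
  g_sigma_preimage coors (\bigcup_i (F i)).
Proof. exact: sigma_algebra_bigcup. Qed.

(** Generated by the coordinates, this sigma-algebra makes both [consv] and its inverse measurable,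
    so theorems on product measures pass to row vectors one coordinate at a time. *)
HB.instance Definition _ := @isMeasurable.Build (rowv_display default_measure_display)
  'rV[R]_n (g_sigma_preimage coors) rowv_set0 rowv_setC rowv_bigcup.

Lemma measurable_coord (i : 'I_n) : measurable_fun [set: 'rV[R]_n] (fun u : 'rV[R]_n => u 0 i).
Proof.
move=> _ Y mY; rewrite setTI; apply: sub_sigma_algebra => /=.
rewrite -bigcup_seq/=; exists i => /=; first by rewrite mem_index_enum.
by exists Y => //; rewrite setTI.
Qed.

Lemma measurable_rowvP d (T : measurableType d) (f : T -> 'rV[R]_n) :
  (forall i, measurable_fun [set: T] (fun t => f t 0 i)) -> measurable_fun [set: T] f.
Proof.
move=> mf.
have H : g_sigma_preimage (fun i => coors i \o f) `<=` measurable.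
  apply: smallest_sub; first exact: sigma_algebra_measurable.
  rewrite -bigcup_seq; apply: bigcup_sub => i _.
  by move=> A [B mB <-]; exact: mf.
move: H; rewrite g_sigma_preimage_comp => H.
by move=> _ A mA; apply: H; exists A.
Qed.

End rowv_measurable.

Section consv.
Context {R : realType} {n : nat}.

Definition consv (t : R) (y : 'rV[R]_n) : 'rV[R]_n.+1 := row_mx (t%:M : 'rV_1) y.

Definition tailv (u : 'rV[R]_n.+1) : 'rV[R]_n := \row_i u 0 (lift 0 i).

Lemma consv0 t y : consv t y 0 0 = t.
Proof.
rewrite /consv; have -> : (0 : 'I_n.+1) = lshift n (0 : 'I_1) by exact/val_inj.
by rewrite (@row_mxEl _ 1 1 n) mxE eqxx mulr1n.
Qed.

Lemma consvS t y i : consv t y 0 (lift 0 i) = y 0 i.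
Proof.
rewrite /consv; have -> : lift 0 i = rshift 1 i by exact/val_inj.
by rewrite (@row_mxEr _ 1 1 n).
Qed.

Lemma tailv_consv t y : tailv (consv t y) = y.
Proof. by apply/rowP => i; rewrite mxE consvS. Qed.

Lemma measurable_consv d (T : measurableType d) (f : T -> R) (g : T -> 'rV[R]_n) :
  measurable_fun setT f -> measurable_fun setT g ->
  measurable_fun [set: T] (fun x => consv (f x) (g x)).
Proof.
move=> mf mg; apply: measurable_rowvP => i.
case: (unliftP 0 i) => [j|] ->.
  under eq_fun do rewrite consvS.
  by apply: (measurableT_comp (measurable_coord j)).
by under eq_fun do rewrite consv0.
Qed.

Lemma measurable_uncurry_consv :
  measurable_fun [set: R * 'rV[R]_n] (fun p => consv p.1 p.2).
Proof. by apply: measurable_consv; [exact: measurable_fst|exact: measurable_snd]. Qed.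

Lemma measurable_tailv : measurable_fun [set: 'rV[R]_n.+1] tailv.
Proof.
apply: measurable_rowvP => i.
by under eq_fun do rewrite mxE; exact: measurable_coord.
Qed.

End consv.

Section cons_measure.
Context {R : realType} {n : nat}.
Context (m : {sigma_finite_measure set 'rV[R]_n -> \bar R}).

Definition cons_measure : set 'rV[R]_n.+1 -> \bar R :=
  pushforward ((@lebesgue_measure R) \x m)%E (fun p => consv p.1 p.2).

Let cons_measure0 : cons_measure set0 = 0%E.
Proof. by rewrite /cons_measure /pushforward preimage_set0 measure0. Qed.

Let cons_measure_ge0 A : (0 <= cons_measure A)%E.
Proof. by rewrite /cons_measure /pushforward; exact: measure_ge0. Qed.

Let cons_measure_sigma_additive : semi_sigma_additive cons_measure.
Proof.
move=> F mF tF mUF; rewrite /cons_measure /pushforward preimage_bigcup.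
apply: measure_semi_sigma_additive.
- by move=> k; rewrite -[X in measurable X]setTI; exact: measurable_uncurry_consv.
- apply/trivIsetP => /= i j _ _ ij; rewrite -preimage_setI.
  by move/trivIsetP : tF => /(_ _ _ _ _ ij) ->//; rewrite preimage_set0.
- rewrite -preimage_bigcup -[X in measurable X]setTI.
  exact: measurable_uncurry_consv.
Qed.

HB.instance Definition _ := isMeasure.Build _ _ _ cons_measure
  cons_measure0 cons_measure_ge0 cons_measure_sigma_additive.

Let cons_measure_sigma_finite : sigma_finite setT cons_measure.
Proof.
have /sigma_finiteP[F [FT ndF Foo]] := sigma_finiteT (@lebesgue_measure R).
have /sigma_finiteP[G [GT ndG Goo]] := sigma_finiteT m.
pose h (u : 'rV[R]_n.+1) := (u 0 0, tailv u).
have mh : measurable_fun setT h.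
  by apply: measurable_fun_pair; [exact: measurable_coord|exact: measurable_tailv].
exists (fun k => h @^-1` (F k `*` G k)).
  rewrite -preimage_bigcup (_ : \bigcup_k _ = setT) ?preimage_setT//.
  rewrite -setXTT FT GT predeqE => -[x y]; split.
    by move=> [k _ []/= ? ?]; split; exists k.
  move=> [/= [k _ Fnx] [l _ Gky]]; exists (maxn k l) => //; split.
  - by move: x Fnx; exact/subsetPset/ndF/leq_maxl.
  - by move: y Gky; exact/subsetPset/ndG/leq_maxr.
move=> k; have [mF Fk] := Foo k; have [mG Gk] := Goo k.
have mFG : measurable (F k `*` G k) by exact: measurableX.
split; first by rewrite -[X in measurable X]setTI; exact: mh.
rewrite /cons_measure /pushforward -comp_preimage.
rewrite (_ : _ \o _ = id); last first.
  by apply/funext => -[t y] /=; rewrite /h /= consv0 tailv_consv.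
by rewrite preimage_id product_measure1E// lte_mul_pinfty// ge0_fin_numE.
Qed.

HB.instance Definition _ := Measure_isSigmaFinite.Build _ _ _ cons_measure
  cons_measure_sigma_finite.

End cons_measure.

Section rvm.
Context {R : realType}.

(** A genuine measure behind [volume], which is only an iterated integral of set functions.
    Sigma-finiteness is carried along because each product with one more line requires it. *)
Fixpoint rvm (n : nat) : {sigma_finite_measure set 'rV[R]_n -> \bar R} :=
  match n return {sigma_finite_measure set 'rV[R]_n -> \bar R} with
  | 0 => [the {sigma_finite_measure set 'rV[R]_0 -> \bar R} of \d_(0 : 'rV[R]_0)]
  | n'.+1 => [the {sigma_finite_measure set 'rV[R]_n'.+1 -> \bar R} of cons_measure (rvm n')]
  end.

Lemma measurable_section n (S : set 'rV[R]_n.+1) t :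
  measurable S -> measurable [set y | S (consv t y)].
Proof.
move=> mS; rewrite -[X in measurable X]setTI.
by apply: (measurable_consv (measurable_cst t) (@measurable_id _ _ _)).
Qed.

Lemma rvmS n (S : set 'rV[R]_n.+1) :
  rvm n.+1 S = (\int[@lebesgue_measure R]_t rvm n [set y | S (consv t y)])%E.
Proof.
rewrite /= /cons_measure /pushforward /product_measure1 /=.
apply: eq_integral => t _; congr (rvm n _).
by apply/seteqP; split => y; rewrite /xsection /= inE.
Qed.

Lemma volumeE n (S : set 'rV[R]_n) : measurable S -> volume S = rvm n S.
Proof.
elim: n S => [|n IH] S mS; first by rewrite /= diracE indicE.
rewrite rvmS /=; apply: eq_integral => t _; apply: IH.
exact: measurable_section.
Qed.

(** Uniqueness of the product measure allows the first coordinate to be integrated innermost, the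
    order in which a shear of that coordinate is a translation. *)
Lemma rvm_swap n (S : set 'rV[R]_n.+1) : measurable S ->
  rvm n.+1 S = (\int[rvm n]_y @lebesgue_measure R [set t | S (consv t y)])%E.
Proof.
move=> mS; have mc := @measurable_uncurry_consv R n.
have mS' : measurable ((fun p : R * 'rV[R]_n => consv p.1 p.2) @^-1` S).
  by rewrite -[X in measurable X]setTI; exact: mc.
transitivity ((@lebesgue_measure R \x^ rvm n)%E
   ((fun p : R * 'rV[R]_n => consv p.1 p.2) @^-1` S)).
  rewrite /= /cons_measure /pushforward.
  apply: product_measure_unique => // A B mA mB; exact: product_measure2E.
rewrite /product_measure2; apply: eq_integral => y _ /=; congr lebesgue_measure.
by apply/seteqP; split => t; rewrite /ysection /= inE.
Qed.

End rvm.

(** * Affine and linear changes of variables *)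

Lemma lebesgue_affine {R : realType} (a b : R) (S : set R) : a != 0 -> measurable S ->
  (lebesgue_measure [set t | S (a * t + b)%R] = `|a|^-1%:E * lebesgue_measure S)%E.
Proof.
move=> a0 mS; pose h t := a * t + b.
have mh : measurable_fun setT h.
  by apply: measurable_funD => //; exact: measurable_funM.
have itv_pos x y : 0 < a ->
    [set t | h t \in `]x, y]] = `](x - b) / a, (y - b) / a]%classic.
  move=> a0'; apply/seteqP; split => t /=; rewrite !in_itv /= /h.
    by rewrite ltr_pdivrMr// ler_pdivlMr// ltrBlDr lerBrDr mulrC.
  by rewrite ltr_pdivrMr// ler_pdivlMr// ltrBlDr lerBrDr mulrC.
have itv_neg x y : a < 0 ->
    [set t | h t \in `]x, y]] = `[(y - b) / a, (x - b) / a[%classic.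
  move=> a0'; apply/seteqP; split => t /=; rewrite !in_itv /= /h.
    by rewrite ler_ndivrMr// ltr_ndivlMr// ltrBlDr lerBrDr mulrC andbC.
  by rewrite ler_ndivrMr// ltr_ndivlMr// ltrBlDr lerBrDr mulrC andbC.
pose nu0 := pushforward (@lebesgue_measure R) (h : R -> measurableTypeR R).
pose nu : {measure set (measurableTypeR R) -> \bar R} :=
  HB.pack_for {measure set (measurableTypeR R) -> \bar R} nu0
    (isMeasure.Build _ _ _ nu0 (measure0 _) (measure_ge0 _) (measure_semi_sigma_additive (s := _))).
(* Lebesgue measure is determined by the intervals []x, y]]. For a < 0 their preimages are half-open
   on the other side, with the same length. *)
have -> : lebesgue_measure S = mscale (NngNum (normr_ge0 a)) (nu mh) S.
  apply: lebesgue_measure_unique => //= _ [[x y] _ <-]; rewrite /mscale /=.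
  have -> : nu0 `]x, y]%classic = lebesgue_measure [set t | h t \in `]x, y]] by [].
  rewrite lebesgue_measure_itv /= lte_fin.
  have [a0'|a0'|a0'] := ltgtP a 0; last by rewrite a0' eqxx in a0.
  - rewrite itv_neg// lebesgue_measure_itv /= lte_fin.
    rewrite ltr_nM2r ?invr_lt0// ltrD2r; case: ifPn => _; last by rewrite mule0.
    by rewrite -EFinM; congr EFin; rewrite ltr0_norm//; field; exact: ltr0_neq0.
  - rewrite itv_pos// lebesgue_measure_itv /= lte_fin.
    rewrite ltr_pM2r ?invr_gt0// ltrD2r; case: ifPn => _; last by rewrite mule0.
    by rewrite -EFinM; congr EFin; rewrite gtr0_norm//; field; exact: lt0r_neq0.
by rewrite /mscale /= muleA -EFinM mulVf ?normr_eq0// mul1e.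
Qed.

Section linear_change.
Context {R : realType}.

(** Only positivity of the factor is recorded: volumes are later divided by each other, so the
    factor never has to be identified with a determinant. *)
Definition scales_volume n (A : 'M[R]_n) := exists2 c : R, 0 < c &
  forall S, measurable S -> (rvm n [set y | S (y *m A)] = c%:E * rvm n S)%E.

Lemma measurable_mulmxr n p (A : 'M[R]_(n, p)) :
  measurable_fun [set: 'rV[R]_n] (fun y => y *m A).
Proof.
apply: measurable_rowvP => i; under eq_fun do rewrite mxE.
apply: measurable_sum => j; apply: measurable_funM => //; exact: measurable_coord.
Qed.

Lemma measurable_preimage_mulmxr n p (A : 'M[R]_(n, p)) S :
  measurable S -> measurable [set y : 'rV[R]_n | S (y *m A)].
Proof. by move=> mS; rewrite -[X in measurable X]setTI; exact: measurable_mulmxr. Qed.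

Lemma measurable_addv n (w : 'rV[R]_n) : measurable_fun [set: 'rV[R]_n] (fun y => y + w).
Proof.
apply: measurable_rowvP => i; under eq_fun do rewrite mxE.
by apply: measurable_funD => //; exact: measurable_coord.
Qed.

Lemma scales_volumeM n (A B : 'M[R]_n) :
  scales_volume A -> scales_volume B -> scales_volume (A *m B).
Proof.
move=> [a a0 HA] [b b0 HB]; exists (a * b); first exact: mulr_gt0.
move=> S mS; have mS' := measurable_preimage_mulmxr B mS.
rewrite EFinM -muleA -HB// -HA//; congr (rvm n _).
by apply/seteqP; split => y /=; rewrite mulmxA.
Qed.

Lemma ge0_integral_affine (a b : R) (f : R -> \bar R) : a != 0 ->
  measurable_fun setT f -> (forall t, 0 <= f t)%E ->
  (\int[@lebesgue_measure R]_t f (a * t + b)%R =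
    `|a|^-1%:E * \int[@lebesgue_measure R]_t f t)%E.
Proof.
move=> a0 mf f0; pose h t := a * t + b.
have mh : measurable_fun setT h.
  by apply: measurable_funD => //; exact: measurable_funM.
pose c : {nonneg R} := NngNum (normr_ge0 a^-1).
transitivity (\int[pushforward (@lebesgue_measure R)
    (h : measurableTypeR R -> measurableTypeR R)]_y f y)%E.
  by rewrite ge0_integral_pushforward// ?preimage_setT.
transitivity (\int[mscale c (@lebesgue_measure R)]_y f y)%E.
  apply: eq_measure_integral => //= A mA _.
  by rewrite /pushforward /mscale /= normfV -(lebesgue_affine b).
by rewrite ge0_integral_mscale//= normfV.
Qed.

Lemma measurable_rvm_section n (S : set 'rV[R]_n.+1) : measurable S ->
  measurable_fun [set: R] (fun t => rvm n [set y | S (consv t y)]).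
Proof.
move=> mS; have mc := @measurable_uncurry_consv R n.
have mS' : measurable ((fun p : R * 'rV[R]_n => consv p.1 p.2) @^-1` S).
  by rewrite -[X in measurable X]setTI; exact: mc.
rewrite (_ : (fun t => _) = (rvm n) \o
    xsection ((fun p : R * 'rV[R]_n => consv p.1 p.2) @^-1` S)).
  exact: measurable_fun_xsection.
apply/funext => t /=; congr (rvm n _).
by apply/seteqP; split => y; rewrite /xsection /= inE.
Qed.

Lemma rvm_translate n (w : 'rV[R]_n) S : measurable S ->
  rvm n [set y | S (y + w)] = rvm n S.
Proof.
elim: n w S => [|n IH] w S mS.
  by congr (rvm 0 _); apply/seteqP; split => y /=; rewrite [_ + _]thinmx0 [y]thinmx0.
have E t y : consv t y + w = consv (1 * t + w 0 0) (y + tailv w).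
  apply/rowP => i; rewrite mxE mul1r; case: (unliftP 0 i) => [j|] ->.
    by rewrite !consvS !mxE.
  by rewrite !consv0.
rewrite !rvmS; under eq_integral => t _.
  rewrite /=; under eq_set do rewrite E.
  rewrite (IH _ [set y | S (consv (1 * t + w 0 0) y)]); last exact: measurable_section.
  over.
rewrite (ge0_integral_affine (w 0 0) (oner_neq0 R) (measurable_rvm_section mS)) //.
by rewrite normr1 invr1 mul1e.
Qed.

(** On the slice with first coordinate t the map is D followed by the translation by t b, while t
    itself is multiplied by a. *)
Lemma scales_volume_ublock n (a : R) (b : 'rV[R]_n) (D : 'M[R]_n) :
  a != 0 -> scales_volume D -> scales_volume (block_mx a%:M b 0 D : 'M[R]_(1 + n)).
Proof.
move=> a0 [c c0 HD]; exists (`|a|^-1 * c).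
  by rewrite mulr_gt0// invr_gt0 normr_gt0.
move=> S mS.
have E t y : consv t y *m (block_mx a%:M b 0 D : 'M[R]_(1 + n)) =
    consv (a * t + 0) (y *m D + t *: b).
  rewrite /consv (@mul_row_block _ 1 1 n 1 n) mulmx0 !addr0 mul_scalar_mx.
  by rewrite scale_scalar_mx mul_scalar_mx mulrC addrC.
rewrite (rvmS [set y | _]) (rvmS S); under eq_integral => t _.
  rewrite /=; under eq_set do rewrite E.
  rewrite (HD [set y | S (consv (a * t + 0) (y + t *: b))]); last first.
    rewrite -[X in measurable X]setTI.
    by apply: (measurable_consv (measurable_cst (a * t + 0)) (measurable_addv _)).
  rewrite (rvm_translate _ (S := [set y | S (consv (a * t + 0) y)])); last exact: measurable_section.
  over.
rewrite /= ge0_integralZl//; last 2 first.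
- apply: (measurableT_comp (measurable_rvm_section mS)).
  by apply: measurable_funD => //; exact: measurable_funM.
- exact: ltW.
rewrite (ge0_integral_affine 0 a0 (measurable_rvm_section mS)) //.
by rewrite muleA -EFinM [c * _]mulrC.
Qed.

(** The first coordinate moves by an amount that depends on the others alone, hence by a constant
    once it is integrated innermost. *)
Lemma scales_volume_lblock n (c : 'cV[R]_n) :
  scales_volume (block_mx 1%:M 0 c 1%:M : 'M[R]_(1 + n)).
Proof.
exists 1 => // S mS.
have E t y : consv t y *m (block_mx 1%:M 0 c 1%:M : 'M[R]_(1 + n)) =
    consv (1 * t + (y *m c) 0 0) y.
  rewrite /consv (@mul_row_block _ 1 1 n 1 n) !mulmx1 mulmx0 add0r mul1r.
  by rewrite [X in t%:M + X]mx11_scalar -raddfD.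
rewrite mul1e !rvm_swap//; last exact: measurable_preimage_mulmxr.
apply: eq_integral => y _ /=; under eq_set do rewrite E.
rewrite (lebesgue_affine _ (S := [set t | S (consv t y)])) ?oner_eq0//.
  by rewrite normr1 invr1 mul1e.
rewrite -[X in measurable X]setTI.
by apply: (measurable_consv (@measurable_id _ _ _) (measurable_cst y)).
Qed.

(** Block elimination: a matrix with nonzero pivot is a lower shear times an upper block matrix
    whose corner is the Schur complement, to which the induction hypothesis applies. *)
Lemma unitmx_scales_volume n (A : 'M[R]_n) : A \in unitmx -> scales_volume A.
Proof.
elim: n A => [|n IH] A uA.
  exists 1 => // S mS; rewrite mul1e; congr (rvm 0 _).
  by apply/seteqP; split => y /=; rewrite [_ *m _]thinmx0 [y]thinmx0.
have pivot (B : 'M[R]_(1 + n)) : B \in unitmx -> B 0 0 != 0 -> scales_volume B.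
  move=> uB B0; set a := B 0 0 in B0.
  pose D := drsubmx B - a^-1 *: dlsubmx B *m ursubmx B.
  have BE : B = block_mx 1%:M 0 (a^-1 *: dlsubmx B) 1%:M *m block_mx a%:M (ursubmx B) 0 D.
    rewrite mulmx_block !mul1mx !mul0mx !addr0 mul_mx_scalar scalerA divff// scale1r.
    rewrite /D [X in block_mx _ _ _ X]addrC subrK -[LHS]submxK; congr block_mx.
    rewrite [LHS]mx11_scalar; congr _%:M; rewrite !mxE /a.
    by congr (B _ _); exact/val_inj.
  rewrite BE; apply: scales_volumeM; first exact: scales_volume_lblock.
  apply: scales_volume_ublock => //; apply: IH.
  move: uB; rewrite BE unitmx_mul => /andP[_].
  by rewrite !unitmxE det_ublock unitrM => /andP[].
have ut (r : 'rV[R]_n) : scales_volume (block_mx 1%:M r 0 1%:M : 'M[R]_(1 + n)).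
  apply: scales_volume_ublock; first exact: oner_neq0.
  exists 1 => // S mS; rewrite mul1e; congr (rvm n _).
  by apply/seteqP; split => y /=; rewrite mulmx1.
pose A' : 'M[R]_(1 + n) := A.
(* A zero pivot is repaired by adding a combination of the other rows to the first one. If none
   helped, the whole first column would vanish and the matrix would be singular. *)
have [r r0] : exists r : 'rV[R]_n, (block_mx 1%:M r 0 1%:M *m A' : 'M[R]_(1 + n)) 0 0 != 0.
  have E r : (block_mx 1%:M r 0 1%:M *m A' : 'M[R]_(1 + n)) 0 0 =
      A' 0 0 + (r *m dlsubmx A') 0 0.
    rewrite -{1}[A']submxK mulmx_block !mul1mx.
    have -> : (0 : 'I_(1 + n)) = lshift n (0 : 'I_1) by exact/val_inj.
    by rewrite block_mxEul mxE !mxE.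
  have [A0|A0] := eqVneq (A' 0 0) 0; last by exists 0; rewrite E mul0mx mxE addr0.
  have [/eqP c0|] := boolP (dlsubmx A' == 0).
    have : A' \in unitmx by [].
    suff -> : A' = block_mx 0 (ursubmx A') 0 (drsubmx A').
      by rewrite unitmxE det_ublock det_mx11 mxE mul0r unitr0.
    rewrite -[LHS]submxK c0; congr block_mx.
    apply/matrixP => i j; rewrite !ord1 !mxE -[RHS]A0.
    by congr (A' _ _); exact/val_inj.
  case/matrix0Pn => i [j]; rewrite ord1 => cij.
  by exists (delta_mx 0 i); rewrite E A0 add0r -rowE mxE.
have -> : A = (block_mx 1%:M (- r) 0 1%:M : 'M[R]_(1 + n)) *m (block_mx 1%:M r 0 1%:M *m A').
  rewrite mulmxA mulmx_block !mul1mx !mul0mx !mulmx0 !mulmx1 !add0r addr0 subrr.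
  by rewrite -scalar_mx_block mul1mx.
apply: scales_volumeM; first exact: ut.
apply: pivot r0; rewrite unitmx_mul uA andbT unitmxE.
by rewrite det_ublock !det1 mulr1 unitr1.
Qed.

(** Here the exact factor matters: in the layer formula the ratio depends on the level, which is
    integrated over. *)
Lemma rvm_scale n (r : R) (S : set 'rV[R]_n) : 0 < r -> measurable S ->
  rvm n [set y | S (r *: y)] = ((r^-1 ^+ n)%:E * rvm n S)%E.
Proof.
move=> r0; elim: n S => [|n IH] S mS.
  rewrite expr0 mul1e; congr (rvm 0 _).
  by apply/seteqP; split => y /=; rewrite [_ *: _]thinmx0 [y]thinmx0.
have E t y : r *: consv t y = consv (r * t + 0) (r *: y).
  apply/rowP => i; rewrite mxE addr0; case: (unliftP 0 i) => [j|] ->.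
    by rewrite !consvS !mxE.
  by rewrite !consv0.
rewrite !rvmS; under eq_integral => t _.
  rewrite /=; under eq_set do rewrite E.
  rewrite (IH [set y | S (consv (r * t + 0) y)]); last exact: measurable_section.
  over.
rewrite /= ge0_integralZl//; last 2 first.
- apply: (measurableT_comp (measurable_rvm_section mS)).
  by apply: measurable_funD => //; exact: measurable_funM.
- by rewrite lee_fin exprn_ge0// invr_ge0 ltW.
rewrite (ge0_integral_affine 0 _ (measurable_rvm_section mS)) ?gt_eqF//.
by rewrite muleA -EFinM exprSr gtr0_norm.
Qed.

End linear_change.

Section measurable_comparison.
Context d (T : measurableType d) (R : realType).
Variables f g : T -> R.
Hypotheses (mf : measurable_fun setT f) (mg : measurable_fun setT g).

Lemma measurable_le_set : measurable [set x | (f x <= g x)%R].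
Proof.
have : measurable_fun setT (g \- f) by exact: measurable_funB.
move=> /(_ measurableT `[0, +oo[%classic (measurable_itv _)).
rewrite setTI; congr measurable; apply/seteqP.
by split => x /=; rewrite in_itv /= andbT subr_ge0.
Qed.

Lemma measurable_lt_set : measurable [set x | (f x < g x)%R].
Proof.
have : measurable_fun setT (g \- f) by exact: measurable_funB.
move=> /(_ measurableT `]0, +oo[%classic (measurable_itv _)).
rewrite setTI; congr measurable; apply/seteqP.
by split => x /=; rewrite in_itv /= andbT subr_gt0.
Qed.

End measurable_comparison.

(** * Gaussian integrals over cones by level sets *)

Section layer_cake.
Context {R : realType} {n : nat}.
Variable Q : 'rV[R]_n -> R.
Hypothesis mQ : measurable_fun [set: 'rV[R]_n] Q.
Hypothesis Q0 : forall y, 0 <= Q y.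
Hypothesis QZ : forall r y, Q (r *: y) = r ^+ 2 * Q y.

Lemma cone_sublevel (D : set 'rV[R]_n) rho : measurable D ->
  (forall r y, 0 < r -> D y -> D (r *: y)) -> 0 < rho ->
  rvm n (D `&` [set y | (Q y <= rho)%R]) =
    ((Num.sqrt rho ^+ n)%:E * rvm n (D `&` [set y | (Q y <= 1)%R]))%E.
Proof.
move=> mD DZ rho0; have s0 : 0 < Num.sqrt rho by rewrite sqrtr_gt0.
rewrite -[Num.sqrt rho in RHS]invrK -rvm_scale ?invr_gt0//; last first.
  apply: measurableI => //.
  exact: measurable_le_set.
congr (rvm n _); apply/seteqP; split => y [] Dy /= Qy; split.
- by apply: DZ; rewrite ?invr_gt0.
- by rewrite /= QZ exprVn sqr_sqrtr ?(ltW rho0)// ler_pdivrMl// mulr1.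
- by rewrite -[y](scalerKV (lt0r_neq0 s0)); exact: DZ.
- by move: Qy; rewrite /= QZ exprVn sqr_sqrtr ?(ltW rho0)// ler_pdivrMl// mulr1.
Qed.

(* [K] does not depend on the cone, so ratios of Gaussian integrals are ratios of volumes. *)
Lemma integral_exp_cone : exists K : \bar R, forall D : set 'rV[R]_n,
  measurable D -> (forall r y, 0 < r -> D y -> D (r *: y)) ->
  (\int[rvm n]_(y in D) (expR (- (Q y / 2)))%:E =
   K * rvm n (D `&` [set y | (Q y <= 1)%R]))%E.
Proof.
(* The condition exp(- Q / 2) >= u is Q <= -2 ln u, so inside a cone this set has [k u] times the
   volume of the part where Q <= 1. *)
pose k (u : R) := (Num.sqrt (- (2 * ln u)) ^+ n).
exists (\int[@lebesgue_measure R]_(u in `]0%R, 1%R[) (k u)%:E)%E.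
move=> D mD DZ.
have me : measurable_fun [set: 'rV[R]_n] (fun y => expR (- (Q y / 2))).
  apply: measurableT_comp; first exact: measurable_expR.
  by apply: measurable_funN; apply: measurable_funM.
(* The region below the graph over D. The bound u < 1 keeps -2 ln u positive, as [cone_sublevel]
   requires, and discards only a null set. *)
pose H := [set p : 'rV[R]_n * R | D p.1] `&` [set p | (0 < p.2)%R] `&`
  [set p | (p.2 < 1)%R] `&` [set p | (p.2 <= expR (- (Q p.1 / 2)))%R].
have mH : measurable H.
  have m1 := @measurable_fst _ _ 'rV[R]_n R.
  have m2 := @measurable_snd _ _ 'rV[R]_n R.
  apply: measurableI; first apply: measurableI; first apply: measurableI.
  - by rewrite -[X in measurable X]setTI; exact: m1.
  - exact: (measurable_lt_set (measurable_cst _) m2).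
  - exact: (measurable_lt_set m2 (measurable_cst _)).
  - exact: (measurable_le_set m2 (measurableT_comp me m1)).
pose f p := (\1_H p : R)%:E.
have mf : measurable_fun setT f by apply/measurable_EFinP; exact: measurable_indic.
have f0 p : (0 <= f p)%E by rewrite lee_fin.
transitivity (\int[rvm n]_y \int[@lebesgue_measure R]_u f (y, u))%E.
  rewrite integral_mkcond; apply: eq_integral => y _; rewrite patchE.
  have -> : (\int[@lebesgue_measure R]_u f (y, u) = lebesgue_measure (xsection H y))%E.
    rewrite -[in RHS](setIT (xsection H y)) -integral_indic//; last exact: measurable_xsection.
    by apply: eq_integral => u _; rewrite /f !indicE mem_xsection.
  case: ifPn => [/set_mem Dy|/negP Dy].
    have e1 : expR (- (Q y / 2)) <= 1 by rewrite expR_le1 oppr_le0 divr_ge0.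
    have [el1|e1'] := ltP (expR (- (Q y / 2))) 1.
      have -> : xsection H y = `]0, expR (- (Q y / 2))]%classic.
        apply/seteqP; split=> u; rewrite /xsection /= inE /H /= in_itv /=.
          by move=> [[[_ ->] _] ->].
        by move=> /andP[u0 ue]; do !split => //; exact: le_lt_trans ue _.
      by rewrite lebesgue_measure_itv /= lte_fin expR_gt0 oppr0 addr0.
    have -> : xsection H y = `]0, 1[%classic.
      apply/seteqP; split=> u; rewrite /xsection /= inE /H /= in_itv /=.
        by move=> [[[_ ->] ->] _].
      by move=> /andP[u0 u1]; do !split => //; exact: le_trans (ltW u1) _.
    rewrite lebesgue_measure_itv /= lte_fin ltr01 oppr0 addr0; congr EFin.
    by apply/eqP; rewrite eq_le e1 e1'.
  rewrite (_ : xsection _ _ = set0) ?measure0//.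
  by apply/seteqP; split=> u //; rewrite /xsection /= inE /H /= => -[[[/mem_set]]].
rewrite fubini_tonelli//= -ge0_integralZr//; last 2 first.
- apply/measurable_EFinP/measurable_funTS/measurable_funX.
  have msq : measurable_fun setT (@Num.sqrt R).
    by apply: continuous_measurable_fun; exact: sqrt_continuous.
  apply: (measurableT_comp msq).
  apply: measurable_funN; apply: measurable_funM => //; exact: measurable_ln.
- by move=> u _; rewrite lee_fin exprn_ge0// sqrtr_ge0.
rewrite [RHS]integral_mkcond; apply: eq_integral => u _; rewrite patchE.
have E : (\int[rvm n]_x f (x, u) = rvm n (ysection H u))%E.
  rewrite -[in RHS](setIT (ysection H u)) -integral_indic//; last exact: measurable_ysection.
  by apply: eq_integral => y _; rewrite /f !indicE mem_ysection.
rewrite E; case: ifPn => [/set_mem|/negP].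
  rewrite /= in_itv /= => /andP[u0 u1]; rewrite -cone_sublevel//; last first.
    by rewrite oppr_gt0 pmulr_rlt0// ln_lt0// u0.
  congr (rvm n _); apply/seteqP; split=> y; rewrite /ysection /= inE /H /=.
    move=> [[[Dy _] _] uy]; split => //; move: uy.
    rewrite -ler_ln ?posrE ?expR_gt0// expRK => h.
    lra.
  move=> [Dy Qy]; do ! split => //.
  rewrite -ler_ln ?posrE ?expR_gt0// expRK; lra.
move=> nu; rewrite (_ : ysection _ _ = set0) ?measure0//.
apply/seteqP; split=> y //; rewrite /ysection /= inE /H /= => -[[[_ u0] u1] _].
by apply: nu; apply/mem_set; rewrite /= in_itv /= u0 u1.
Qed.

End layer_cake.

(** * Integrals of complex-valued functions *)

Notation cRe := (@complex.Re _).
Notation cIm := (@complex.Im _).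

Section complex_basics.
Context {R : realType}.
Implicit Types z w : R[i].

Lemma cReM z w : cRe (z * w) = cRe z * cRe w - cIm z * cIm w.
Proof. by case: z w => a b [c e]. Qed.

Lemma cImM z w : cIm (z * w) = cRe z * cIm w + cIm z * cRe w.
Proof. by case: z w => a b [c e]. Qed.

Lemma cReD z w : cRe (z + w) = cRe z + cRe w.
Proof. by case: z w => a b [c e]. Qed.

Lemma cImD z w : cIm (z + w) = cIm z + cIm w.
Proof. by case: z w => a b [c e]. Qed.

Lemma cReN z : cRe (- z) = - cRe z.
Proof. by case: z. Qed.

Lemma cImN z : cIm (- z) = - cIm z.
Proof. by case: z. Qed.

Lemma cRe_real (x : R) : cRe x%:C = x.
Proof. by []. Qed.

Lemma cIm_real (x : R) : cIm x%:C = 0.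
Proof. by []. Qed.

Lemma complexP z w : cRe z = cRe w -> cIm z = cIm w -> z = w.
Proof. by case: z w => a b [c e] /= -> ->. Qed.

(** The modulus as an element of [R]: the norm on [R[i]] takes its values in [R[i]], whereas
    dominated integrability compares real functions. *)
Definition cnorm z : R := Num.sqrt (cRe z ^+ 2 + cIm z ^+ 2).

Lemma cnormE z : (cnorm z)%:C = `|z|.
Proof. by rewrite normc_def. Qed.

Lemma cnorm_ge0 z : 0 <= cnorm z.
Proof. exact: sqrtr_ge0. Qed.

Lemma cnormM z w : cnorm (z * w) = cnorm z * cnorm w.
Proof. by apply: complexI; rewrite rmorphM /= !cnormE normrM. Qed.

Lemma cnormD z w : cnorm (z + w) <= cnorm z + cnorm w.
Proof. by rewrite -lecR rmorphD /= !cnormE ler_normD. Qed.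

Lemma cnormN z : cnorm (- z) = cnorm z.
Proof. by apply: complexI; rewrite !cnormE normrN. Qed.

Lemma cnorm_real (x : R) : cnorm x%:C = `|x|.
Proof. by rewrite /cnorm cRe_real cIm_real expr0n addr0 sqrtr_sqr. Qed.

Lemma cnorm_prod (I : Type) (r : seq I) (P : pred I) (f : I -> R[i]) :
  cnorm (\prod_(i <- r | P i) f i) = \prod_(i <- r | P i) cnorm (f i).
Proof.
by apply: (big_morph _ cnormM); rewrite -[1]/(1%:C) cnorm_real normr1.
Qed.

Lemma normRe_le z : `|cRe z| <= cnorm z.
Proof. by rewrite -sqrtr_sqr ler_wsqrtr// lerDl sqr_ge0. Qed.

Lemma normIm_le z : `|cIm z| <= cnorm z.
Proof. by rewrite -sqrtr_sqr ler_wsqrtr// lerDr sqr_ge0. Qed.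

Lemma cnorm_le z : cnorm z <= `|cRe z| + `|cIm z|.
Proof.
rewrite -[leRHS]ger0_norm ?addr_ge0// -sqrtr_sqr ler_wsqrtr// sqrrD.
by rewrite !real_normK ?num_real// lerD2r lerDl mulrn_wge0// mulr_ge0.
Qed.

Lemma cexpD z w : cexp (z + w) = cexp z * cexp w.
Proof.
rewrite /cexp cReD cImD expRD cosD sinD.
by apply: complexP; rewrite /= !(mul0r, subr0, addr0, mulr0, add0r); ring.
Qed.

Lemma cexp0 : cexp 0 = 1 :> R[i].
Proof. by rewrite /cexp /= expR0 cos0 sin0 mul1r. Qed.

Lemma cexp_real (x : R) : cexp x%:C = (expR x)%:C.
Proof. by rewrite /cexp /= cos0 sin0 mulr1. Qed.

Lemma cexp_sum (I : Type) (r : seq I) (P : pred I) (f : I -> R[i]) :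
  cexp (\sum_(i <- r | P i) f i) = \prod_(i <- r | P i) cexp (f i).
Proof. by apply: (big_morph _ cexpD); exact: cexp0. Qed.

Lemma cnorm_cexp z : cnorm (cexp z) = expR (cRe z).
Proof.
rewrite /cexp cnormM cnorm_real ger0_norm ?expR_ge0//.
by rewrite /cnorm /= cos2Dsin2 sqrtr1 mulr1.
Qed.

Lemma cRe_cexp z : cRe (cexp z) = expR (cRe z) * cos (cIm z).
Proof. by rewrite /cexp cReM cRe_real cIm_real mul0r subr0. Qed.

Lemma cIm_cexp z : cIm (cexp z) = expR (cRe z) * sin (cIm z).
Proof. by rewrite /cexp cImM cRe_real cIm_real mul0r addr0. Qed.

End complex_basics.

Section cmeasurable.
Context {R : realType} d (T : measurableType d).
Implicit Types f g : T -> R[i].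

Definition cmeasurable f :=
  measurable_fun setT (cRe \o f) /\ measurable_fun setT (cIm \o f).

Lemma cmeasurable_cst z : cmeasurable (fun=> z).
Proof. by split; exact: measurable_cst. Qed.

Lemma cmeasurable_real (h : T -> R) :
  measurable_fun setT h -> cmeasurable (fun x => (h x)%:C).
Proof. by move=> mh; split => //; exact: measurable_cst. Qed.

Lemma cmeasurableD f g :
  cmeasurable f -> cmeasurable g -> cmeasurable (fun x => f x + g x).
Proof.
move=> [f1 f2] [g1 g2]; split; rewrite /comp.
  by under eq_fun do rewrite cReD; exact: measurable_funD.
by under eq_fun do rewrite cImD; exact: measurable_funD.
Qed.

Lemma cmeasurableN f : cmeasurable f -> cmeasurable (fun x => - f x).
Proof.
move=> [f1 f2]; split; rewrite /comp.
  by under eq_fun do rewrite cReN; exact: measurable_funN.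
by under eq_fun do rewrite cImN; exact: measurable_funN.
Qed.

Lemma cmeasurableM f g :
  cmeasurable f -> cmeasurable g -> cmeasurable (fun x => f x * g x).
Proof.
move=> [f1 f2] [g1 g2]; split; rewrite /comp.
  by under eq_fun do rewrite cReM; apply: measurable_funB; exact: measurable_funM.
by under eq_fun do rewrite cImM; apply: measurable_funD; exact: measurable_funM.
Qed.

Lemma cmeasurable_prod (I : Type) (r : seq I) (P : pred I) (F : I -> T -> R[i]) :
  (forall i, cmeasurable (F i)) -> cmeasurable (fun x => \prod_(i <- r | P i) F i x).
Proof.
move=> mF; elim: r => [|i r IH].
  by under [X in cmeasurable X]eq_fun do rewrite big_nil; exact: cmeasurable_cst.
under [X in cmeasurable X]eq_fun do rewrite big_cons; case: (P i) => //.
exact: cmeasurableM.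
Qed.

Lemma cmeasurable_cexp f : cmeasurable f -> cmeasurable (fun x => cexp (f x)).
Proof.
have mcos : measurable_fun setT (@cos R).
  by apply: continuous_measurable_fun; exact: continuous_cos.
have msin : measurable_fun setT (@sin R).
  by apply: continuous_measurable_fun; exact: continuous_sin.
move=> [f1 f2]; split; rewrite /comp.
  under eq_fun do rewrite cRe_cexp.
  apply: measurable_funM; [exact: (measurableT_comp (@measurable_expR R) f1)|].
  exact: (measurableT_comp mcos f2).
under eq_fun do rewrite cIm_cexp.
apply: measurable_funM; [exact: (measurableT_comp (@measurable_expR R) f1)|].
exact: (measurableT_comp msin f2).
Qed.

Lemma measurable_cnorm f : cmeasurable f -> measurable_fun setT (fun x => cnorm (f x)).
Proof.
move=> [f1 f2].
have msq : measurable_fun setT (@Num.sqrt R).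
  by apply: continuous_measurable_fun; exact: sqrt_continuous.
apply: (measurableT_comp msq).
by apply: measurable_funD; exact: measurable_funX.
Qed.

End cmeasurable.

Lemma cmeasurable_comp {R : realType} d d' (T : measurableType d) (U : measurableType d')
  (f : U -> R[i]) (h : T -> U) : cmeasurable f -> measurable_fun setT h ->
  cmeasurable (f \o h).
Proof. by move=> [f1 f2] mh; split; [exact: (measurableT_comp f1 mh)|exact: (measurableT_comp f2 mh)]. Qed.

Section cint.
Context {R : realType} d (T : measurableType d) (mu : {measure set T -> \bar R}).
Implicit Types f g : T -> R[i].

Definition cintegrable f :=
  mu.-integrable setT (EFin \o (cRe \o f)) /\ mu.-integrable setT (EFin \o (cIm \o f)).

(** The analogue of [cintegral] over an arbitrary measure space; on the whole line with Lebesgue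
    measure the two are convertible. *)
Definition cint f : R[i] :=
  Rintegral mu setT (cRe \o f) +i* Rintegral mu setT (cIm \o f).

Lemma cintegrable_cmeasurable f : cintegrable f -> cmeasurable f.
Proof.
by move=> [/measurable_int/measurable_EFinP f1 /measurable_int/measurable_EFinP f2].
Qed.

Lemma le_cintegrable f (h : T -> R) : cmeasurable f ->
  mu.-integrable setT (EFin \o h) -> (forall x, cnorm (f x) <= h x) -> cintegrable f.
Proof.
move=> [f1 f2] ih fh; split.
- apply: (le_integrable _ _ _ ih) => //; first exact/measurable_EFinP.
  move=> x _ /=; rewrite lee_fin; apply: le_trans (normRe_le _) _.
  by apply: le_trans (fh x) _; exact: ler_norm.
- apply: (le_integrable _ _ _ ih) => //; first exact/measurable_EFinP.
  move=> x _ /=; rewrite lee_fin; apply: le_trans (normIm_le _) _.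
  by apply: le_trans (fh x) _; exact: ler_norm.
Qed.

Lemma cintegrable_cnorm f : cintegrable f ->
  mu.-integrable setT (EFin \o (fun x => cnorm (f x))).
Proof.
move=> cf; have [f1 f2] := cf.
have h : mu.-integrable setT (EFin \o (fun x => `|cRe (f x)| + `|cIm (f x)|)).
  rewrite [X in _.-integrable _ X](_ : _ = (fun x => `|(EFin \o (cRe \o f)) x| + `|(EFin \o (cIm \o f)) x|)%E).
    by apply: integrableD => //; exact: integrable_abse.
  by apply/funext.
apply: (le_integrable _ _ _ h) => //.
  by apply/measurable_EFinP; apply: measurable_cnorm; exact: cintegrable_cmeasurable.
move=> x _ /=; rewrite lee_fin ger0_norm ?cnorm_ge0// ger0_norm ?addr_ge0//.
exact: cnorm_le.
Qed.

Lemma eq_cint f g : f =1 g -> cint f = cint g.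
Proof. by move=> /funext ->. Qed.

Lemma cintegrableD f g : cintegrable f -> cintegrable g -> cintegrable (fun x => f x + g x).
Proof.
move=> [f1 f2] [g1 g2]; split.
- rewrite (_ : _ \o _ = (EFin \o (cRe \o f)) \+ (EFin \o (cRe \o g)))%E.
    exact: integrableD.
  by apply/funext => x /=; rewrite cReD.
- rewrite (_ : _ \o _ = (EFin \o (cIm \o f)) \+ (EFin \o (cIm \o g)))%E.
    exact: integrableD.
  by apply/funext => x /=; rewrite cImD.
Qed.

Lemma cintD f g : cintegrable f -> cintegrable g ->
  cint (fun x => f x + g x) = cint f + cint g.
Proof.
move=> [f1 f2] [g1 g2]; apply: complexP; rewrite ?cReD ?cImD /cint /=.
- by rewrite -RintegralD//; apply: eq_Rintegral => x _ /=; rewrite cReD.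
- by rewrite -RintegralD//; apply: eq_Rintegral => x _ /=; rewrite cImD.
Qed.

Lemma cintegrableZ z f : cintegrable f -> cintegrable (fun x => z * f x).
Proof.
move=> cf; apply: (@le_cintegrable _ (fun x => cnorm z * cnorm (f x))).
- by apply: cmeasurableM; [exact: cmeasurable_cst|exact: cintegrable_cmeasurable].
- rewrite (_ : _ \o _ = fun x => ((cnorm z)%:E * (EFin \o (fun x => cnorm (f x))) x)%E)//.
  by apply: integrableZl => //; exact: cintegrable_cnorm.
- by move=> x; rewrite cnormM.
Qed.

Lemma cintZ z f : cintegrable f -> cint (fun x => z * f x) = z * cint f.
Proof.
move=> [f1 f2].
have i1 (c : R) : mu.-integrable setT (EFin \o (fun x => c * cRe (f x))).
  rewrite (_ : _ \o _ = fun x => (c%:E * (EFin \o (cRe \o f)) x)%E)//.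
  exact: integrableZl.
have i2 (c : R) : mu.-integrable setT (EFin \o (fun x => c * cIm (f x))).
  rewrite (_ : _ \o _ = fun x => (c%:E * (EFin \o (cIm \o f)) x)%E)//.
  exact: integrableZl.
apply: complexP; rewrite ?cReM ?cImM /cint /=.
- rewrite -!RintegralZl// -RintegralB//.
  by apply: eq_Rintegral => x _ /=; rewrite cReM.
- rewrite -!RintegralZl// -RintegralD//.
  by apply: eq_Rintegral => x _ /=; rewrite cImM.
Qed.

(** The factor 2 comes from bounding the real and imaginary parts separately; the later estimates do
    not depend on a sharp constant. *)
Lemma cnorm_cint_le f (h : T -> R) : cmeasurable f ->
  mu.-integrable setT (EFin \o h) -> (forall x, cnorm (f x) <= h x) ->
  cnorm (cint f) <= 2 * Rintegral mu setT h.
Proof.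
move=> mf ih fh; have [f1 f2] := le_cintegrable mf ih fh.
apply: le_trans (cnorm_le _) _; rewrite /cint /= mulr2n mulrDl !mul1r.
apply: lerD; apply: le_trans (le_normr_Rintegral _ _) _ => //.
- apply: le_Rintegral => //; first exact: integrable_norm.
  by move=> x _ /=; apply: le_trans (normRe_le _) (fh x).
- apply: le_Rintegral => //; first exact: integrable_norm.
  by move=> x _ /=; apply: le_trans (normIm_le _) (fh x).
Qed.

End cint.

(** * Fubini for complex-valued functions *)

Section fubini_complex.
Context {R : realType} d1 d2 (T1 : measurableType d1) (T2 : measurableType d2).
Variables (m1 : {sigma_finite_measure set T1 -> \bar R})
  (m2 : {sigma_finite_measure set T2 -> \bar R}).

Lemma integrable_fubini_second (f : T1 * T2 -> \bar R) :
  (m1 \x m2)%E.-integrable setT f ->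
  m2.-integrable setT (fun y => (\int[m1]_x f (x, y))%E).
Proof.
move=> f12; have /integrableP[mf _] := f12.
have mG := measurable_fubini_G f12.
have ma : measurable_fun setT (abse \o f) by exact: measurableT_comp.
apply/integrableP; split => //.
have /(proj1 (integrable21ltyP m1 m2 mf)) := f12; apply: le_lt_trans.
apply: ge0_le_integral => //.
- exact: measurableT_comp.
- exact: (measurable_fun_fubini_tonelli_G (m1 := m1) (abse \o f) ma (fun p => abse_ge0 _)).
- move=> y _; apply: le_abse_integral => //.
  exact: (measurableT_comp mf (measurable_pair2 y)).
Qed.

(** Integrability of every section, rather than of almost every one, makes all section integrals
    finite, so that [fine] loses nothing pointwise. *)
Lemma Rintegral_fubini (f : T1 * T2 -> R) :
  (m1 \x m2)%E.-integrable setT (EFin \o f) ->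
  (forall x, m2.-integrable setT (fun y => (f (x, y))%:E)) ->
  (forall y, m1.-integrable setT (fun x => (f (x, y))%:E)) ->
  [/\ m1.-integrable setT (fun x => (Rintegral m2 setT (fun y => f (x, y)))%:E),
      m2.-integrable setT (fun y => (Rintegral m1 setT (fun x => f (x, y)))%:E),
      Rintegral (m1 \x m2)%E setT f = Rintegral m1 setT (fun x => Rintegral m2 setT (fun y => f (x, y))) &
      Rintegral (m1 \x m2)%E setT f = Rintegral m2 setT (fun y => Rintegral m1 setT (fun x => f (x, y)))].
Proof.
move=> f12 f2 f1.
have E1 : (fun x => (Rintegral m2 setT (fun y => f (x, y)))%:E) = (fun x => \int[m2]_y (f (x, y))%:E)%E.
  by apply/funext => x; rewrite /Rintegral fineK//; exact: integrable_fin_num.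
have E2 : (fun y => (Rintegral m1 setT (fun x => f (x, y)))%:E) = (fun y => \int[m1]_x (f (x, y))%:E)%E.
  by apply/funext => y; rewrite /Rintegral fineK//; exact: integrable_fin_num.
split.
- by rewrite E1; exact: (integrable_fubini_F f12).
- by rewrite E2; exact: (integrable_fubini_second f12).
- by rewrite {1 2}/Rintegral E1 -(integral12_prod_meas1 f12).
- by rewrite {1 2}/Rintegral E2 -(integral21_prod_meas1 f12).
Qed.

Lemma cint_fubini (f : T1 * T2 -> R[i]) : cintegrable (m1 \x m2)%E f ->
  (forall x, cintegrable m2 (fun y => f (x, y))) ->
  (forall y, cintegrable m1 (fun x => f (x, y))) ->
  [/\ cintegrable m1 (fun x => cint m2 (fun y => f (x, y))),
      cintegrable m2 (fun y => cint m1 (fun x => f (x, y))),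
      cint (m1 \x m2)%E f = cint m1 (fun x => cint m2 (fun y => f (x, y))) &
      cint (m1 \x m2)%E f = cint m2 (fun y => cint m1 (fun x => f (x, y)))].
Proof.
move=> [fR fI] f2 f1.
have [a1 a2 a3 a4] := Rintegral_fubini fR (fun x => (f2 x).1) (fun y => (f1 y).1).
have [b1 b2 b3 b4] := Rintegral_fubini fI (fun x => (f2 x).2) (fun y => (f1 y).2).
by split => //; rewrite /cint ?a3 ?b3 ?a4 ?b4// -a3 -b3 a4 b4.
Qed.

Lemma cint_prod_mul (f : T1 -> R[i]) (g : T2 -> R[i]) :
  cintegrable m1 f -> cintegrable m2 g ->
  cintegrable (m1 \x m2)%E (fun p => f p.1 * g p.2) /\
  cint (m1 \x m2)%E (fun p => f p.1 * g p.2) = cint m1 f * cint m2 g.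
Proof.
move=> cf cg.
have mfg : cmeasurable (fun p : T1 * T2 => f p.1 * g p.2).
  apply: cmeasurableM.
    exact: (cmeasurable_comp (cintegrable_cmeasurable cf) measurable_fst).
  exact: (cmeasurable_comp (cintegrable_cmeasurable cg) measurable_snd).
have nf := cintegrable_cnorm cf; have ng := cintegrable_cnorm cg.
have ifg : cintegrable (m1 \x m2)%E (fun p => f p.1 * g p.2).
  apply: (le_cintegrable mfg (h := fun p => cnorm (f p.1) * cnorm (g p.2))); last first.
    by move=> p; rewrite cnormM.
  have mn : measurable_fun setT (EFin \o (fun p : T1 * T2 => cnorm (f p.1) * cnorm (g p.2))).
    apply/measurable_EFinP; apply: (eq_measurable_fun (fun p : T1 * T2 => cnorm (f p.1 * g p.2))).
      by move=> p _; rewrite cnormM.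
    exact: measurable_cnorm.
  apply (proj2 (integrable12ltyP m1 m2 mn)).
  under eq_integral => x _.
    under eq_integral => y _ do
      rewrite /= ger0_norm ?mulr_ge0 ?cnorm_ge0// EFinM.
    rewrite ge0_integralZl//; last 3 first.
    - by have /integrableP[mng _] := ng.
    - by move=> y _; rewrite lee_fin cnorm_ge0.
    - by rewrite lee_fin cnorm_ge0.
    over.
  have Ig : (\int[m2]_y (cnorm (g y))%:E)%E \is a fin_num by exact: integrable_fin_num.
  rewrite ge0_integralZr//; last 3 first.
  - by have /integrableP[mnf _] := nf.
  - by move=> y _; rewrite lee_fin cnorm_ge0.
  - by apply: integral_ge0 => y _; rewrite lee_fin cnorm_ge0.
  have If : (\int[m1]_y (cnorm (f y))%:E)%E \is a fin_num by exact: integrable_fin_num.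
  by rewrite -ge0_fin_numE ?fin_numM// mule_ge0//; apply: integral_ge0 => y _; rewrite lee_fin cnorm_ge0.
split=> //.
have [||_ _ -> _] := cint_fubini ifg.
- by move=> x /=; exact: (cintegrableZ (f x) cg).
- move=> y; rewrite [X in cintegrable _ X](_ : _ = fun x => g y * f x).
    exact: cintegrableZ.
  by apply/funext => x; rewrite mulrC.
- rewrite mulrC -cintZ//; apply: eq_cint => x /=.
  by rewrite cintZ// mulrC.
Qed.

End fubini_complex.

Section cint_rvm.
Context {R : realType}.

Lemma cint_rvmS n (f : 'rV[R]_n.+1 -> R[i]) : cmeasurable f ->
  cintegrable (@lebesgue_measure R \x rvm n)%E (fun p => f (consv p.1 p.2)) ->
  cintegrable (rvm n.+1) f /\
  cint (rvm n.+1) f = cint (@lebesgue_measure R \x rvm n)%E (fun p => f (consv p.1 p.2)).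
Proof.
move=> [mR mI] [iR iI]; have mc := @measurable_uncurry_consv R n.
have tr (g : 'rV[R]_n.+1 -> \bar R) : measurable_fun setT g ->
    (@lebesgue_measure R \x rvm n)%E.-integrable setT (fun p => g (consv p.1 p.2)) ->
    (rvm n.+1).-integrable setT g.
  move=> mg /integrableP[_ ig]; apply/integrableP; split => //.
  by rewrite ge0_integral_pushforward ?preimage_setT//; exact: measurableT_comp.
have jR : (rvm n.+1).-integrable setT (EFin \o (cRe \o f)).
  by apply: tr => //; exact/measurable_EFinP.
have jI : (rvm n.+1).-integrable setT (EFin \o (cIm \o f)).
  by apply: tr => //; exact/measurable_EFinP.
split => //; rewrite /cint /Rintegral; congr (_ +i* _); congr fine.
- by rewrite integral_pushforward ?preimage_setT//; exact/measurable_EFinP.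
- by rewrite integral_pushforward ?preimage_setT//; exact/measurable_EFinP.
Qed.

Lemma cint_rvm_prod n (f : 'I_n -> R -> R[i]) :
  (forall i, cintegrable (@lebesgue_measure R) (f i)) ->
  cintegrable (rvm n) (fun u => \prod_i f i (u 0 i)) /\
  cint (rvm n) (fun u => \prod_i f i (u 0 i)) =
    \prod_i cint (@lebesgue_measure R) (f i).
Proof.
elim: n f => [|n IH] f cf.
  split.
    rewrite [X in cintegrable _ X](_ : _ = fun=> 1); last first.
      by apply/funext => u; rewrite big_ord0.
    apply: (@le_cintegrable _ _ _ _ _ (fun=> 1)).
    - exact: cmeasurable_cst.
    - apply/integrableP; split; first by apply/measurable_EFinP.
      by rewrite integral_dirac//= diracE mem_set// mul1e normr1 ltry.
    - by move=> u; rewrite -[1]/(1%:C) cnorm_real normr1.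
  rewrite big_ord0 [X in cint _ X](_ : _ = fun=> 1); last by apply/funext => u; rewrite big_ord0.
  rewrite /cint /Rintegral; apply: complexP => /=.
  - by rewrite integral_cst// [X in (_ * X)%E]diracT mule1.
  - by rewrite integral_cst// mul0e.
have [i2 e2] := IH _ (fun i => cf (lift ord0 i)).
have [i12 e12] := cint_prod_mul (cf ord0) i2.
have mF : cmeasurable (fun u : 'rV[R]_n.+1 => \prod_i f i (u 0 i)).
  apply: cmeasurable_prod => i.
  exact: (cmeasurable_comp (cintegrable_cmeasurable (cf i)) (measurable_coord i)).
have E : (fun p : R * 'rV[R]_n => \prod_i f i (consv p.1 p.2 0 i)) =
   (fun p => f ord0 p.1 * (\prod_i f (lift ord0 i) (p.2 0 i))).
  apply/funext => p; rewrite big_ord_recl consv0; congr (_ * _).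
  by apply: eq_bigr => i _; rewrite consvS.
have [|a b] := cint_rvmS mF; first by rewrite E.
by split => //; rewrite b E e12 e2 big_ord_recl.
Qed.

End cint_rvm.

(** * Affine substitutions and the fundamental theorem of calculus on the line *)

Section real_derivatives.
Context {R : realType}.
Implicit Types f g : R -> R.

Lemma is_derive_addr x f g df dg :
  is_derive x (1 : R) f df -> is_derive x (1 : R) g dg ->
  is_derive x (1 : R) (fun t => f t + g t) (df + dg).
Proof. exact: is_deriveD. Qed.

Lemma is_derive_oppr x f df :
  is_derive x (1 : R) f df -> is_derive x (1 : R) (fun t => - f t) (- df).
Proof. exact: is_deriveN. Qed.

Lemma is_derive_compr x f g df dg :
  is_derive x (1 : R) f df -> is_derive (f x) (1 : R) g dg ->
  is_derive x (1 : R) (fun t => g (f t)) (df * dg).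
Proof.
by move=> hf hg; rewrite mulrC; exact: is_derive1_comp.
Qed.

Lemma is_derive_continuous f df :
  (forall x, is_derive x (1 : R) f (df x)) -> continuous f.
Proof.
move=> dF x; apply: differentiable_continuous; apply/derivable1_diffP.
by have [] := dF x.
Qed.

End real_derivatives.

Section cint_line.
Context {R : realType}.
Local Notation leb := (@lebesgue_measure R).

Lemma integral_affine (a b : R) (f : R -> \bar R) : a != 0 -> measurable_fun setT f ->
  (\int[leb]_t f (a * t + b)%R = `|a|^-1%:E * \int[leb]_t f t)%E.
Proof.
move=> a0 mf; rewrite integralE [in RHS]integralE.
have -> : (fun t => f (a * t + b)%R)^\+%E = (fun t => f^\+ (a * t + b)%R)%E.
  by apply/funext => t; rewrite !funeposE.
have -> : (fun t => f (a * t + b)%R)^\-%E = (fun t => f^\- (a * t + b)%R)%E.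
  by apply/funext => t; rewrite !funenegE.
rewrite (ge0_integral_affine b a0 (measurable_funepos mf))//.
rewrite (ge0_integral_affine b a0 (measurable_funeneg mf))//.
(* When the difference of the two parts is undefined, both are +oo and stay so after scaling by a
   positive number. *)
have [Pf|Pf] := boolP ((\int[leb]_t f^\+ t)%E +? - (\int[leb]_t f^\- t)%E)%E.
  by symmetry; apply: muleBr.
have a1 : 0 < `|a|^-1 by rewrite invr_gt0 normr_gt0.
move: Pf; have : (0 <= \int[leb]_t f^\+ t)%E by exact: integral_ge0.
have : (0 <= \int[leb]_t f^\- t)%E by exact: integral_ge0.
case: (\int[leb]_t f^\+ t)%E => [r| |] //; case: (\int[leb]_t f^\- t)%E => [r'| |] // _ _ _.
by rewrite !gt0_muley ?lte_fin//= gt0_muleNy ?lte_fin.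
Qed.

Lemma integrable_affine (a b : R) (f : R -> \bar R) : a != 0 ->
  leb.-integrable setT f -> leb.-integrable setT (fun t => f (a * t + b)%R).
Proof.
move=> a0 /integrableP[mf intf].
have mh : measurable_fun setT (fun t : R => a * t + b).
  by apply: measurable_funD => //; exact: measurable_funM.
apply/integrableP; split; first exact: (measurableT_comp mf mh).
have ma : measurable_fun setT (fun t => `|f t|)%E by exact: measurableT_comp.
rewrite (ge0_integral_affine b a0 ma) => [|t]; last exact: abse_ge0.
by rewrite lte_mul_pinfty// lee_fin invr_ge0.
Qed.

Lemma cint_affine (a b : R) (f : R -> R[i]) : a != 0 -> cintegrable leb f ->
  cintegrable leb (fun t => f (a * t + b)) /\
  cint leb (fun t => f (a * t + b)) = (`|a|^-1)%:C * cint leb f.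
Proof.
move=> a0 [fR fI]; split.
  split; first exact: (integrable_affine b a0 fR).
  exact: (integrable_affine b a0 fI).
have /integrableP[mR _] := fR; have /integrableP[mI _] := fI.
have eR := integral_affine b a0 mR.
have eI := integral_affine b a0 mI.
apply: complexP; rewrite ?cReM ?cImM ?cRe_real ?cIm_real mul0r ?subr0 ?addr0 /cint /=.
- rewrite /Rintegral; transitivity (fine ((`|a|^-1)%:E * \int[leb]_t (EFin \o (cRe \o f)) t)%E).
    by rewrite -eR.
  by rewrite fineM// integrable_fin_num.
- rewrite /Rintegral; transitivity (fine ((`|a|^-1)%:E * \int[leb]_t (EFin \o (cIm \o f)) t)%E).
    by rewrite -eI.
  by rewrite fineM// integrable_fin_num.
Qed.

Lemma is_derive_expRN (C x : R) :
  is_derive x (1 : R) (fun t => C * expR (- t)) (- C * expR (- x)).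
Proof.
by apply: is_derive_eq; rewrite /GRing.scale /= mulrN1 mulrN mulNr.
Qed.

Lemma integral_expRN (C : R) : 0 <= C ->
  leb.-integrable `[0, +oo[ (fun t => (C * expR (- t))%:E) /\
  Rintegral leb `[0, +oo[ (fun t => C * expR (- t)) = C.
Proof.
move=> C0.
have ce := is_derive_continuous (is_derive_expRN C).
have E : (\int[leb]_(t in `[0%R, +oo[) (C * expR (- t))%:E = C%:E)%E.
  rewrite (@ge0_continuous_FTC2y _ _ (fun t : R => - C * expR (- t)) 0 0).
  - by rewrite oppr0 expR0 mulr1 -EFinB opprK add0r.
  - by move=> x _; rewrite mulr_ge0// expR_ge0.
  - exact: continuous_subspaceT.
  - rewrite -[X in _ --> X](mulr0 (- C)); apply: cvgM; first exact: cvg_cst.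
    exact: cvgr_expR.
  - by move=> x _; have [] := is_derive_expRN (- C) x.
  - by apply: cvg_at_right_filter; exact: (is_derive_continuous (is_derive_expRN (- C))).
  - move=> x _; rewrite derive1E.
    have -> := @derive_val _ _ _ _ _ _ _ (is_derive_expRN (- C) x).
    by rewrite opprK.
split; last by rewrite /Rintegral E.
apply/integrableP; split.
  by apply/measurable_EFinP/measurable_funTS; exact: continuous_measurable_fun.
under eq_integral => x _ do rewrite gee0_abs ?lee_fin ?mulr_ge0 ?expR_ge0//.
by rewrite E ltry.
Qed.

(** Adding C exp(- x), whose integral over the half-line is C, makes the integrand nonnegative. The
    fundamental theorem for nonnegative functions then applies with primitive F - C exp(- x), and C
    is subtracted again. *)
Lemma continuous_dominated_FTC (F f : R -> R) (C : R) :
  (forall x, is_derive x (1 : R) F (f x)) -> continuous f ->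
  (forall x, 0 <= x -> `|F x| <= C * expR (- x)) ->
  (forall x, 0 <= x -> `|f x| <= C * expR (- x)) ->
  Rintegral leb `[0, +oo[ f = - F 0.
Proof.
move=> dF cf FC fC.
have C0 : 0 <= C.
  by have := FC 0 (lexx 0); rewrite oppr0 expR0 mulr1; apply: le_trans.
have [iC eC] := integral_expRN C0.
have cE := is_derive_continuous (is_derive_expRN C).
have dF' x : derivable F x 1 by have [] := dF x.
have cF : continuous F.
  by move=> x; apply: differentiable_continuous; exact/derivable1_diffP.
have if_ : leb.-integrable `[0, +oo[ (EFin \o f).
  apply: (le_integrable _ _ _ iC) => //.
    by apply/measurable_EFinP/measurable_funTS; exact: continuous_measurable_fun.
  move=> x; rewrite /= in_itv /= andbT => x0; rewrite lee_fin.
  by apply: le_trans (fC x x0) _; exact: ler_norm.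
have dG x : is_derive x (1 : R) (fun t => F t - C * expR (- t)) (f x - (- C * expR (- x))).
  by apply: is_derive_addr => //; apply: is_derive_oppr; exact: is_derive_expRN.
have : Rintegral leb `[0, +oo[ (fun t => f t + C * expR (- t)) = C - F 0.
  rewrite /Rintegral (@ge0_continuous_FTC2y _ _ (fun t => F t - C * expR (- t)) 0 0).
  - by rewrite oppr0 expR0 mulr1 /= opprB add0r.
  - by move=> x x0; rewrite -lerBlDr sub0r lerNl; apply: le_trans (fC x x0); rewrite -normrN ler_norm.
  - by apply: continuous_subspaceT => x; apply: cvgD; [exact: cf|exact: cE].
  - have eC0 : C * expR (- x) @[x --> +oo%R] --> (0 : R).
      rewrite -[X in _ --> X](mulr0 C); apply: cvgM; first exact: cvg_cst.
      exact: cvgr_expR.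
    rewrite -[X in _ --> X](subrr (0 : R)); apply: cvgB => //.
    apply: (@squeeze_cvgr _ _ _ _ (fun x => - (C * expR (- x))) (fun x => C * expR (- x))) => //.
      near=> x; rewrite -ler_norml; apply: FC.
      by near: x; exact: nbhs_pinfty_ge.
    by rewrite -[X in _ --> X]oppr0; exact: cvgN.
  - by move=> x _; have [] := dG x.
  - by apply: cvg_at_right_filter; exact: (is_derive_continuous dG).
  - move=> x _; rewrite derive1E.
    have -> := @derive_val _ _ _ _ _ _ _ (dG x).
    by rewrite mulNr opprK.
by rewrite RintegralD// eC => /(canRL (addrK _)) ->; ring.
Unshelve. all: end_near. Qed.

Lemma continuous_FTC01 (F f : R -> R) :
  (forall x, is_derive x (1 : R) F (f x)) -> continuous f ->
  Rintegral leb `[0, 1] f = F 1 - F 0.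
Proof.
move=> dF cf.
have dF' x : derivable F x 1 by have [] := dF x.
have cF : continuous F.
  by move=> x; apply: differentiable_continuous; exact/derivable1_diffP.
rewrite /Rintegral (@continuous_FTC2 _ f F 0 1)//.
- exact: continuous_subspaceT.
- split; first by move=> x _.
  + by apply: cvg_at_right_filter; exact: cF.
  + by apply: cvg_at_left_filter; exact: cF.
- by move=> x _; rewrite derive1E; apply: derive_val.
Qed.

End cint_line.

(** * The complex Gaussian integral over a half-line *)

Section complex_derivatives.
Context {R : realType}.
Local Notation leb := (@lebesgue_measure R).
Implicit Types f g : R -> R[i].

Definition cderiv f x df :=
  is_derive x (1 : R) (fun t => cRe (f t)) (cRe df) /\
  is_derive x (1 : R) (fun t => cIm (f t)) (cIm df).

Lemma cderiv_cst z x : cderiv (fun=> z) x 0.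
Proof. by split; exact: is_derive_cst. Qed.

Lemma cderiv_real x : cderiv (fun t => t%:C) x 1.
Proof. by split; [exact: is_derive_id|exact: is_derive_cst]. Qed.

Lemma cderivD f g x df dg : cderiv f x df -> cderiv g x dg ->
  cderiv (fun t => f t + g t) x (df + dg).
Proof.
move=> [f1 f2] [g1 g2]; split.
  by under eq_fun do rewrite cReD; rewrite cReD; exact: is_derive_addr.
by under eq_fun do rewrite cImD; rewrite cImD; exact: is_derive_addr.
Qed.

Lemma cderivN f x df : cderiv f x df -> cderiv (fun t => - f t) x (- df).
Proof.
move=> [f1 f2]; split.
  by under eq_fun do rewrite cReN; rewrite cReN; exact: is_derive_oppr.
by under eq_fun do rewrite cImN; rewrite cImN; exact: is_derive_oppr.
Qed.

Lemma cderivM f g x df dg : cderiv f x df -> cderiv g x dg ->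
  cderiv (fun t => f t * g t) x (df * g x + f x * dg).
Proof.
move=> [f1 f2] [g1 g2]; split.
  under eq_fun do rewrite cReM.
  by apply: is_derive_eq; rewrite /GRing.scale /= cReD !cReM; ring.
under eq_fun do rewrite cImM.
by apply: is_derive_eq; rewrite /GRing.scale /= cImD !cImM; ring.
Qed.

Lemma cderiv_cexp f x df : cderiv f x df ->
  cderiv (fun t => cexp (f t)) x (df * cexp (f x)).
Proof.
move=> [f1 f2].
have e1 := is_derive_compr f1 (is_derive_expR (cRe (f x))).
split.
  under eq_fun do rewrite cRe_cexp.
  by apply: is_derive_eq; rewrite /GRing.scale /= cReM cRe_cexp cIm_cexp; ring.
under eq_fun do rewrite cIm_cexp.
by apply: is_derive_eq; rewrite /GRing.scale /= cImM cRe_cexp cIm_cexp; ring.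
Qed.

Lemma cderiv_eq f x df df' : cderiv f x df -> df = df' -> cderiv f x df'.
Proof. by move=> ? <-. Qed.

(** The derivative f' supplies the continuity of both components of f. *)
Lemma cintegral_FTC01 (F f f' : R -> R[i]) :
  (forall x, cderiv F x (f x)) -> (forall x, cderiv f x (f' x)) ->
  cintegral `[0, 1] f = F 1 - F 0.
Proof.
move=> dF df; apply: complexP; rewrite ?cReD ?cImD ?cReN ?cImN /cintegral /=.
- apply: (@continuous_FTC01 R (fun t => cRe (F t))) => [x|]; first exact: (dF x).1.
  exact: (is_derive_continuous (fun x => (df x).1)).
- apply: (@continuous_FTC01 R (fun t => cIm (F t))) => [x|]; first exact: (dF x).2.
  exact: (is_derive_continuous (fun x => (df x).2)).
Qed.

Lemma cintegral_dominated_FTC (F f f' : R -> R[i]) (C : R) :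
  (forall x, cderiv F x (f x)) -> (forall x, cderiv f x (f' x)) ->
  (forall x, 0 <= x -> cnorm (F x) <= C * expR (- x)) ->
  (forall x, 0 <= x -> cnorm (f x) <= C * expR (- x)) ->
  cintegral `[0, +oo[ f = - F 0.
Proof.
move=> dF df FC fC; apply: complexP; rewrite ?cReN ?cImN /cintegral /=.
- apply: (@continuous_dominated_FTC R (fun t => cRe (F t)) _ C) => [x||x x0|x x0].
  + exact: (dF x).1.
  + exact: (is_derive_continuous (fun x => (df x).1)).
  + exact: le_trans (normRe_le _) (FC x x0).
  + exact: le_trans (normRe_le _) (fC x x0).
- apply: (@continuous_dominated_FTC R (fun t => cIm (F t)) _ C) => [x||x x0|x x0].
  + exact: (dF x).2.
  + exact: (is_derive_continuous (fun x => (df x).2)).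
  + exact: le_trans (normIm_le _) (FC x x0).
  + exact: le_trans (normIm_le _) (fC x x0).
Qed.

Lemma cintegral_indic (D : set R) f : measurable D ->
  cintegral D f = cint leb (fun t => (\1_D t)%:C * f t).
Proof.
move=> mD; apply: complexP; rewrite /cintegral /cint /= [LHS]Rintegral_mkcond;
  congr (Rintegral _ _ _); apply/funext => t /=; rewrite patchE indicE.
- by rewrite cReM cIm_real mul0r subr0 cRe_real; case: ifPn => _; rewrite ?mul1r ?mul0r.
- by rewrite cImM cIm_real mul0r addr0 cRe_real; case: ifPn => _; rewrite ?mul1r ?mul0r.
Qed.

End complex_derivatives.

Lemma cint0 {R : realType} d (T : measurableType d) (mu : {measure set T -> \bar R}) :
  cint mu (fun=> 0 : R[i]) = 0.
Proof. by rewrite /cint; apply: complexP => /=; rewrite /Rintegral /= integral0. Qed.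

Lemma cintN {R : realType} d (T : measurableType d) (mu : {measure set T -> \bar R})
  (f : T -> R[i]) : cint mu (fun x => - f x) = - cint mu f.
Proof.
have H (g : T -> R) : Rintegral mu setT (fun x => - g x) = - Rintegral mu setT g.
  rewrite /Rintegral integralE [in RHS]integralE.
  have -> : (fun x => (- g x)%:E)^\+%E = (fun x => (g x)%:E)^\-%E.
    by apply/funext => x; rewrite funeposE funenegE EFinN.
  have -> : (fun x => (- g x)%:E)^\-%E = (fun x => (g x)%:E)^\+%E.
    by apply/funext => x; rewrite funeposE funenegE EFinN oppeK.
  case: (integral _ _ _) => [r| |]; case: (integral _ _ _) => [r'| |] //=;
    by rewrite ?oppr0 ?opprB.
by rewrite /cint; apply: complexP => /=; rewrite -H; apply: eq_Rintegral => x _ /=;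
  rewrite ?cReN ?cImN.
Qed.

(** Serves to glue two closed half-lines, which overlap in the point 0. *)
Lemma cint_eq_except {R : realType} (a : R) (f g : measurableTypeR R -> R[i]) :
  cmeasurable f -> cintegrable (@lebesgue_measure R) g -> (forall y, y != a -> f y = g y) ->
  cintegrable (@lebesgue_measure R) f /\
  cint (@lebesgue_measure R) f = cint (@lebesgue_measure R) g.
Proof.
move=> [f1 f2] [g1 g2] fg.
have H (u v : measurableTypeR R -> R) : measurable_fun setT u ->
    (@lebesgue_measure R).-integrable setT (EFin \o v) ->
    (forall y, y != a -> u y = v y) ->
    (@lebesgue_measure R).-integrable setT (EFin \o u) /\
    (\int[@lebesgue_measure R]_y (u y)%:E = \int[@lebesgue_measure R]_y (v y)%:E)%E.
  move=> mu_ iv uv; have /integrableP[mv vlt] := iv.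
  have mu' : measurable_fun setT (EFin \o u) by exact/measurable_EFinP.
  have ae (p q : measurableTypeR R -> \bar R) : (forall y, y != a -> p y = q y) ->
      ae_eq (@lebesgue_measure R) setT p q.
    move=> pq; exists [set a]; split => //; first exact: lebesgue_measure_set1.
    by move=> y /= /not_implyP[_ npq]; apply: contra_notP npq => /eqP ya; exact: pq.
  split.
    apply/integrableP; split => //.
    rewrite (ae_eq_integral (abse \o (EFin \o v)))//; first exact: measurableT_comp.
      exact: measurableT_comp.
    by apply: ae => y ya /=; rewrite uv.
  by apply: ae_eq_integral => //; apply: ae => y ya; rewrite uv.
have [i1 e1] := H _ _ f1 g1 (fun y ya => congr1 _ (fg y ya)).
have [i2 e2] := H _ _ f2 g2 (fun y ya => congr1 _ (fg y ya)).
by split => //; apply: complexP; rewrite /cint /= /Rintegral ?e1 ?e2.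
Qed.

Section half_gauss.
Context {R : realType}.
Local Notation leb := (@lebesgue_measure R).

(* [lebesgue_measure] lives on this copy of [R], whose display differs from the default one. *)
Local Notation LR := (measurableTypeR R).

Lemma chalf : (2 : R[i])^-1 = (2^-1 : R)%:C.
Proof. by rewrite fmorphV rmorph_nat. Qed.

(* The derivative in [t] of [gauss_shift w t y] is [- w] times its derivative in [y]; integrating it
   over [0, 1] x [0, +oo[ in both orders replaces the shift of the contour of integration. *)
Definition gauss_shift (w : R[i]) (t y : R) : R[i] :=
  cexp (- ((y%:C - t%:C * w) ^+ 2 / 2)).

Lemma cRe_shift (w : R[i]) (t y : R) : cRe (- ((y%:C - t%:C * w) ^+ 2 / 2)) =
  - (((y - t * cRe w) ^+ 2 - (t * cIm w) ^+ 2) / 2).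
Proof.
rewrite chalf expr2; case: w => a b /=.
by rewrite !(mulr0, mul0r, subr0, addr0, oppr0, add0r); field.
Qed.

(** A bound uniform in t. The modulus is at most exp(- y^2 / 2 + A y + A^2 / 2), and the linear
    factor at most exp(y + A). Splitting off exp(- y) leaves - y^2 / 2 + (A + 2) y, whose maximum is
    (A + 2)^2 / 2; this explains the three terms in C. *)
Lemma gauss_shift_le (w : R[i]) (t y : R) : 0 <= t <= 1 -> 0 <= y ->
  let A := cnorm w in
  let C := expR ((A + 2) ^+ 2 / 2 + A ^+ 2 / 2 + A) in
  cnorm (gauss_shift w t y) <= C * expR (- y) /\
  cnorm ((y%:C - t%:C * w) * gauss_shift w t y) <= C * expR (- y).
Proof.
move=> /andP[t0 t1] y0 A C.
have A0 : 0 <= A by exact: cnorm_ge0.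
have aA : `|cRe w| <= A by exact: normRe_le.
have bA : `|cIm w| <= A by exact: normIm_le.
have H : - (((y - t * cRe w) ^+ 2 - (t * cIm w) ^+ 2) / 2) <=
    - (y ^+ 2 / 2) + y * A + A ^+ 2 / 2.
  have h1 : y * (t * cRe w) <= y * A.
    apply: ler_wpM2l => //; apply: le_trans (ler_norm _) _.
    rewrite normrM ger0_norm// -[leRHS]mul1r; exact: ler_pM.
  have h2 : (t * cIm w) ^+ 2 <= A ^+ 2.
    rewrite -(real_normK (num_real (t * _))) ler_sqr ?nnegrE// normrM ger0_norm//.
    by rewrite -[leRHS]mul1r; exact: ler_pM.
  have h3 : 0 <= (t * cRe w) ^+ 2 by exact: sqr_ge0.
  nra.
have H2 : - (y ^+ 2 / 2) + y * (A + 2) <= (A + 2) ^+ 2 / 2.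
  have : 0 <= (y - (A + 2)) ^+ 2 by exact: sqr_ge0.
  nra.
have E1 : cnorm (gauss_shift w t y) <= expR (- (y ^+ 2 / 2) + y * A + A ^+ 2 / 2).
  by rewrite cnorm_cexp cRe_shift ler_expR.
have N1 : cnorm (y%:C - t%:C * w) <= expR (y + A).
  apply: le_trans (cnormD _ _) _; rewrite cnormN cnormM !cnorm_real !ger0_norm//.
  apply: le_trans (expR_ge1Dx _).
  have : t * cnorm w <= 1 * A by exact: ler_pM.
  lra.
split.
- apply: le_trans E1 _; rewrite -expRD ler_expR; nra.
- rewrite cnormM; apply: le_trans (ler_pM (cnorm_ge0 _) (cnorm_ge0 _) N1 E1) _.
  rewrite -!expRD ler_expR; nra.
Qed.

Lemma cderiv_shift_y w t y :
  cderiv (fun y => gauss_shift w t y) y (- ((y%:C - t%:C * w) * gauss_shift w t y)).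
Proof.
have d : cderiv (fun y => y%:C - t%:C * w) y 1.
  by apply: cderiv_eq (cderivD (cderiv_real y) (cderiv_cst _ y)) _; rewrite addr0.
apply: cderiv_eq.
  apply: cderiv_cexp; apply: cderivN; apply: cderivM; last exact: (cderiv_cst 2^-1 y).
  exact: (cderivM d d).
rewrite -/(gauss_shift w t y); cbv beta; rewrite -/(gauss_shift w t y).
by field.
Qed.

Lemma cderiv_shift_t w t y :
  cderiv (fun t => gauss_shift w t y) t (w * ((y%:C - t%:C * w) * gauss_shift w t y)).
Proof.
have d : cderiv (fun t => y%:C - t%:C * w) t (- w).
  apply: cderiv_eq (cderivD (cderiv_cst _ t) (cderivN (cderivM (cderiv_real t) (cderiv_cst w t)))) _.
  by cbv beta; ring.
apply: cderiv_eq.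
  apply: cderiv_cexp; apply: cderivN; apply: cderivM; last exact: (cderiv_cst 2^-1 t).
  exact: (cderivM d d).
rewrite -/(gauss_shift w t y); cbv beta; rewrite -/(gauss_shift w t y).
by field.
Qed.

Lemma cintegral_shift_y w t : 0 <= t <= 1 ->
  cintegral `[0, +oo[ (fun y => w * ((y%:C - t%:C * w) * gauss_shift w t y)) =
  w * gauss_shift w t 0.
Proof.
move=> t01.
have d y : cderiv (fun y => y%:C - t%:C * w) y 1.
  by apply: cderiv_eq (cderivD (cderiv_real y) (cderiv_cst _ y)) _; rewrite addr0.
pose C := expR ((cnorm w + 2) ^+ 2 / 2 + cnorm w ^+ 2 / 2 + cnorm w).
rewrite (@cintegral_dominated_FTC _ (fun y => - (w * gauss_shift w t y)) _
  (fun y => 0 * ((y%:C - t%:C * w) * gauss_shift w t y) + w * (1 * gauss_shift w t y +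
    (y%:C - t%:C * w) * (- ((y%:C - t%:C * w) * gauss_shift w t y)))) (cnorm w * C)).
- by rewrite opprK.
- move=> y; apply: cderiv_eq.
    exact: (cderivN (cderivM (cderiv_cst w y) (cderiv_shift_y w t y))).
  by cbv beta; ring.
- move=> y; apply: cderivM; first exact: cderiv_cst.
  by apply: cderivM; [exact: d|exact: cderiv_shift_y].
- move=> y y0; rewrite cnormN cnormM -mulrA ler_wpM2l ?cnorm_ge0//.
  by have [] := gauss_shift_le w t01 y0.
- move=> y y0; rewrite cnormM -mulrA ler_wpM2l ?cnorm_ge0//.
  by have [] := gauss_shift_le w t01 y0.
Qed.

Lemma cintegral_shift_t w y :
  cintegral `[0, 1] (fun t => w * ((y%:C - t%:C * w) * gauss_shift w t y)) =
  gauss_shift w 1 y - gauss_shift w 0 y.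
Proof.
have d t : cderiv (fun t => y%:C - t%:C * w) t (- w).
  apply: cderiv_eq (cderivD (cderiv_cst _ t) (cderivN (cderivM (cderiv_real t) (cderiv_cst w t)))) _.
  by cbv beta; ring.
apply: (@cintegral_FTC01 _ (fun t => gauss_shift w t y) _
  (fun t => 0 * ((y%:C - t%:C * w) * gauss_shift w t y) + w * (- w * gauss_shift w t y +
    (y%:C - t%:C * w) * (w * ((y%:C - t%:C * w) * gauss_shift w t y))))).
- by move=> t; exact: cderiv_shift_t.
- move=> t; apply: cderivM; first exact: cderiv_cst.
  by apply: cderivM; [exact: d|exact: cderiv_shift_t].
Qed.

Lemma measurable_indicr (D : set R) : measurable D -> measurable_fun setT (\1_D : R -> R).
Proof. exact: measurable_indic. Qed.

Lemma integrable_indic_expRN (C : R) : 0 <= C ->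
  cintegrable leb (fun y => (\1_`[0, +oo[ y * (C * expR (- y)))%:C).
Proof.
move=> C0; have [iC _] := integral_expRN C0.
have E : (fun y => (\1_`[0, +oo[ y * (C * expR (- y)))%:E) =
    (fun y => (C * expR (- y))%:E) \_ `[0, +oo[.
  by apply/funext => y; rewrite patchE indicE; case: ifPn; rewrite ?mul1r ?mul0r.
have i0 : leb.-integrable setT (fun y => (\1_`[0, +oo[ y * (C * expR (- y)))%:E).
  by rewrite E; apply/(integrable_mkcond _ _).1 => //.
split => //; apply: (eq_integrable measurableT (cst 0%E)) => //.
exact: integrable0.
Qed.

Lemma integrable_indic01 : cintegrable leb (fun t => (\1_`[0, 1] t : R)%:C).
Proof.
split; last by apply: (eq_integrable measurableT (cst 0%E)) => //; exact: integrable0.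
by apply: integrable_indic_itv.
Qed.

Lemma cmeasurable_shift (w : R[i]) :
  cmeasurable (fun p : LR * LR => gauss_shift w p.1 p.2) /\
  cmeasurable (fun p : LR * LR => w * ((p.2%:C - p.1%:C * w) * gauss_shift w p.1 p.2)).
Proof.
have m1 : cmeasurable (fun p : LR * LR => p.2%:C - p.1%:C * w).
  apply: cmeasurableD; first by apply: cmeasurable_real; exact: measurable_snd.
  apply: cmeasurableN; apply: cmeasurableM; last exact: cmeasurable_cst.
  by apply: cmeasurable_real; exact: measurable_fst.
have m2 : cmeasurable (fun p : LR * LR => gauss_shift w p.1 p.2).
  apply: cmeasurable_cexp; apply: cmeasurableN; apply: cmeasurableM; last exact: cmeasurable_cst.
  exact: cmeasurableM.
split => //; apply: cmeasurableM; first exact: cmeasurable_cst.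
exact: cmeasurableM.
Qed.

(** The right-hand side is the segment integral in [Phi w]: it is the side of the contour that the
    shift by w leaves behind. *)
Lemma cint_shift_diff (w : R[i]) :
  cint leb (fun y => (\1_`[0, +oo[ y)%:C * (gauss_shift w 1 y - gauss_shift w 0 y)) =
  cintegral `[0, 1] (fun t => w * cexp (- ((w * t%:C) ^+ 2 / 2))).
Proof.
pose C := expR ((cnorm w + 2) ^+ 2 / 2 + cnorm w ^+ 2 / 2 + cnorm w).
have C0 : 0 <= cnorm w * C by rewrite mulr_ge0 ?cnorm_ge0 ?expR_ge0.
pose u (t : R) : R[i] := (\1_`[0, 1] t : R)%:C.
(* The product of [u] and [v] dominates the integrand: an indicator of [0, 1] times the exponential
   bound of [gauss_shift_le], both integrable on the line. *)
pose v (y : R) : R[i] := (\1_`[0, +oo[ y * ((cnorm w * C) * expR (- y)))%:C.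
pose f (p : LR * LR) := u p.1 * ((\1_`[0, +oo[ p.2 : R)%:C *
  (w * ((p.2%:C - p.1%:C * w) * gauss_shift w p.1 p.2))).
have mu_ : cmeasurable (fun p : LR * LR => u p.1).
  apply: cmeasurable_real; apply: (measurableT_comp (measurable_indicr _)) => //.
have mf : cmeasurable f.
  apply: cmeasurableM => //; apply: cmeasurableM; last exact: (cmeasurable_shift w).2.
  by apply: cmeasurable_real; apply: (measurableT_comp (measurable_indicr _)).
have iv : cintegrable leb v by exact: integrable_indic_expRN.
have bf t y : cnorm (f (t, y)) <= cnorm (u t * v y).
  rewrite /f /u /v /=; have := fun t01 y0 => (@gauss_shift_le w t y t01 y0).2.
  rewrite -/C; move: (_ * gauss_shift w t y) => g Hg.
  rewrite !cnormM !cnorm_real !indicE !mem_setE !in_itv /= andbT.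
  have [t01|_] := boolP (0 <= t <= 1); last by rewrite normr0 !mul0r.
  have [y0|_] := boolP (0 <= y); last by rewrite normr0 !mul0r normr0.
  rewrite normr1 !mul1r -mulrA ger0_norm ?mulr_ge0 ?expR_ge0 ?cnorm_ge0//.
  by rewrite ler_wpM2l ?cnorm_ge0//; exact: Hg.
have u1 t : cnorm (u t) <= 1.
  by rewrite cnorm_real indicE; case: (_ \in _); rewrite ?normr1 ?normr0.
have [iuv _] := cint_prod_mul integrable_indic01 iv.
have bf' p : cnorm (f p) <= cnorm (u p.1 * v p.2) by case: p => t y; exact: bf.
have if_ := le_cintegrable mf (cintegrable_cnorm iuv) bf'.
have f1 t : cintegrable leb (fun y => f (t, y)).
  apply: (le_cintegrable _ (cintegrable_cnorm (cintegrableZ (u t) iv))); last exact: bf.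
  exact: (cmeasurable_comp mf (measurable_pair1 t)).
have f2 y : cintegrable leb (fun t => f (t, y)).
  apply: (le_cintegrable _ (cintegrable_cnorm (cintegrableZ (v y) integrable_indic01))).
    exact: (cmeasurable_comp mf (measurable_pair2 y)).
  by move=> t; rewrite mulrC; exact: bf.
have [_ _ e1 e2] := cint_fubini if_ f1 f2.
transitivity (cint leb (fun y => cint leb (fun t => f (t, y)))).
  apply: eq_cint => y; rewrite -cintegral_shift_t cintegral_indic//.
  have [y0|ny0] := boolP (0 <= y).
    rewrite indicE mem_setE in_itv /= y0 mul1r; apply: eq_cint => t.
    by rewrite /f /= [\1_`[0, +oo[ y]indicE mem_setE in_itv /= y0 mul1r.
  rewrite indicE mem_setE in_itv /= (negbTE ny0) mul0r -[LHS](cint0 leb); apply: eq_cint => t.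
  by rewrite /f /= [\1_`[0, +oo[ y]indicE mem_setE in_itv /= (negbTE ny0) mul0r mulr0.
apply: (etrans (esym e2)); apply: (etrans e1).
rewrite [RHS](cintegral_indic _ (measurable_itv `[0, 1])).
congr (cint _ _).
apply/funext => t.
rewrite /f /= /u.
have [t01|nt] := boolP (0 <= t <= 1); last first.
  rewrite indicE mem_setE in_itv /= (negbTE nt) mul0r -[RHS](cint0 leb).
  by apply: eq_cint => y; rewrite mul0r.
rewrite indicE mem_setE in_itv /= t01 mul1r.
transitivity (w * gauss_shift w t 0).
  by rewrite -cintegral_shift_y// cintegral_indic//; apply: eq_cint => y; rewrite mul1r.
by rewrite /gauss_shift sub0r sqrrN mulrC [t%:C * w]mulrC mulrC.
Qed.

(** The substitution y -> y / sqrt 2 in the half-line integral of exp(- y^2). *)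
Lemma integral_half_gauss :
  (\int[leb]_y (\1_`[0, +oo[ y * expR (- (y ^+ 2 / 2)))%:E = (Num.sqrt (2 * pi) / 2)%:E)%E.
Proof.
pose f (y : R) := (\1_`[0, +oo[ y * gauss_fun y)%:E.
have s2 : Num.sqrt (2 : R) != 0 by rewrite sqrtr_eq0 -ltNge.
have s2' : 0 < (Num.sqrt (2 : R))^-1 by rewrite invr_gt0 sqrtr_gt0.
have mf : measurable_fun setT f.
  apply/measurable_EFinP; apply: measurable_funM; first exact: measurable_indic.
  exact: measurable_gauss_fun.
have f0 t : (0 <= f t)%E by rewrite lee_fin mulr_ge0// gauss_fun_ge0.
have If : (\int[leb]_y f y = (Num.sqrt pi / 2)%:E)%E.
  rewrite -integral0y_gauss [RHS]integral_mkcond; apply: eq_integral => y _.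
  by rewrite patchE /f indicE; case: ifPn => _; rewrite ?mul1r ?mul0r.
have := ge0_integral_affine 0 (invr_neq0 s2) mf f0.
rewrite If normrV ?unitfE// invrK gtr0_norm ?sqrtr_gt0// -EFinM mulrA -sqrtrM// => <-.
apply: eq_integral => y _; rewrite /f addr0; congr (_ * _)%:E.
  rewrite !indicE !mem_setE !in_itv /= !andbT.
  by rewrite pmulr_rge0.
by rewrite /gauss_fun exprMn exprVn sqr_sqrtr// mulrC.
Qed.

(** Completing the square, - y^2 / 2 + w y = w^2 / 2 - (y - w)^2 / 2. The integral of the shifted
    Gaussian is that of the centred one plus the segment integral from 0 to w, which together make
    [Phi w] up to normalization. *)
Lemma cint_half_gauss (w : R[i]) :
  let f (y : LR) := (\1_`[0, +oo[ y * expR (- (y ^+ 2 / 2)))%:C * cexp (w * y%:C) in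
  cintegrable leb f /\
  cint leb f = (Num.sqrt (2 * pi))%:C * cexp (w ^+ 2 / 2) * Phi w.
Proof.
move=> f.
have E (y : LR) : f y = cexp (w ^+ 2 / 2) * ((\1_`[0, +oo[ y)%:C * gauss_shift w 1 y).
  have -> : f y = (\1_`[0, +oo[ y)%:C * (cexp (- (y ^+ 2 / 2))%:C * cexp (w * y%:C)).
    by rewrite cexp_real mulrA -rmorphM.
  rewrite [RHS]mulrCA /gauss_shift -!cexpD; congr (_ * cexp _).
  by rewrite rmorphN /= fmorph_div rmorphXn /= rmorph_nat; field.
have C0 (z : R) : 0 <= expR z by exact: expR_ge0.
have ms t : cmeasurable (fun y : LR => (\1_`[0, +oo[ y)%:C * gauss_shift w t y).
  apply: cmeasurableM; first by apply: cmeasurable_real; exact: measurable_indic.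
  exact: (cmeasurable_comp (cmeasurable_shift w).1 (measurable_pair1 t)).
have ish t : 0 <= t <= 1 -> cintegrable leb (fun y : LR => (\1_`[0, +oo[ y)%:C * gauss_shift w t y).
  move=> t01; apply: (le_cintegrable (ms t) (cintegrable_cnorm (integrable_indic_expRN (C0
    ((cnorm w + 2) ^+ 2 / 2 + cnorm w ^+ 2 / 2 + cnorm w))))) => y.
  rewrite [leLHS]cnormM !cnorm_real indicE mem_setE in_itv /= andbT.
  have [y0|_] := boolP (0 <= y); last by rewrite normr0 !mul0r normr0.
  rewrite normr1 !mul1r ger0_norm ?mulr_ge0//.
  by have [] := gauss_shift_le w t01 y0.
have i1 : cintegrable leb (fun y : LR => (\1_`[0, +oo[ y)%:C * gauss_shift w 1 y) by apply: ish; rewrite ler01 lexx.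
have i0 : cintegrable leb (fun y : LR => (\1_`[0, +oo[ y)%:C * gauss_shift w 0 y) by apply: ish; rewrite ler01 lexx.
have -> : f = fun y : LR => cexp (w ^+ 2 / 2) * ((\1_`[0, +oo[ y)%:C * gauss_shift w 1 y) by exact/funext.
split; first exact: cintegrableZ.
rewrite cintZ//; move: (cexp _) => c.
rewrite -mulrA [RHS]mulrCA; congr (_ * _).
have e0 : cint leb (fun y : LR => (\1_`[0, +oo[ y)%:C * gauss_shift w 0 y) = (Num.sqrt (2 * pi) / 2)%:C.
  have E0 (y : LR) : (\1_`[0, +oo[ y)%:C * gauss_shift w 0 y = (\1_`[0, +oo[ y * expR (- (y ^+ 2 / 2)))%:C.
    rewrite rmorphM /= -cexp_real; congr (_ * cexp _).
    by rewrite mul0r subr0 rmorphN /= fmorph_div rmorphXn /= rmorph_nat.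
  rewrite (eq_cint _ E0); apply: complexP; rewrite /cint /=.
    by rewrite /Rintegral integral_half_gauss.
  by rewrite Rintegral_cst// mul0r.
have := cintD i1 (cintegrableZ (-1) i0); rewrite cintZ// mulN1r.
rewrite [X in cint _ X = _](_ : _ = fun y : LR => (\1_`[0, +oo[ y)%:C * (gauss_shift w 1 y - gauss_shift w 0 y)); last first.
  by apply/funext => y; ring.
rewrite cint_shift_diff e0 => /eqP; rewrite eq_sym subr_eq => /eqP ->.
rewrite /Phi; set I := cintegral _ _.
have sp : (Num.sqrt (2 * pi) : R) != 0 by rewrite sqrtr_eq0 -ltNge mulr_gt0// pi_gt0.
rewrite fmorphV fmorph_div rmorph_nat; field.
by rewrite fmorph_eq0.
Qed.

(** The segment integral is odd in w, so only the two constants 1/2 survive. *)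
Lemma PhiN (w : R[i]) : Phi w + Phi (- w) = 1.
Proof.
rewrite /Phi.
have -> : cintegral `[0, 1] (fun t => - w * cexp (- ((- w * t%:C) ^+ 2 / 2))) =
    - cintegral `[0, 1] (fun t => w * cexp (- ((w * t%:C) ^+ 2 / 2))).
  rewrite !cintegral_indic// -cintN; congr (cint _ _); apply/funext => t /=.
  by rewrite [- w * t%:C]mulNr sqrrN [- w * _]mulNr mulrN.
set I := cintegral _ _; rewrite mulrN addrACA subrr addr0.
by field.
Qed.

(** The positive half-line contributes [Phi w] and the reflected one [Phi (- w)], which add up to
    1. *)
Lemma cint_gauss (w : R[i]) :
  let f (y : LR) := (expR (- (y ^+ 2 / 2)))%:C * cexp (w * y%:C) in
  cintegrable leb f /\ cint leb f = (Num.sqrt (2 * pi))%:C * cexp (w ^+ 2 / 2).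
Proof.
move=> f.
pose h (w : R[i]) (y : LR) : R[i] := (\1_`[0, +oo[ y * expR (- (y ^+ 2 / 2)))%:C * cexp (w * y%:C).
have [i1 e1] := cint_half_gauss w; have [i2 e2] := cint_half_gauss (- w).
have a0 : (-1 : R) != 0 by rewrite oppr_eq0 oner_eq0.
have [i3 e3] := cint_affine 0 a0 i2.
have i := cintegrableD i1 i3; have e := cintD i1 i3.
rewrite e3 normrN1 invr1 mul1r e1 e2 sqrrN -mulrDr PhiN mulr1 in e.
have E (y : LR) : y != 0 -> f y =
   (\1_`[0, +oo[ y * expR (- (y ^+ 2 / 2)))%:C * cexp (w * y%:C) +
   (\1_`[0, +oo[ (-1 * y + 0) * expR (- ((-1 * y + 0) ^+ 2 / 2)))%:C * cexp (- w * (-1 * y + 0)%:C).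
  move=> y0; rewrite addr0 mulN1r sqrrN rmorphN /= mulrNN -mulrDl -rmorphD /= -mulrDl.
  rewrite (_ : _ + _ = 1) ?mul1r// !indicE !mem_setE !in_itv /= !andbT oppr_ge0.
  by case: ltgtP y0 => //= _ _; rewrite ?addr0 ?add0r.
have mf : cmeasurable f.
  apply: cmeasurableM.
    apply: cmeasurable_real; apply: (measurableT_comp (@measurable_expR R)).
    by apply: measurable_funN; apply: measurable_funM => //; exact: measurable_funX.
  apply: cmeasurable_cexp; apply: cmeasurableM; first exact: cmeasurable_cst.
  exact: cmeasurable_real.
have [if_ ef] := cint_eq_except mf i E.
by split => //; rewrite ef e.
Qed.

End half_gauss.

(** * Gaussian integrals of rank-one perturbations *)

Section gauss_linearization.
Context {R : realType} {n : nat}.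
Local Notation leb := (@lebesgue_measure R).
Local Notation LR := (measurableTypeR R).
Variable beta : 'I_n -> R.
Implicit Types (J : pred 'I_n) (z : R[i]).

(** A boolean cut-off lets one computation cover the orthant of the normal cone, the orthant times a
    linear space of the tangent cone, and the whole space used for normalization. *)
Definition half (c : bool) (y : R) : R := if c then \1_`[0, +oo[ y else 1.

Lemma half_ge0 c y : 0 <= half c y.
Proof. by case: c => //=; rewrite indicE. Qed.

Lemma half_le1 c y : half c y <= 1.
Proof. by case: c => //=; rewrite indicE; case: (_ \in _). Qed.

Lemma measurable_half c : measurable_fun setT (half c).
Proof. by case: c; [exact: measurable_indic|exact: measurable_cst]. Qed.

Definition lin_factor J z (x : R) (j : 'I_n) (y : LR) : R[i] :=
  (half (J j) y * expR (- (y ^+ 2 / 2)))%:C * cexp (z * (beta j)%:C * x%:C * y%:C).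

Definition factor_int J z (x : R) (j : 'I_n) : R[i] :=
  (Num.sqrt (2 * pi))%:C * cexp ((z * (beta j)%:C * x%:C) ^+ 2 / 2) *
  (if J j then Phi (z * (beta j)%:C * x%:C) else 1).

Lemma cint_lin_factor J z x j : cintegrable leb (lin_factor J z x j) /\
  cint leb (lin_factor J z x j) = factor_int J z x j.
Proof.
rewrite /lin_factor /factor_int /half; case: (J j).
  exact: cint_half_gauss.
have [i e] := cint_gauss (z * (beta j)%:C * x%:C).
rewrite mulr1 -e.
by under [X in cintegrable _ X]eq_fun do rewrite mul1r;
  under [X in cint _ X = _]eq_fun do rewrite mul1r.
Qed.

(* Joint density of the auxiliary normal variable [p.1] and the point [p.2]; for [z ^+ 2 = - q]
   its integral over [p.1] is [sqrt (2 pi) exp (- gauss_quad q p.2 / 2)] on the half box. *)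
Definition lin_density J z (p : LR * 'rV[R]_n) : R[i] :=
  (expR (- (p.1 ^+ 2 / 2)))%:C * \prod_j lin_factor J z p.1 j (p.2 0 j).

Lemma cmeasurable_lin_density J z : cmeasurable (lin_density J z).
Proof.
have m1 := @measurable_fst _ _ LR 'rV[R]_n.
have m2 := @measurable_snd _ _ LR 'rV[R]_n.
apply: cmeasurableM.
  apply: cmeasurable_real; apply: (measurableT_comp (@measurable_expR R)).
  by apply: measurable_funN; apply: measurable_funM => //; exact: measurable_funX.
apply: cmeasurable_prod => j.
have mj := measurableT_comp (@measurable_coord R n j) m2.
apply: cmeasurableM.
  apply: cmeasurable_real; apply: measurable_funM.
    exact: (measurableT_comp (measurable_half (J j)) mj).
  apply: (measurableT_comp (@measurable_expR R)).
  by apply: measurable_funN; apply: measurable_funM => //; exact: measurable_funX.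
apply: cmeasurable_cexp; apply: cmeasurableM; last exact: cmeasurable_real.
apply: cmeasurableM; first exact: cmeasurable_cst.
exact: cmeasurable_real.
Qed.

Lemma cint_lin_density_x J z x : cintegrable (rvm n) (fun u => lin_density J z (x, u)) /\
  cint (rvm n) (fun u => lin_density J z (x, u)) =
    (expR (- (x ^+ 2 / 2)))%:C * \prod_j factor_int J z x j.
Proof.
have [i e] := cint_rvm_prod (fun j => (cint_lin_factor J z x j).1).
rewrite /lin_density /=; split; first exact: (cintegrableZ _ i).
rewrite cintZ// e; congr (_ * _); apply: eq_bigr => j _.
exact: (cint_lin_factor J z x j).2.
Qed.

Definition lin_form (u : 'rV[R]_n) : R := \sum_j beta j * u 0 j.

Lemma lin_densityE J z x u : lin_density J z (x, u) =
  ((\prod_j half (J j) (u 0 j)) * expR (- ((\sum_j u 0 j ^+ 2) / 2)))%:C *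
   ((expR (- (x ^+ 2 / 2)))%:C * cexp (z * (lin_form u)%:C * x%:C)).
Proof.
rewrite /lin_density /= /lin_factor big_split /= [RHS]mulrCA; congr (_ * _).
rewrite -cexp_sum; congr (_ * cexp _).
  rewrite -rmorph_prod /= big_split /=; congr (_ * _)%:C.
  by rewrite -expR_sum mulr_suml -sumrN.
rewrite /lin_form rmorph_sum /= mulr_sumr mulr_suml; apply: eq_bigr => j _.
by rewrite rmorphM /=; ring.
Qed.

Lemma cint_lin_density_u J z u : cintegrable leb (fun x => lin_density J z (x, u)) /\
  cint leb (fun x => lin_density J z (x, u)) =
    (Num.sqrt (2 * pi))%:C *
    (((\prod_j half (J j) (u 0 j)) * expR (- ((\sum_j u 0 j ^+ 2) / 2)))%:C *
      cexp ((z * (lin_form u)%:C) ^+ 2 / 2)).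
Proof.
have [i e] := cint_gauss (z * (lin_form u)%:C).
pose c : R[i] := ((\prod_j half (J j) (u 0 j)) * expR (- ((\sum_j u 0 j ^+ 2) / 2)))%:C.
have -> : (fun x : LR => lin_density J z (x, u)) = (fun x : LR => c *
   ((expR (- (x ^+ 2 / 2)))%:C * cexp (z * (lin_form u)%:C * x%:C))).
  by apply/funext => x; exact: lin_densityE.
split; first exact: (cintegrableZ _ i).
by rewrite cintZ// e mulrCA.
Qed.

(** The cut-offs are at most 1, and for real a the modulus of exp(z a) depends on Re z alone. *)
Lemma cnorm_lin_density J z p : cnorm (lin_density J z p) <=
  cnorm (lin_density pred0 (cRe z)%:C p).
Proof.
case: p => x u; rewrite !lin_densityE.
set a := \prod_j half (J j) _; set b := \prod_j half (pred0 j) _.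
have a1 : 0 <= a <= 1.
  rewrite prodr_ge0 /= => [|j _]; last exact: half_ge0.
  by apply: prodr_ile1 => j _; rewrite half_ge0 half_le1.
have -> : b = 1 by rewrite /b big1.
move/andP: a1 => [a0 a1].
rewrite cnormM [leRHS]cnormM; apply: ler_pM; rewrite ?cnorm_ge0//.
  rewrite !cnorm_real !ger0_norm ?mulr_ge0 ?expR_ge0//.
  by rewrite ler_wpM2r ?expR_ge0.
rewrite cnormM [leRHS]cnormM ler_wpM2l ?cnorm_ge0// !cnorm_cexp ler_expR.
by case: z => zr zi /=; rewrite !(mulr0, subr0, mul0r, addr0).
Qed.

Lemma factor_int_real (a x : R) j : factor_int pred0 a%:C x j =
  (Num.sqrt (2 * pi) * expR ((a * beta j * x) ^+ 2 / 2))%:C.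
Proof.
rewrite /factor_int /= mulr1 rmorphM /= -cexp_real; congr (_ * cexp _).
by rewrite fmorph_div rmorph_nat rmorphXn /= !rmorphM.
Qed.

(** Tonelli with u integrated first: the real Gaussian factors leave a multiple of exp(- s x^2 / 2)
    with s = 1 - (Re z)^2 |beta|^2, which is integrable for s > 0. *)
Lemma cintegrable_lin_density J z : 0 < 1 - cRe z ^+ 2 * \sum_j beta j ^+ 2 ->
  cintegrable (leb \x rvm n)%E (lin_density J z).
Proof.
move=> h; set s := 1 - _ in h; set a := cRe z in s h.
pose v x : R := expR (- (x ^+ 2 / 2)) * \prod_j (Num.sqrt (2 * pi) * expR ((a * beta j * x) ^+ 2 / 2)).
have dx x : cintegrable (rvm n) (fun u => lin_density pred0 a%:C (x, u)) /\
    cint (rvm n) (fun u => lin_density pred0 a%:C (x, u)) = (v x)%:C.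
  have [i e] := cint_lin_density_x pred0 a%:C x; split => //.
  rewrite e /v rmorphM /= rmorph_prod; congr (_ * _); apply: eq_bigr => j _.
  exact: factor_int_real.
have reald p : lin_density pred0 a%:C p = (cnorm (lin_density pred0 a%:C p))%:C.
  case: p => x u; rewrite lin_densityE.
  have -> : a%:C * (lin_form u)%:C * x%:C = (a * lin_form u * x)%:C by rewrite !rmorphM.
  rewrite cexp_real -!rmorphM /= cnorm_real ger0_norm// !mulr_ge0 ?expR_ge0//.
  by rewrite big1.
apply: (le_cintegrable (h := fun p => cnorm (lin_density pred0 a%:C p))).
- exact: cmeasurable_lin_density.
- have mn : measurable_fun setT (EFin \o (fun p => cnorm (lin_density pred0 a%:C p))).
    by apply/measurable_EFinP; apply: measurable_cnorm; exact: cmeasurable_lin_density.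
  apply (proj2 (integrable12ltyP leb (rvm n) mn)).
  under eq_integral => x _.
    have -> : (\int[rvm n]_u `|(EFin \o (fun p => cnorm (lin_density pred0 a%:C p))) (x, u)| = (v x)%:E)%E.
      have [[iR _] e] := dx x.
      rewrite -[v x]/(cRe (v x)%:C) -e /cint /= /Rintegral fineK; last exact: integrable_fin_num.
      apply: eq_integral => u _ /=.
      by rewrite ger0_norm ?cnorm_ge0// reald /= cnorm_real ger0_norm ?cnorm_ge0.
    over.
  have sv x : v x = Num.sqrt (2 * pi) ^+ n * expR (- ((Num.sqrt s * x + 0) ^+ 2 / 2)).
    rewrite /v addr0 big_split /= prodr_const card_ord mulrCA -expR_sum -expRD.
    congr (_ * expR _); rewrite exprMn sqr_sqrtr ?ltW// /s -mulr_suml.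
    under eq_bigr => j _ do rewrite !exprMn.
    by rewrite -mulr_suml -mulr_sumr; field.
  have s0 : Num.sqrt s != 0 by rewrite gt_eqF// sqrtr_gt0.
  have [ig _] := cint_affine 0 s0 (cint_gauss 0).1.
  have := cintegrable_cnorm (cintegrableZ (Num.sqrt (2 * pi) ^+ n)%:C ig).
  move=> /integrableP[_]; apply: le_lt_trans; rewrite le_eqVlt; apply/orP; left; apply/eqP.
  apply: eq_integral => x _; rewrite /= ger0_norm ?cnorm_ge0// sv mul0r cexp0 mulr1.
  by rewrite -rmorphM cnorm_real ger0_norm// mulr_ge0 ?expR_ge0// exprn_ge0// sqrtr_ge0.
- by move=> p; exact: cnorm_lin_density.
Qed.

Definition gauss_quad (q : R) (u : 'rV[R]_n) : R := \sum_j u 0 j ^+ 2 + q * lin_form u ^+ 2.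

Definition half_box J : set 'rV[R]_n := [set u | forall j, J j -> 0 <= u 0 j].

Lemma measurable_lin_form : measurable_fun setT lin_form.
Proof.
apply: measurable_sum => j; apply: measurable_funM => //; exact: measurable_coord.
Qed.

Lemma measurable_gauss_quad q : measurable_fun setT (gauss_quad q).
Proof.
apply: measurable_funD.
  by apply: measurable_sum => j; apply: measurable_funX; exact: measurable_coord.
apply: measurable_funM => //; apply: measurable_funX; exact: measurable_lin_form.
Qed.

Lemma measurable_half_box J : measurable (half_box J).
Proof.
have -> : half_box J = \bigcap_(j in [set j | J j]) [set u | 0 <= u 0 j].
  by apply/seteqP; split => u /=; [move=> h j; exact: h|move=> h j Jj; exact: h].
apply: fin_bigcap_measurable => // j _.
exact: (measurable_le_set (measurable_cst _) (measurable_coord j)).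
Qed.

Lemma prod_half J (u : 'rV[R]_n) : \prod_j half (J j) (u 0 j) = \1_(half_box J) u.
Proof.
have [uJ|nuJ] := pselect (half_box J u).
  rewrite indicE mem_set// big1// => j _; rewrite /half; case: ifPn => // Jj.
  by rewrite indicE mem_setE in_itv /= andbT uJ.
rewrite indicE memNset//; move/existsNP: nuJ => [j /not_implyP[Jj /negP uj]].
by rewrite (bigD1 j)//= /half Jj indicE mem_setE in_itv /= andbT (negbTE uj) mul0r.
Qed.

Definition gauss_mass (q : R) J : \bar R :=
  (\int[rvm n]_(u in half_box J) (expR (- (gauss_quad q u / 2)))%:E)%E.

Definition Phi_prod J (a : 'I_n -> R[i]) (y : LR) : R[i] :=
  (\prod_(j | J j) Phi (a j * y%:C)) * (expR (- (y ^+ 2 / 2)))%:C.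

(** Fubini for [lin_density]. With x innermost the double integral is sqrt(2 pi) times the mass of
    the half box; with u innermost it is a one-dimensional integral of a product of values of
    Phi. *)
Lemma gauss_massE (q : R) z J : 0 < 1 + q * \sum_j beta j ^+ 2 ->
  z ^+ 2 = (- q)%:C -> 0 < 1 - cRe z ^+ 2 * \sum_j beta j ^+ 2 ->
  let sigma := Num.sqrt (1 + q * \sum_j beta j ^+ 2) in
  let a j := z * (beta j)%:C / sigma%:C in
  [/\ gauss_mass q J \is a fin_num, cintegrable leb (Phi_prod J a) &
  (Num.sqrt (2 * pi))%:C * (fine (gauss_mass q J))%:C =
  (Num.sqrt (2 * pi) ^+ n / sigma)%:C * cint leb (Phi_prod J a)].
Proof.
move=> sg zq hz sigma a.
have s0 : 0 < sigma by rewrite sqrtr_gt0.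
have [iF iG e1 e2] := cint_fubini (cintegrable_lin_density J hz)
  (fun x => (cint_lin_density_x J z x).1) (fun u => (cint_lin_density_u J z u).1).
(* Since z^2 = - q, the factors exp((z beta_j x)^2 / 2) merge with the weight of x into exp(- (sigma
   x)^2 / 2), and z beta_j x = a_j (sigma x). The change of variable sigma x later yields the factor
   1 / sigma. *)
have EF x : cint (rvm n) (fun u => lin_density J z (x, u)) =
    (Num.sqrt (2 * pi) ^+ n)%:C * Phi_prod J a (sigma * x + 0).
  rewrite (cint_lin_density_x J z x).2 /factor_int big_split /= big_split /=.
  rewrite prodr_const card_ord -rmorphXn /= mulrCA -mulrA; congr (_ * _).
  rewrite -cexp_sum -cexp_real mulrA -cexpD mulrC /Phi_prod addr0 -cexp_real /=.
  congr (_ * cexp _).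
    rewrite [RHS]big_mkcond /=; apply: eq_bigr => j _; case: ifP => // _; congr Phi.
    by rewrite /a rmorphM /=; field; rewrite fmorph_eq0 gt_eqF.
  rewrite -mulr_suml.
  under eq_bigr => j _ do rewrite !exprMn zq -!rmorphXn -!rmorphM.
  rewrite -rmorph_sum /= chalf -rmorphM -rmorphD /=; congr _%:C.
  rewrite exprMn sqr_sqrtr ?ltW//.
  by rewrite -mulr_suml -mulr_sumr; field.
have EG u : cint leb (fun x => lin_density J z (x, u)) = (Num.sqrt (2 * pi))%:C *
    (\1_(half_box J) u * expR (- (gauss_quad q u / 2)))%:C.
  rewrite (cint_lin_density_u J z u).2 prod_half; congr (_ * _).
  have -> : cexp ((z * (lin_form u)%:C) ^+ 2 / 2) = (expR (- q * lin_form u ^+ 2 / 2))%:C.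
    by rewrite -cexp_real exprMn zq chalf -rmorphXn -!rmorphM.
  rewrite -[LHS]rmorphM; congr _%:C; rewrite /= -[LHS]mulrA -expRD.
  by congr (_ * expR _); rewrite /gauss_quad; field.
have iP : cintegrable leb (Phi_prod J a).
  have i1 := cintegrableZ ((Num.sqrt (2 * pi) ^+ n)%:C)^-1 iF.
  have i2 := (cint_affine 0 (invr_neq0 (lt0r_neq0 s0)) i1).1.
  have p0 : (Num.sqrt (2 * pi) : R) != 0 by rewrite sqrtr_eq0 -ltNge mulr_gt0// pi_gt0.
  move: i2; congr (cintegrable leb _); apply/funext => x.
  rewrite EF mulKf ?fmorph_eq0 ?expf_neq0//.
  by rewrite !addr0 mulrA divff ?mul1r// gt_eqF.
have e3 : cint leb (fun x => cint (rvm n) (fun u => lin_density J z (x, u))) =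
    (Num.sqrt (2 * pi) ^+ n / sigma)%:C * cint leb (Phi_prod J a).
  have [i4 e4] := cint_affine 0 (lt0r_neq0 s0) iP.
  rewrite (_ : (fun x => _) = fun x => (Num.sqrt (2 * pi) ^+ n)%:C * Phi_prod J a (sigma * x + 0)); last exact/funext.
  by rewrite cintZ// e4 mulrA -rmorphM /= gtr0_norm.
have me : measurable_fun setT (fun u => \1_(half_box J) u * expR (- (gauss_quad q u / 2))).
  apply: measurable_funM; first by apply: measurable_indic; exact: measurable_half_box.
  apply: (measurableT_comp (@measurable_expR R)); apply: measurable_funN.
  by apply: measurable_funM => //; exact: measurable_gauss_quad.
have e5 : gauss_mass q J = (\int[rvm n]_u (\1_(half_box J) u * expR (- (gauss_quad q u / 2)))%:E)%E.
  rewrite /gauss_mass integral_mkcond; apply: eq_integral => u _.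
  by rewrite patchE indicE; case: ifPn => _; rewrite ?mul1r ?mul0r.
rewrite (_ : (fun y => _) = fun u => (Num.sqrt (2 * pi))%:C *
    (\1_(half_box J) u * expR (- (gauss_quad q u / 2)))%:C) in iG; last exact/funext.
have p0 : (Num.sqrt (2 * pi) : R) != 0 by rewrite sqrtr_eq0 -ltNge mulr_gt0// pi_gt0.
have ir : cintegrable (rvm n) (fun u => (\1_(half_box J) u * expR (- (gauss_quad q u / 2)))%:C).
  have := cintegrableZ ((Num.sqrt (2 * pi))%:C)^-1 iG.
  by congr (cintegrable _ _); apply/funext => u; rewrite mulKf ?fmorph_eq0.
have fin : gauss_mass q J \is a fin_num.
  by rewrite e5; apply: (integrable_fin_num measurableT); exact: ir.1.
split => //.
rewrite -e3 -(etrans (esym e2) e1).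
rewrite (_ : (fun y => _) = fun u => (Num.sqrt (2 * pi))%:C *
    (\1_(half_box J) u * expR (- (gauss_quad q u / 2)))%:C); last exact/funext.
rewrite cintZ//; congr (_ * _); apply: complexP; rewrite /cint /=.
  by rewrite /Rintegral e5.
by rewrite Rintegral_cst// mul0r.
Qed.

(** For [pred0] the half box is the whole space and the product of Phi is empty, so the prefactor of
    [gauss_massE] cancels in the quotient. *)
Lemma gauss_mass_ratio (q : R) z J : 0 < 1 + q * \sum_j beta j ^+ 2 ->
  z ^+ 2 = (- q)%:C -> 0 < 1 - cRe z ^+ 2 * \sum_j beta j ^+ 2 ->
  let sigma := Num.sqrt (1 + q * \sum_j beta j ^+ 2) in
  let a j := z * (beta j)%:C / sigma%:C in
  [/\ gauss_mass q J \is a fin_num, gauss_mass q pred0 \is a fin_num,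
    0 < fine (gauss_mass q pred0), cintegrable leb (Phi_prod J a) &
    (fine (gauss_mass q J) / fine (gauss_mass q pred0))%:C = Phi_gauss_integral J a].
Proof.
move=> sg zq hz sigma a.
have s0 : 0 < sigma by rewrite sqrtr_gt0.
have [f1 i1 e1] := gauss_massE J sg zq hz.
have [f2 i2 e2] := gauss_massE pred0 sg zq hz.
have p0 : 0 < (Num.sqrt (2 * pi) : R) by rewrite sqrtr_gt0 mulr_gt0// pi_gt0.
have E0 : cint leb (Phi_prod pred0 (fun j => z * (beta j)%:C / sigma%:C)) = (Num.sqrt (2 * pi))%:C.
  have [_ e] := cint_gauss (0 : R[i]).
  rewrite expr0n mul0r cexp0 mulr1 in e; rewrite -[RHS]e.
  congr (cint _ _); apply/funext => y.
  by rewrite /Phi_prod big1// mul1r mul0r cexp0 mulr1.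
rewrite E0 mulrC in e2; move/(mulIf _): e2; rewrite fmorph_eq0 gt_eqF// => /(_ isT)/complexI m0.
have m0' : 0 < fine (gauss_mass q pred0) by rewrite m0 divr_gt0// exprn_gt0.
split => //.
rewrite fmorph_div /= [X in _ / X%:C]m0 /Phi_gauss_integral -[cintegral _ _]/(cint leb (Phi_prod J a)).
have c1 : ((Num.sqrt (2 * pi) : R)%:C : R[i]) != 0 by rewrite fmorph_eq0 gt_eqF.
have c2 : (((Num.sqrt (2 * pi) : R) ^+ n / sigma)%:C : R[i]) != 0.
  by rewrite fmorph_eq0 gt_eqF// divr_gt0// exprn_gt0.
apply: (mulfI c1); rewrite mulrA e1 [in RHS]fmorphV mulVKf//.
by rewrite mulrAC divff// mul1r.
Qed.

End gauss_linearization.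

(** * Cones, Gram matrices and solid angles *)

Section bilinear_form.
Context {R : realType}.

Definition bform n (G : 'M[R]_n) (u v : 'rV[R]_n) : R := (u *m G *m v^T) 0 0.

Lemma dotE n (u v : 'rV[R]_n) : dot u v = bform 1%:M u v.
Proof. by rewrite /bform mulmx1 mxE; apply: eq_bigr => i _; rewrite mxE. Qed.

Lemma dot_bform n : @dot R n = bform 1%:M.
Proof. by apply/funext => u; apply/funext => v; exact: dotE. Qed.

Lemma bform_mul n p (G : 'M[R]_n) (B : 'M[R]_(p, n)) (y z : 'rV[R]_p) :
  bform G (y *m B) (z *m B) = bform (B *m G *m B^T) y z.
Proof. by rewrite /bform trmx_mul !mulmxA. Qed.

Lemma bform_row n p (G : 'M[R]_n) (B : 'M[R]_(p, n)) i j :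
  bform G (row i B) (row j B) = (B *m G *m B^T) i j.
Proof.
rewrite /bform -!row_mul tr_row !mxE; apply: eq_bigr => l _.
by rewrite !mxE.
Qed.

Definition posdef n (G : 'M[R]_n) :=
  G^T = G /\ forall u : 'rV[R]_n, u != 0 -> 0 < bform G u u.

Lemma posdef1 n : posdef (1%:M : 'M[R]_n).
Proof.
split; first exact: trmx1.
move=> u u0; rewrite -dotE lt_neqAle sumr_ge0 => [|i _]; last by rewrite -expr2 sqr_ge0.
rewrite andbT eq_sym; apply: contra u0 => /eqP.
move=> /psumr_eq0P h; apply/eqP/rowP => i; rewrite mxE.
have : u 0 i * u 0 i = 0 by apply: h => // j _; rewrite -expr2 sqr_ge0.
by move/eqP; rewrite mulf_eq0 orbb => /eqP.
Qed.

Lemma posdef_ge0 n (G : 'M[R]_n) u : posdef G -> 0 <= bform G u u.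
Proof.
move=> [_ h]; have [->|u0] := eqVneq u 0; last exact/ltW/h.
by rewrite /bform !mul0mx mxE.
Qed.

Lemma posdef_congr n p (G : 'M[R]_n) (B : 'M[R]_(p, n)) :
  posdef G -> row_free B -> posdef (B *m G *m B^T).
Proof.
move=> [Gs Gp] fB; split; first by rewrite !trmx_mul trmxK Gs mulmxA.
move=> u u0; rewrite -bform_mul; apply: Gp.
by rewrite (mulmx_free_eq0 _ fB).
Qed.

Lemma row_free_gram n p (G : 'M[R]_n) (B : 'M[R]_(p, n)) :
  B *m G *m B^T \in unitmx -> row_free B.
Proof.
move=> u; apply/row_freeP; exists (G *m B^T *m invmx (B *m G *m B^T)).
by rewrite !mulmxA mulmxV.
Qed.

(* Symmetric Gaussian elimination: one step reduces [A] to its Schur complement. *)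
Lemma posdef_diag n (A : 'M[R]_n) : posdef A -> exists C : 'M[R]_n, C *m A *m C^T = 1%:M.
Proof.
elim: n A => [|n IH] A [As Ap]; first by exists 0; rewrite flatmx0 [RHS]flatmx0.
pose A' : 'M[R]_(1 + n) := A.
pose a := A' 0 0; pose b := ursubmx A'; pose D := drsubmx A'.
have ulE : ulsubmx A' = a%:M.
  rewrite [LHS]mx11_scalar !mxE; congr (A' _ _)%:M; exact/val_inj.
have dlE : dlsubmx A' = b^T by rewrite /b trmx_ursub /A' As.
have DE : D^T = D by rewrite /D trmx_drsub /A' As.
have AE : A' = block_mx a%:M b b^T D by rewrite -[LHS]submxK ulE dlE.
have a0 : 0 < a.
  have : (delta_mx 0 0 : 'rV[R]_n.+1) != 0.
    by apply/matrix0Pn; exists 0, 0; rewrite mxE !eqxx oner_eq0.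
  by move=> /Ap; rewrite /bform -rowE trmx_delta -colE !mxE.
pose S := D - a^-1 *: (b^T *m b).
have pS : posdef S.
  split; first by rewrite /S linearB linearZ /= trmx_mul trmxK DE.
  move=> u u0; pose t : 'M[R]_1 := - a^-1 *: (u *m b^T).
  have ne : row_mx t u != 0 :> 'rV[R]_(1 + n).
    by rewrite row_mx_eq0 negb_and u0 orbT.
  have ta : t *m a%:M + u *m b^T = 0.
    by rewrite mul_mx_scalar /t scalerA mulrN divff ?gt_eqF// scaleN1r addNr.
  have tb : t *m b + u *m D = u *m S.
    by rewrite /t /S mulmxBr -scalemxAl scaleNr -scalemxAr mulmxA addrC.
  have := Ap _ ne; rewrite /bform -[A]/A' AE (@mul_row_block _ 1 1 n 1 n) (@tr_row_mx _ 1 1 n) (@mul_row_col _ 1 1 n 1).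
  by rewrite ta tb mul0mx add0r.
have [C CE] := IH _ pS.
pose r := Num.sqrt a.
have r0 : r != 0 by rewrite gt_eqF// sqrtr_gt0.
have ra : r^-1 * a = r by rewrite -[a in LHS]sqr_sqrtr ?ltW// expr2 mulKf.
exists (block_mx r^-1%:M 0 (- a^-1 *: (C *m b^T)) C : 'M[R]_(1 + n)).
have E1 : (block_mx r^-1%:M 0 (- a^-1 *: (C *m b^T)) C : 'M[R]_(1 + n)) *m A' =
    block_mx r%:M (r^-1 *: b) 0 (C *m S).
  rewrite AE mulmx_block !mul0mx !addr0 -scalar_mxM ra mul_scalar_mx.
  rewrite mul_mx_scalar scalerA mulrN divff ?gt_eqF// scaleN1r addNr.
  congr block_mx; rewrite -scalemxAl scaleNr /S mulmxBr -scalemxAr mulmxA.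
  by rewrite addrC.
have E2 : r / a = r^-1.
  have aE : a = r * r by rewrite -expr2 sqr_sqrtr// ltW.
  by rewrite aE invfM mulrA divff// mul1r.
rewrite -[A]/A' E1 (@tr_block_mx _ 1 n 1 n) (@mulmx_block _ 1 n 1 n 1 n) tr_scalar_mx trmx0.
rewrite !mulmx0 !mul0mx !addr0 ?add0r CE -scalar_mxM divff//.
have -> : r%:M *m (- a^-1 *: (C *m b^T))^T + r^-1 *: b *m C^T = 0.
  rewrite linearZ /= trmx_mul trmxK mul_scalar_mx scalerA mulrN E2 scaleNr.
  by rewrite -scalemxAl addNr.
by rewrite -scalar_mx_block.
Qed.

Lemma orthonormalize n p (G : 'M[R]_n) (B : 'M[R]_(p, n)) : posdef G -> row_free B ->
  exists2 C : 'M[R]_p, C \in unitmx & (C *m B) *m G *m (C *m B)^T = 1%:M.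
Proof.
move=> Gp fB; have [C CE] := posdef_diag (posdef_congr Gp fB).
exists C; first by move: CE; rewrite -mulmxA => /mulmx1_unit [].
by rewrite trmx_mul !mulmxA -CE !mulmxA.
Qed.

Lemma gram_realization p (A : 'M[R]_p) : posdef A ->
  exists2 V : 'M[R]_p, row_free V & V *m V^T = A.
Proof.
move=> Ap; have [C CE] := posdef_diag Ap.
have Cu : C \in unitmx by move: CE; rewrite -mulmxA => /mulmx1_unit [].
exists (invmx C); first by rewrite row_free_unit unitmx_inv.
rewrite -[A](mulKmx Cu) -[C *m A](mulmxK (_ : C^T \in unitmx)) ?unitmx_tr//.
by rewrite CE mul1mx trmx_inv.
Qed.

End bilinear_form.

Section linear_hull.
Context {R : realType} {n : nat}.

Lemma mem_rows p (B : 'M[R]_(p, n)) i : row i B \in [tuple row i B | i < p].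
Proof. by rewrite -(tnth_mktuple (fun i => row i B) i) mem_tnth. Qed.

(** [lin_hull] is selected by [xget], so a least subspace must be exhibited first. As D contains the
    unit vectors, the rows of B belong to the cone and span it. *)
Lemma lin_hullP (K : set 'rV[R]_n) p (B : 'M[R]_(p, n)) (D : set 'rV[R]_p) :
  (forall i, D (delta_mx 0 i)) -> K = [set y *m B | y in D] ->
  forall u, (u \in lin_hull K) = (u <= B)%MS.
Proof.
move=> Dd KE u.
pose U : {vspace 'rV[R]_n} := <<[tuple row i B | i < p]>>%VS.
have UB v : v \in U -> (v <= B)%MS.
  move=> /coord_span ->; apply: summx_sub => i _.
  by rewrite scalemx_sub// -tnth_nth tnth_mktuple row_sub.
have [KL Lmin] : [set U : {vspace 'rV[R]_n} | K `<=` [set` U] /\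
    forall W : {vspace 'rV[R]_n}, K `<=` [set` W] -> (U <= W)%VS] (lin_hull K).
  apply: (xgetPex _ (ex_intro _ U _)); split.
    rewrite KE => _ [y _ <-] /=; rewrite mulmx_sum_row.
    by apply: rpred_sum => i _; apply/rpredZ/memv_span/mem_rows.
  move=> W KW; apply/span_subvP => _ /tnthP[i ->]; rewrite tnth_mktuple; apply: KW.
  by rewrite KE; exists (delta_mx 0 i) => //; rewrite -rowE.
apply/idP/idP => [uL|/submxP[y ->]].
  have LU : (lin_hull K <= U)%VS.
    apply: Lmin; rewrite KE => _ [y _ <-] /=; rewrite mulmx_sum_row.
    by apply: rpred_sum => i _; apply/rpredZ/memv_span/mem_rows.
  by apply: UB; exact: (subvP LU).
rewrite mulmx_sum_row; apply: rpred_sum => i _; apply: rpredZ; apply: KL.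
by rewrite KE; exists (delta_mx 0 i) => //; rewrite -rowE.
Qed.

Lemma dim_lin_hull (L : {vspace 'rV[R]_n}) p (B : 'M[R]_(p, n)) : row_free B ->
  (forall u, (u \in L) = (u <= B)%MS) -> \dim L = p.
Proof.
move=> fB LB; pose X := [tuple row i B | i < p].
have fX : free X.
  apply/freeP => c c0 i.
  have : (\row_j c j) *m B = 0.
    rewrite mulmx_sum_row -[RHS]c0; apply: eq_bigr => j _.
    by rewrite mxE -tnth_nth tnth_mktuple.
  move=> h; have : \row_j c j = 0 by apply: (row_free_inj fB); rewrite mul0mx.
  by move/rowP/(_ i); rewrite !mxE.
have -> : L = <<X>>%VS.
  apply/eqP; rewrite eqEsubv; apply/andP; split; apply/subvP => v.
    rewrite LB => /submxP[y ->]; rewrite mulmx_sum_row.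
    by apply: rpred_sum => i _; apply/rpredZ/memv_span/mem_rows.
  move=> /coord_span ->; apply: rpred_sum => i _; apply: rpredZ.
  by rewrite LB -tnth_nth tnth_mktuple row_sub.
by move: fX; rewrite /free size_tuple => /eqP.
Qed.

End linear_hull.

Section isometry_and_angle.
Context {R : realType}.

(** Equal Gram matrices make y *m B |-> y *m V an isometry of the hulls; [pinvmx B *m V] extends it
    to the ambient space. *)
Lemma isometric_gram n (G : 'M[R]_n) p (B : 'M[R]_(p, n)) m (V : 'M[R]_(p, m))
    (D : set 'rV[R]_p) (K : set 'rV[R]_n) (L : set 'rV[R]_m) :
  (forall i, D (delta_mx 0 i)) -> row_free B -> B *m G *m B^T = V *m V^T ->
  K = [set y *m B | y in D] -> L = [set y *m V | y in D] ->
  isometric (bform G) K (@dot R m) L.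
Proof.
move=> Dd fB gr KE LE; rewrite dot_bform.
have hK := lin_hullP Dd KE; have hL := lin_hullP Dd LE.
pose M := pinvmx B *m V.
have fE y : y *m B *m M = y *m V by rewrite /M -mulmxA [B *m _]mulmxA mulmxVp// mul1mx.
exists (mulmxr M); split.
- move=> u v; rewrite !hK => /submxP[y ->] /submxP[z ->] /=.
  by rewrite !fE !bform_mul gr mulmx1.
- apply/seteqP; split => v /=.
    by move=> [u uK <-] /=; move: uK; rewrite hK hL => /submxP[y ->]; rewrite fE submxMl.
  rewrite hL => /submxP[y ->]; exists (y *m B); last by rewrite /= fE.
  by rewrite /= hK submxMl.
- rewrite KE LE; apply/seteqP; split => v /=.
    by move=> [u [y yD <-] <-]; exists y => //; rewrite /= fE.
  by move=> [y yD <-]; exists (y *m B); [exists y|rewrite /= fE].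
Qed.

(** Orthonormal coordinates and coordinates in the rows of B differ by an invertible matrix. The
    equation q = p is a hypothesis because the dimension of a hull equals p only propositionally. *)
Lemma volume_change n (G : 'M[R]_n) p (B : 'M[R]_(p, n)) q (e : 'M[R]_(q, n)) :
  q = p -> row_free B -> e *m G *m e^T = 1%:M -> (forall i, (row i e <= B)%MS) ->
  exists2 k : R, 0 < k & forall (S : set 'rV[R]_p), measurable S ->
    fine (volume [set c : 'rV[R]_q | [set y *m B | y in S] (c *m e)]) =
    k * fine (rvm p S).
Proof.
move=> qp; subst q => fB ge eB.
have /submxP[E eE] : (e <= B)%MS by apply/row_subP.
have Eu : E \in unitmx.
  move: ge; rewrite eE -!mulmxA => /mulmx1_unit[].
  by [].
have [k k0 kE] := unitmx_scales_volume Eu; exists k => // S mS.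
have -> : [set c : 'rV[R]_p | [set y *m B | y in S] (c *m e)] = [set c | S (c *m E)].
  apply/seteqP; split => c /=.
    by move=> [y yS]; rewrite eE mulmxA => /(row_free_inj fB) <-.
  by move=> cS; exists (c *m E) => //; rewrite eE mulmxA.
rewrite volumeE; last exact: measurable_preimage_mulmxr.
(* For infinite volume both sides are 0, since [fine] sends infinities to 0 and the factor is
   positive. *)
rewrite kE//; case: (rvm p S) => [r| |] //=.
- by rewrite gt0_muley ?lte_fin// mulr0.
- by rewrite gt0_muleNy ?lte_fin// mulr0.
Qed.

Lemma orthonormal_basisP n (G : 'M[R]_n) p (B : 'M[R]_(p, n)) (L : {vspace 'rV[R]_n}) :
  posdef G -> row_free B -> (forall u, (u \in L) = (u <= B)%MS) ->
  let e := orthonormal_basis (bform G) L in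
  e *m G *m e^T = 1%:M /\ forall i, (row i e <= B)%MS.
Proof.
move=> Gp fB LB /=.
have dL := dim_lin_hull fB LB.
have [C Cu CE] := orthonormalize Gp fB.
have [h1 h2] : [set e : 'M[R]_(\dim L, n) |
    (forall i j, bform G (row i e) (row j e) = (i == j)%:R) /\
    (forall i, row i e \in L)] (orthonormal_basis (bform G) L).
  have [e0 [g0 b0]] : exists e0 : 'M[R]_(\dim L, n), e0 *m G *m e0^T = 1%:M /\
      forall i, (row i e0 <= B)%MS.
    move: (\dim L) dL => q ->; exists (C *m B); split => // i.
    by rewrite row_mul submxMl.
  apply: (xgetPex _ (ex_intro _ e0 _)); split => i; last by rewrite LB.
  by move=> j; rewrite bform_row g0 mxE.
split; last by move=> i; rewrite -LB.
by apply/matrixP => i j; rewrite -bform_row h1 mxE.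
Qed.

(** The volume factor between the two coordinate systems is common to numerator and denominator. *)
Lemma solid_angle_ratio n (G : 'M[R]_n) p (B : 'M[R]_(p, n)) (D : set 'rV[R]_p)
    (K : set 'rV[R]_n) :
  posdef G -> row_free B -> measurable D -> (forall i, D (delta_mx 0 i)) ->
  K = [set y *m B | y in D] ->
  let Q y := bform (B *m G *m B^T) y y in
  solid_angle (bform G) K =
  fine (rvm p (D `&` [set y | Q y <= 1])) / fine (rvm p [set y | Q y <= 1]).
Proof.
move=> Gp fB mD Dd KE Q.
have hK := lin_hullP Dd KE.
have [ge eB] := orthonormal_basisP Gp fB hK.
have [k k0 kE] := volume_change (dim_lin_hull fB hK) fB ge eB.
have mQ : measurable [set y : 'rV[R]_p | Q y <= 1].
  apply: measurable_le_set => //.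
  have -> : Q = fun y => \sum_j (y *m (B *m G *m B^T)) 0 j * y 0 j.
    by apply/funext => y; rewrite /Q /bform mxE; apply: eq_bigr => j _; rewrite !mxE.
  apply: measurable_sum => j; apply: measurable_funM; last exact: measurable_coord.
  exact: (measurableT_comp (measurable_coord j) (measurable_mulmxr _)).
rewrite /solid_angle /volume_in.
have -> : K `&` [set u | bform G u u <= 1] = [set y *m B | y in D `&` [set y | Q y <= 1]].
  rewrite KE; apply/seteqP; split => u /=.
    by move=> [[y yD <-]]; rewrite bform_mul => h; exists y.
  by move=> [y [yD h] <-]; rewrite bform_mul; split => //; exists y.
have -> : [set` lin_hull K] `&` [set u | bform G u u <= 1] = [set y *m B | y in [set y | Q y <= 1]].
  apply/seteqP; split => u /=.
    by rewrite hK => -[/submxP[y ->]]; rewrite bform_mul => h; exists y.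
  by move=> [y h <-]; rewrite hK bform_mul submxMl.
rewrite !kE//; last exact: measurableI.
by rewrite -mulf_div divff ?mul1r// gt_eqF.
Qed.

Lemma gauss_quad_gram p (b : 'rV[R]_p) q y :
  bform (1%:M + q *: (b^T *m b)) y y = gauss_quad (fun j => b 0 j) q y.
Proof.
rewrite /bform mulmxDr mulmxDl mulmx1 mxE; congr (_ + _).
  by rewrite mxE; apply: eq_bigr => j _; rewrite mxE -expr2.
have E : y *m (b^T *m b) *m y^T = ((y *m b^T) 0 0 * (b *m y^T) 0 0)%:M.
  by rewrite mulmxA -[LHS]mulmxA [y *m b^T]mx11_scalar [b *m y^T]mx11_scalar -scalar_mxM !mxE.
rewrite -scalemxAr -scalemxAl mxE E mxE eqxx mulr1n; congr (_ * _).
have -> : (y *m b^T) 0 0 = lin_form (fun j => b 0 j) y.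
  by rewrite mxE; apply: eq_bigr => j _; rewrite mxE mulrC.
have -> : (b *m y^T) 0 0 = lin_form (fun j => b 0 j) y.
  by rewrite mxE; apply: eq_bigr => j _; rewrite mxE.
by rewrite expr2.
Qed.

Lemma csqrt_sqr (a : R) : csqrt a ^+ 2 = a%:C.
Proof.
rewrite /csqrt; case: ifPn => [a0|]; first by rewrite -rmorphXn /= sqr_sqrtr.
rewrite -ltNge => a0; rewrite expr2; apply: complexP; rewrite ?cReM ?cImM /=; last by ring.
by rewrite mul0r sub0r -expr2 sqr_sqrtr ?opprK// oppr_ge0 ltW.
Qed.

(** The Sherman-Morrison formula. It inverts the Gram matrices of the cones as well as the Klein
    metric. *)
Lemma gram_rank_one_unit p (b : 'rV[R]_p) q : 0 < 1 + q * \sum_j b 0 j ^+ 2 ->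
  (1%:M - (q / (1 + q * \sum_j b 0 j ^+ 2)) *: (b^T *m b)) *m (1%:M + q *: (b^T *m b)) = 1%:M.
Proof.
move=> h; set t := \sum_j _ in h *.
have bb : b^T *m b *m (b^T *m b) = t *: (b^T *m b).
  rewrite mulmxA -[b^T *m b *m b^T]mulmxA [b *m b^T]mx11_scalar.
  rewrite mul_mx_scalar -scalemxAl; congr (_ *: _).
  by rewrite mxE; apply: eq_bigr => j _; rewrite mxE expr2.
rewrite mulmxBl mul1mx mulmxDr mulmx1 -scalemxAl -scalemxAr bb !scalerA -addrA.
rewrite -scalerDl -scalerBl (_ : _ - _ = 0) ?scale0r ?addr0//.
by field; rewrite gt_eqF.
Qed.

(** A number with real square is real or purely imaginary: either its real part vanishes, or (Re
    z)^2 = - q. *)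
Lemma Re_sqr_mul_lt1 (z : R[i]) (q t : R) : z ^+ 2 = (- q)%:C -> 0 <= t ->
  0 < 1 + q * t -> 0 < 1 - cRe z ^+ 2 * t.
Proof.
move=> /[dup] /(congr1 (@complex.Im _)) + /(congr1 (@complex.Re _)).
rewrite expr2 cReM cImM cRe_real cIm_real => i0 zz t0 h.
have : cRe z * cIm z = 0 by lra.
move=> /eqP; rewrite mulf_eq0 => /orP[] /eqP z0.
  by rewrite z0 expr0n mul0r subr0.
by move: zz; rewrite z0 mulr0 subr0 -expr2 => ->; rewrite mulNr opprK.
Qed.

(** By [integral_exp_cone] the volume ratio equals the ratio of Gaussian masses, which
    [gauss_mass_ratio] evaluates with z = c sigma. Allowing any square root c makes the result
    independent of the branch of [csqrt]. *)
Theorem solid_angle_gauss n (G : 'M[R]_n) p (B : 'M[R]_(p, n)) (b : 'rV[R]_p) (q : R)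
    (J : pred 'I_p) (K : set 'rV[R]_n) (c : R[i]) :
  posdef G -> B *m G *m B^T = 1%:M + q *: (b^T *m b) ->
  0 < 1 + q * \sum_j b 0 j ^+ 2 ->
  K = [set y *m B | y in half_box J] ->
  c ^+ 2 = (- q / (1 + q * \sum_j b 0 j ^+ 2))%:C ->
  (solid_angle (bform G) K)%:C = Phi_gauss_integral J (fun j => c * (b 0 j)%:C).
Proof.
move=> Gp gr h KE cE.
have fB : row_free B.
  apply: (row_free_gram (G := G)); rewrite gr.
  by have /mulmx1_unit[] := gram_rank_one_unit h.
have Dd i : half_box J (delta_mx 0 i : 'rV[R]_p) by move=> j _; rewrite mxE /=; case: (_ == _).
pose sigma := Num.sqrt (1 + q * \sum_j b 0 j ^+ 2).
have sigma0 : 0 < sigma by rewrite sqrtr_gt0.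
pose z := c * sigma%:C.
have zE : z ^+ 2 = (- q)%:C.
  rewrite /z exprMn cE -rmorphXn -rmorphM /= sqr_sqrtr ?(ltW h)//.
  by rewrite divfK// gt_eqF.
have hz : 0 < 1 - cRe z ^+ 2 * \sum_j b 0 j ^+ 2.
  by apply: (Re_sqr_mul_lt1 zE) => //; apply: sumr_ge0 => j _; exact: sqr_ge0.
have [f1 f2 m0 _] := gauss_mass_ratio J h zE hz.
have -> : (fun j => z * (b 0 j)%:C / (Num.sqrt (1 + q * \sum_j b 0 j ^+ 2))%:C) =
    (fun j => c * (b 0 j)%:C).
  apply/funext => j; rewrite /z -/sigma mulrAC mulfK//.
  by rewrite (inj_eq (@complexI R) sigma 0) gt_eqF.
move=> <-.
rewrite (solid_angle_ratio Gp fB (measurable_half_box J) Dd KE) gr.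
pose Q := gauss_quad (fun j => b 0 j) q.
have QE y : bform (1%:M + q *: (b^T *m b)) y y = Q y by exact: gauss_quad_gram.
have Q0 y : 0 <= Q y by rewrite -QE -gr -bform_mul; exact: posdef_ge0.
have QZ r y : Q (r *: y) = r ^+ 2 * Q y.
  rewrite -!QE /bform linearZ /= -!scalemxAl -scalemxAr scalerA mxE.
  by rewrite expr2.
have [k kE] := integral_exp_cone (measurable_gauss_quad (fun j => b 0 j) q) Q0 QZ.
have hbZ J' r (y : 'rV[R]_p) : 0 < r -> half_box J' y -> half_box J' (r *: y).
  by move=> r0 hy j Jj; rewrite mxE; apply: mulr_ge0; [exact: ltW|exact: hy].
have EJ := kE _ (measurable_half_box J) (hbZ J).
have E0 := kE _ (measurable_half_box pred0) (hbZ pred0).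
have hT : half_box pred0 = [set: 'rV[R]_p] by apply/seteqP; split.
rewrite hT setTI in E0.
have -> : [set y | bform (1%:M + q *: (b^T *m b)) y y <= 1] = [set y | Q y <= 1].
  by apply/seteqP; split => y /=; rewrite QE.
set VJ := rvm p _ in EJ *; set V0 := rvm p _ in E0 *.
have V00 : (0 <= V0)%E by exact: measure_ge0.
have VJ0 : (0 <= VJ)%E by exact: measure_ge0.
have VJ1 : (VJ <= V0)%E.
  apply: le_measure; rewrite ?inE //.
  - by apply: measurableI; [exact: measurable_half_box|exact: measurable_le_set (measurable_gauss_quad _ _) _].
  - exact: measurable_le_set (measurable_gauss_quad _ _) _.
congr _%:C.
have mJ : gauss_mass (fun j => b 0 j) q J = (k * VJ)%E by exact: EJ.
have mm0 : gauss_mass (fun j => b 0 j) q pred0 = (k * V0)%E by rewrite /gauss_mass hT; exact: E0.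
rewrite mJ mm0; rewrite mm0 in f2 m0.
(* The constant k and the volumes are extended reals. Since k V0 is finite and positive, k and V0
   are both finite and nonzero, so k can be cancelled. *)
case: V0 V00 VJ1 f2 m0 {E0 mm0} => [v0| |] //=.
- move=> v00; case: VJ VJ0 {EJ mJ} => [vJ| |] //= vJ0 vJ1.
  have [->|v0n] := eqVneq v0 0; first by rewrite mule0 /= ltxx.
  have v0p : 0 < v0 by rewrite lt_neqAle eq_sym v0n -lee_fin.
  case: k {kE} => [r| |]; first 1 last.
  + by rewrite gt0_mulye ?lte_fin.
  + by rewrite gt0_mulNye ?lte_fin.
  rewrite /= => _ r0.
  have rn : r != 0 by apply: contraTneq r0 => ->; rewrite mul0r ltxx.
  by rewrite -mulf_div divff ?mul1r.
- move=> _ _; case: k {kE mJ EJ} => [r| |] //=.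
  case: (ltgtP r 0) => [r0|r0|->]; rewrite ?mul0e ?ltxx//.
  + by rewrite lt0_muley ?lte_fin.
  + by rewrite gt0_muley ?lte_fin.
Qed.

End isometry_and_angle.

(** * Polar cones of cones with rank-one perturbed Gram matrix *)

Lemma bform_rowr (R : realType) n p (G : 'M[R]_n) (B : 'M[R]_(p, n)) u i :
  bform G u (row i B) = (u *m G *m B^T) 0 i.
Proof. by rewrite /bform !mxE; apply: eq_bigr => l _; rewrite !mxE. Qed.

Section polar_cone.
Context {R : realType} {n k m : nat}.
Variables (G : 'M[R]_n) (B : 'M[R]_(m, n)).
Hypotheses (Gp : posdef G) (fB : row_free B) (nkm : n = (k + m)%N).

(** The G-orthogonal complement of the row space of B is the kernel of G B^T, of dimension n - m =
    k. *)
Lemma orthonormal_complement :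
  exists2 E : 'M[R]_(k, n), E *m G *m E^T = 1%:M & E *m G *m B^T = 0.
Proof.
pose K := kermx (G *m B^T).
have Gu : G \in unitmx.
  have [C CE] := posdef_diag Gp.
  by move: CE; rewrite -mulmxA => /mulmx1_unit[_]; rewrite unitmx_mul => /andP[].
have KG : K *m (G *m B^T) = 0 by exact: mulmx_ker.
have rK : \rank K = k.
  rewrite mxrank_ker -mxrank_tr trmx_mul trmxK mxrankMfree; last by rewrite row_free_unit unitmx_tr.
  by move: fB => /eqP ->; rewrite nkm addnK.
have [E0 fE0 E0K] : exists2 E0 : 'M[R]_(k, n), row_free E0 & E0 *m G *m B^T = 0.
  rewrite -rK; exists (row_base K); first exact: row_base_free.
  have /submxP[Y ->] : (row_base K <= K)%MS by rewrite eq_row_base.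
  by rewrite -mulmxA -[Y *m K *m _]mulmxA KG mulmx0.
have [C _ CE] := orthonormalize Gp fE0; exists (C *m E0) => //.
by rewrite -2!mulmxA [E0 *m _]mulmxA E0K mulmx0.
Qed.

Lemma complement_decomp (E : 'M[R]_(k, n)) (Z : 'M[R]_(m, n)) (u : 'rV[R]_n) :
  E *m G *m E^T = 1%:M -> E *m G *m Z^T = 0 -> Z *m G *m Z^T \in unitmx ->
  exists e z, u = e *m E + z *m Z.
Proof.
move=> EE EZ ZZ.
have ZE : Z *m G *m E^T = 0.
  by apply: trmx_inj; rewrite trmx0 !trmx_mul trmxK Gp.1 mulmxA.
have fM : row_free (col_mx E Z).
  apply: (row_free_gram (G := G)).
  rewrite mul_col_mx tr_col_mx mul_col_row EE EZ ZE.
  by rewrite unitmxE det_ublock det1 mul1r -unitmxE.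
have : (u <= col_mx E Z)%MS.
  by apply: submx_full; rewrite -col_leq_rank (eqP fM) nkm.
move=> /submxP[y ->]; exists (lsubmx y), (rsubmx y).
by rewrite -mul_row_col hsubmxK.
Qed.

End polar_cone.

Section rank_one_cone.
Context {R : realType} {n k m : nat}.
Variables (G : 'M[R]_n) (B : 'M[R]_(m, n)) (b : 'rV[R]_m) (q : R).
Hypotheses (Gp : posdef G) (nkm : n = (k + m)%N).
Hypothesis gram : B *m G *m B^T = 1%:M + q *: (b^T *m b).
Let t := \sum_j b 0 j ^+ 2.
Hypothesis qt : 0 < 1 + q * t.

Let q' := q / (1 + q * t).
Let A : 'M[R]_m := 1%:M - q' *: (b^T *m b).

Let Atr : A^T = A.
Proof. by rewrite /A linearB linearZ /= trmx1 trmx_mul trmxK. Qed.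

Let AB : A *m (B *m G *m B^T) = 1%:M.
Proof. by rewrite gram; exact: gram_rank_one_unit. Qed.

Let BA : B *m G *m B^T *m A = 1%:M.
Proof. exact: mulmx1C. Qed.

Lemma gram_unit : B *m G *m B^T \in unitmx.
Proof. by have /mulmx1_unit[] := AB. Qed.

Let fB : row_free B := row_free_gram gram_unit.

(** A is the inverse Gram matrix of B, so the rows of A B form the basis dual to B; the sign turns
    the dual cone into the polar one. *)
Definition polar_rows (E : 'M[R]_(k, n)) : 'M[R]_(k + m, n) := col_mx E (- (A *m B)).

Lemma polar_rows_gram (E : 'M[R]_(k, n)) :
  E *m G *m E^T = 1%:M -> E *m G *m B^T = 0 ->
  polar_rows E *m G *m (polar_rows E)^T = block_mx 1%:M 0 0 A.
Proof.
move=> EE EB; rewrite mul_col_mx tr_col_mx mul_col_row EE.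
have X : E *m G *m (- (A *m B))^T = 0.
  by rewrite linearN /= trmx_mul mulmxN mulmxA EB mul0mx oppr0.
have -> : - (A *m B) *m G *m E^T = 0.
  by apply: trmx_inj; rewrite trmx0 !trmx_mul trmxK Gp.1 mulmxA.
rewrite X; congr block_mx.
rewrite linearN /= trmx_mul Atr !mulNmx mulmxN opprK.
by rewrite -!mulmxA [B *m (G *m _)]mulmxA [B *m G *m (_ *m _)]mulmxA BA mulmx1.
Qed.

(** Padding b with zeros on the lineality space brings the polar cone to the form required by
    [solid_angle_gauss], with parameter - q'. *)
Lemma polar_rows_rank_one (E : 'M[R]_(k, n)) :
  E *m G *m E^T = 1%:M -> E *m G *m B^T = 0 ->
  let c := row_mx (0 : 'rV[R]_k) b in
  polar_rows E *m G *m (polar_rows E)^T = 1%:M + (- q') *: (c^T *m c).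
Proof.
move=> EE EB /=; rewrite polar_rows_gram// tr_row_mx mul_col_row trmx0 !mul0mx !mulmx0.
rewrite [X in _ = X + _]scalar_mx_block scale_block_mx !scaler0 add_block_mx !addr0.
by rewrite scaleNr.
Qed.

(** By duality the pairing of row i of B with y *m polar_rows E is minus the i-th of the last m
    coordinates of y, so each constraint is a sign condition on one coordinate. *)
Lemma polar_cone (E : 'M[R]_(k, n)) :
  E *m G *m E^T = 1%:M -> E *m G *m B^T = 0 ->
  [set u : 'rV[R]_n | forall i, bform G (row i B) u <= 0] =
  [set y *m polar_rows E | y in half_box (fun j : 'I_(k + m) => k <= j)%N].
Proof.
move=> EE EB.
have AA : (A *m B) *m G *m (A *m B)^T = A.
  rewrite trmx_mul Atr -!mulmxA [B *m (G *m _)]mulmxA [B *m G *m (_ *m _)]mulmxA.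
  by rewrite BA mulmx1.
have BE : B *m G *m E^T = 0.
  by apply: trmx_inj; rewrite trmx0 !trmx_mul trmxK Gp.1 mulmxA.
have val_row y i : bform G (row i B) (y *m polar_rows E) = - rsubmx y 0 i.
  rewrite /bform -!row_mul -(hsubmxK y) /polar_rows mul_row_col.
  rewrite mulmxN row_mxKr.
  have -> : B *m G *m (lsubmx y *m E - rsubmx y *m (A *m B))^T = - (rsubmx y)^T.
    rewrite linearB /= mulmxBr !trmx_mul !mulmxA BE mul0mx sub0r Atr.
    by rewrite BA mul1mx.
  by rewrite !mxE.
apply/seteqP; split => u /=.
  have [e [z ->]] : exists e z, u = e *m E + z *m (- (A *m B)).
    apply: (complement_decomp Gp nkm) => //.
      by rewrite linearN /= trmx_mul mulmxN mulmxA EB mul0mx oppr0.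
    rewrite linearN /= !mulNmx mulmxN opprK AA.
    by have /mulmx1_unit[] := AB.
  rewrite -mul_row_col -/(polar_rows E) => h; exists (row_mx e z) => // j kj.
  case: (split_ordP j) kj => i -> /=; first by rewrite leqNgt ltn_ord.
  by move=> _; rewrite row_mxEr; move: (h i); rewrite val_row row_mxKr oppr_le0.
by move=> [y hy <-] i; rewrite val_row oppr_le0 mxE; apply: hy => /=; rewrite leq_addr.
Qed.

(** A bipolar theorem by explicit test vectors: the rows of E and their negatives kill the component
    of v outside the span of B, and the negated dual basis reads off the signs of its coordinates in
    B. *)
Lemma polar_polar :
  [set v : 'rV[R]_n | forall u, (forall i, bform G (row i B) u <= 0) -> bform G v u <= 0] =
  [set y *m B | y in half_box xpredT].
Proof.
have [E EE EB] := orthonormal_complement Gp fB nkm.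
have bfN (v u : 'rV[R]_n) : bform G v (- u) = - bform G v u.
  by rewrite /bform linearN mulmxN mxE.
have BE : B *m G *m E^T = 0.
  by apply: trmx_inj; rewrite trmx0 !trmx_mul trmxK Gp.1 mulmxA.
apply/seteqP; split => v /=; last first.
  move=> [y hy <-] u hu; rewrite /bform [y *m B]mulmx_sum_row !mulmx_suml summxE.
  apply: sumr_le0 => i _; rewrite -!scalemxAl mxE; apply: mulr_ge0_le0; last exact: hu.
  exact: hy.
have [e [z ->]] := complement_decomp Gp nkm v EE EB gram_unit.
move=> h.
have hE i : bform G (e *m E + z *m B) (row i E) = e 0 i.
  rewrite bform_rowr !mulmxDl -[e *m E *m G]mulmxA -[e *m _ *m _]mulmxA EE mulmx1.
  by rewrite -[z *m B *m G]mulmxA -[z *m _ *m _]mulmxA BE mulmx0 addr0.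
have BEi i j : bform G (row i B) (row j E) = 0 by rewrite bform_rowr -!row_mul BE !mxE.
have e0 : e = 0.
  apply/rowP => i; rewrite [RHS]mxE; apply/eqP; rewrite eq_le -[e 0 i]hE h /=.
    by rewrite -oppr_le0 -bfN h// => j; rewrite bfN BEi oppr0.
  by move=> j; rewrite BEi.
rewrite e0 mul0mx add0r; exists z => // i _.
have : bform G (e *m E + z *m B) (- row i (A *m B)) <= 0.
  apply: h => j; rewrite bfN bform_rowr -!row_mul trmx_mul Atr mulmxA BA.
  by rewrite !mxE oppr_le0 ler0n.
rewrite e0 mul0mx add0r bfN oppr_le0 bform_rowr trmx_mul Atr.
by rewrite -!mulmxA [B *m (G *m _)]mulmxA [B *m G *m (_ *m _)]mulmxA BA mulmx1.
Qed.

End rank_one_cone.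

(** * The Klein model and the orthocentric simplex *)

Section klein_metric.
Context {R : realType} {d : nat}.
Implicit Types (x u v : 'rV[R]_d) (kappa : R).

Lemma dot_ge0 u : 0 <= dot u u.
Proof. by rewrite dotE; exact/posdef_ge0/posdef1. Qed.

Lemma dot_eq0 u : dot u u = 0 -> u = 0.
Proof.
move=> h; apply/eqP; apply: contraT => /((posdef1 d).2 _).
by rewrite -dotE h ltxx.
Qed.

Lemma enorm_sqr u : enorm u ^+ 2 = dot u u.
Proof. by rewrite /enorm sqr_sqrtr// dot_ge0. Qed.

Lemma dotC u v : dot u v = dot v u.
Proof. by apply: eq_bigr => i _; rewrite mulrC. Qed.

Lemma dotDr u v w : dot u (v + w) = dot u v + dot u w.
Proof. by rewrite -big_split; apply: eq_bigr => i _; rewrite mxE mulrDr. Qed.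

Lemma dotZr u a v : dot u (a *: v) = a * dot u v.
Proof. by rewrite mulr_sumr; apply: eq_bigr => i _; rewrite mxE mulrCA. Qed.

Lemma dotNr u v : dot u (- v) = - dot u v.
Proof. by rewrite -scaleN1r dotZr mulN1r. Qed.

Lemma dotNl u v : dot (- u) v = - dot u v.
Proof. by rewrite dotC dotNr dotC. Qed.

Lemma dot_sumr u I (r : seq I) (P : pred I) (F : I -> 'rV[R]_d) :
  dot u (\sum_(i <- r | P i) F i) = \sum_(i <- r | P i) dot u (F i).
Proof.
elim/big_rec2: _ => [|i a y _ <-]; last by rewrite dotDr.
by rewrite /dot big1// => i _; rewrite mxE mulr0.
Qed.

Lemma klein_factor_gt0 kappa x : klein_ball kappa x -> 0 < 1 + kappa * dot x x.
Proof.
have x0 := dot_ge0 x.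
have [k0 _|k0 [|]] := leP 0 kappa; first by rewrite ltr_pwDl// mulr_ge0.
  by rewrite leNgt k0.
have kp : 0 < - kappa by rewrite oppr_gt0.
have sk : 0 < Num.sqrt (- kappa) by rewrite sqrtr_gt0.
rewrite -(ltr_pM2l sk) divff ?gt_eqF// => h.
have : (Num.sqrt (- kappa) * enorm x) ^+ 2 < 1.
  by rewrite expr_lt1// mulr_ge0// ?sqrtr_ge0.
by rewrite exprMn sqr_sqrtr ?ltW// enorm_sqr mulNr -subr_gt0 opprK.
Qed.

Definition klein_gram kappa x : 'M[R]_d :=
  (1 + kappa * dot x x)^-1 *: (1%:M - (kappa / (1 + kappa * dot x x)) *: (x^T *m x)).

Definition klein_gram_inv kappa x : 'M[R]_d :=
  (1 + kappa * dot x x) *: (1%:M + kappa *: (x^T *m x)).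

Lemma klein_metricE kappa x : klein_ball kappa x ->
  @klein_metric R kappa d x = bform (klein_gram kappa x).
Proof.
move=> /klein_factor_gt0 w0; apply/funext => u; apply/funext => v.
rewrite /klein_metric enorm_sqr /bform /klein_gram; set w := 1 + _ in w0 *.
rewrite -scalemxAr mulmxBr mulmx1 -scalemxAr -scalemxAl mulmxBl -scalemxAl.
have -> : u *m (x^T *m x) *m v^T = (dot x u * dot x v)%:M.
  rewrite mulmxA -[LHS]mulmxA [u *m x^T]mx11_scalar [x *m v^T]mx11_scalar -scalar_mxM.
  congr (_ * _)%:M; rewrite mxE; apply: eq_bigr => i _; rewrite mxE//.
  by rewrite mulrC.
have -> : u *m v^T = (dot u v)%:M.
  by rewrite [LHS]mx11_scalar dotE /bform mulmx1.
rewrite !mxE eqxx !mulr1n; field; by rewrite gt_eqF.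
Qed.

Lemma klein_gramK kappa x : klein_ball kappa x ->
  klein_gram kappa x *m klein_gram_inv kappa x = 1%:M.
Proof.
move=> /klein_factor_gt0 w0; rewrite /klein_gram /klein_gram_inv.
rewrite -scalemxAl -scalemxAr scalerA mulVf ?gt_eqF// scale1r.
have xx : \sum_j x 0 j ^+ 2 = dot x x by apply: eq_bigr => j _; rewrite expr2.
by rewrite -xx; apply: gram_rank_one_unit; rewrite xx.
Qed.

(** For kappa < 0 both terms of the metric are nonnegative. For kappa >= 0 the subtracted term has
    the wrong sign, but the inverse matrix M is visibly positive definite, and G = G M G^T. *)
Lemma posdef_klein kappa x : klein_ball kappa x -> posdef (klein_gram kappa x).
Proof.
move=> bx; have w0 := klein_factor_gt0 bx; have GM := klein_gramK bx.
have Gs : (klein_gram kappa x)^T = klein_gram kappa x.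
  by rewrite /klein_gram linearZ linearB linearZ /= trmx1 trmx_mul trmxK.
have xxE (u : 'rV[R]_d) : u *m (x^T *m x) *m u^T = (dot x u ^+ 2)%:M.
  rewrite mulmxA -[LHS]mulmxA [u *m x^T]mx11_scalar [x *m u^T]mx11_scalar -scalar_mxM.
  rewrite expr2; congr (_ * _)%:M; rewrite mxE; apply: eq_bigr => i _; rewrite mxE//.
  by rewrite mulrC.
have uuE (u : 'rV[R]_d) : u *m u^T = (dot u u)%:M.
  by rewrite [LHS]mx11_scalar dotE /bform mulmx1.
have [k0|k0] := leP 0 kappa; last first.
  split => // u u0; rewrite /bform /klein_gram.
  rewrite -scalemxAr mulmxBr mulmx1 -scalemxAr -scalemxAl mulmxBl -scalemxAl xxE uuE.
  rewrite !mxE eqxx !mulr1n mulr_gt0 ?invr_gt0// ltr_wpDr//.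
    rewrite oppr_ge0 mulr_le0_ge0 ?sqr_ge0//.
    by rewrite mulr_le0_ge0 ?(ltW k0)// invr_ge0 ltW.
  by rewrite dotE; exact: (posdef1 d).2.
have Mp : posdef (klein_gram_inv kappa x).
  split; first by rewrite /klein_gram_inv linearZ linearD linearZ /= trmx1 trmx_mul trmxK.
  move=> u u0; rewrite /bform /klein_gram_inv.
  rewrite -scalemxAr mulmxDr mulmx1 -scalemxAr -scalemxAl mulmxDl -scalemxAl xxE uuE.
  rewrite !mxE eqxx !mulr1n mulr_gt0// ltr_wpDr//.
    by apply: mulr_ge0 => //; exact: sqr_ge0.
  by rewrite dotE; exact: (posdef1 d).2.
have Gu : klein_gram kappa x \in unitmx by have /mulmx1_unit[] := GM.
rewrite -[klein_gram kappa x]mulmx1 -(mulmx1C GM) mulmxA -{2}Gs.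
by apply: posdef_congr Mp _; rewrite row_free_unit.
Qed.

End klein_metric.

Lemma big_ord_tail (T : Type) (idx : T) (op : Monoid.law idx) (d k : nat) (F : 'I_d.+1 -> T) :
  \big[op/idx]_(j < d.+1 | (k < j)%N) F j =
  \big[op/idx]_(i < d - k) F (inord (k.+1 + i)).
Proof.
have E : \big[op/idx]_(j < d.+1 | (k < j)%N) F j =
    \big[op/idx]_(0 <= j < d.+1 | (k < j)%N) F (inord j).
  by rewrite big_mkord; apply: eq_big => // j _; rewrite inord_val.
rewrite E -(big_mkord xpredT (fun i => F (inord (k.+1 + i)))).
transitivity (\big[op/idx]_(k.+1 <= j < d.+1) F (inord j)).
  by rewrite (@big_nat_widenl _ _ _ k.+1 0).
by rewrite -{1}[k.+1]add0n big_addn subSS; apply: eq_bigr => i _; rewrite addnC.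
Qed.

(** * The orthocentric simplex, its facets and its tangent cones *)

Section simplex.
Context {R : realType} {d : nat}.
Variables (tau : 'I_d.+1 -> R) (v : 'I_d.+1 -> 'rV[R]_d).
Let s := \sum_j tau j ^+ 2.
Hypotheses (d0 : (0 < d)%N) (tau0 : forall j, 0 < tau j).
Hypothesis vv : forall j l, dot (v j) (v l) = - s^-1 + (j == l)%:R / tau j ^+ 2.

Let tau20 j : 0 < tau j ^+ 2. Proof. by rewrite exprn_gt0. Qed.

Lemma tail_lt (A : pred 'I_d.+1) j : ~~ A j -> \sum_(l | A l) tau l ^+ 2 < s.
Proof.
move=> Aj; rewrite /s [ltRHS](bigID A) /= ltrDl (bigD1 j) //= ltr_wpDr//.
by apply: sumr_ge0 => i _; exact: ltW.
Qed.

Let s0 : 0 < s.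
Proof.
by rewrite /s (bigD1 ord0)//= ltr_wpDr// sumr_ge0// => j _; exact: ltW.
Qed.

Let sn0 : s != 0. Proof. by rewrite gt_eqF. Qed.

(** The sum is orthogonal to every v_j, hence to itself. Thus the origin has barycentric coordinates
    tau_j^2 / s. *)
Lemma weighted_sum0 : \sum_j tau j ^+ 2 *: v j = 0.
Proof.
apply: dot_eq0; rewrite dot_sumr big1// => j _.
rewrite dotZr dotC dot_sumr.
rewrite (eq_bigr (fun l => tau l ^+ 2 * - s^-1 + (j == l)%:R)); last first.
  move=> l _; rewrite dotZr vv mulrDr; congr (_ + _).
  have [->|] := eqVneq j l; last by rewrite mul0r mulr0.
  by rewrite mul1r divff// gt_eqF.
rewrite big_split /= -mulr_suml -/s mulrN divff// (bigD1 j)//= eqxx big1 ?addr0 ?addNr ?mulr0//.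
by move=> l lj; rewrite eq_sym (negbTE lj).
Qed.

(** The barycentric coordinates of y with respect to the v_j, written as affine functions of y. *)
Let bary (y : 'rV[R]_d) j := tau j ^+ 2 * (dot (v j) y + s^-1).

Lemma bary_comb (c : 'I_d.+1 -> R) j : \sum_l c l = 1 -> bary (\sum_l c l *: v l) j = c j.
Proof.
move=> c1; rewrite /bary dot_sumr.
rewrite (eq_bigr (fun l => c l * - s^-1 + (j == l)%:R * c l / tau j ^+ 2)); last first.
  by move=> l _; rewrite dotZr vv mulrDr; congr (_ + _); rewrite mulrCA mulrA.
rewrite big_split /= -mulr_suml c1 mul1r (bigD1 j)//= eqxx big1 => [|l lj].
  by rewrite addr0 mul1r addrAC addNr add0r mulrC divfK// gt_eqF.
by rewrite eq_sym (negbTE lj) !mul0r.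
Qed.

Lemma bary_sum y : \sum_j bary y j = 1.
Proof.
rewrite (eq_bigr (fun j => dot y (tau j ^+ 2 *: v j) + tau j ^+ 2 / s)); last first.
  by move=> j _; rewrite /bary mulrDr dotZr dotC.
by rewrite big_split /= -dot_sumr weighted_sum0 -mulr_suml -/s divff// dotE /bform trmx0 mulmx0 mxE add0r.
Qed.

(** Multiplying v_j by tau_j turns the diagonal part 1 / tau_j^2 of the Gram matrix into the
    identity. *)
Definition scaled_rows p (h : 'I_p -> 'I_d.+1) : 'M[R]_(p, d) :=
  \matrix_(i, l) (tau (h i) * v (h i) 0 l).

Lemma row_scaled_rows p (h : 'I_p -> 'I_d.+1) i : row i (scaled_rows h) = tau (h i) *: v (h i).
Proof. by apply/rowP => l; rewrite !mxE. Qed.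

Lemma scaled_rows_gram p (h : 'I_p -> 'I_d.+1) : injective h ->
  let b := \row_i tau (h i) in
  scaled_rows h *m (scaled_rows h)^T = 1%:M + (- s^-1) *: (b^T *m b).
Proof.
move=> hi b; apply/matrixP => i j; rewrite -[X in X *m _^T]mulmx1 -bform_row -dotE.
rewrite !row_scaled_rows dotZr dotC dotZr dotC vv !mxE big_ord1 !mxE.
rewrite -(inj_eq hi); case: (eqVneq (h i) (h j)) => [<-|_]; last by rewrite mul0r addr0 add0r; ring.
by field; rewrite sn0 gt_eqF.
Qed.

(** Omitting an index makes the sum of the remaining tau^2 smaller than s, so the Gram matrix 1 -
    b^T b / s is invertible. *)
Lemma scaled_rows_free p (h : 'I_p -> 'I_d.+1) j : injective h -> (forall i, h i != j) ->
  row_free (scaled_rows h).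
Proof.
move=> hi hj; apply: (row_free_gram (G := 1%:M)); rewrite mulmx1 scaled_rows_gram//.
set b := \row_i _.
have /gram_rank_one_unit/mulmx1_unit[] // : 0 < 1 + - s^-1 * \sum_i b 0 i ^+ 2.
rewrite mulNr subr_gt0 mulrC ltr_pdivrMr// mul1r.
rewrite (eq_bigr (fun i => tau (h i) ^+ 2)) => [|i _]; last by rewrite mxE.
rewrite -(big_imset (h := h) (A := xpredT) (fun l => tau l ^+ 2)) /=; last by move=> ? ? _ _; exact: hi.
by apply: (@tail_lt _ j); apply/negP => /imsetP[i _] /eqP; rewrite eq_sym (negbTE (hj i)).
Qed.

Lemma dot_vertices_eq0 z : (forall j, dot (v j) z = 0) -> z = 0.
Proof.
move=> hz.
have hj i : lift ord0 i != ord0 :> 'I_d.+1 by rewrite eq_sym neq_lift.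
have fV := scaled_rows_free (@lift_inj _ ord0) hj.
have Vu : scaled_rows (lift ord0) \in unitmx by rewrite -row_free_unit.
apply: trmx_inj; rewrite trmx0 -[z^T](mulKmx Vu).
rewrite [scaled_rows _ *m _](_ : _ = 0) ?mulmx0//.
apply/matrixP => i j; rewrite [RHS]mxE ord1.
have -> : (scaled_rows (lift ord0) *m z^T) i 0 = dot z (tau (lift ord0 i) *: v (lift ord0 i)).
  rewrite mxE; apply: eq_bigr => l _; rewrite !mxE mulrC.
  by [].
by rewrite dotZr dotC hz mulr0.
Qed.

Lemma bary_expand y : y = \sum_j bary y j *: v j.
Proof.
apply/eqP; rewrite -subr_eq0; apply/eqP/dot_vertices_eq0 => j.
rewrite dotDr dotNr; apply: (@mulfI _ (tau j ^+ 2)); first by rewrite gt_eqF.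
have := bary_comb j (bary_sum y); rewrite {1}/bary => E.
by rewrite mulr0 mulrBr -[X in X - _](addrK (tau j ^+ 2 / s)) -[X in _ - X](addrK (tau j ^+ 2 / s)) -!mulrDr E subrr.
Qed.

Let a j := - v j.

(** The j-th inequality says that the j-th barycentric coordinate is nonnegative: - v_j is an outer
    normal of the facet opposite to v_j. *)
Lemma simplex_halfspaces : conv_pts v = [set y | forall j, dot (a j) y <= s^-1].
Proof.
have E y j : (dot (a j) y <= s^-1) = (0 <= bary y j).
  by rewrite /a dotNl /bary pmulr_rge0// -subr_ge0 opprK addrC.
apply/seteqP; split => y /=.
  by move=> [c [c0 c1 ->]] j; rewrite E bary_comb.
move=> h; exists (bary y); split; [by move=> j; rewrite -E|exact: bary_sum|].
exact: bary_expand.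
Qed.

Lemma simplex_irredundant : irredundant_rep (conv_pts v) a (fun=> s^-1).
Proof.
have [l lP] : exists l : 'I_d.+1 -> 'I_d.+1, forall j, l j != j.
  exists (fun j => if j == ord0 then ord_max else ord0) => j.
  by case: (eqVneq j ord0) => [->|jn]; rewrite -?val_eqE /= -?lt0n// eq_sym.
split; first exact: simplex_halfspaces.
- move=> j; rewrite oppr_eq0; apply/eqP => vj0.
  have := vv (l j) j; rewrite vj0 (negbTE (lP j)) mul0r addr0.
  rewrite dotE /bform trmx0 mulmx0 mxE => /eqP.
  by rewrite eq_sym oppr_eq0 invr_eq0 (negbTE sn0).
- move=> j E.
  (* The point with barycentric coordinates -1 at j, 2 at another vertex and 0 elsewhere violates
     inequality j alone. *)
  pose c i : R := if i == j then -1 else if i == l j then 2%:R else 0.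
  have c1 : \sum_i c i = 1.
    rewrite (bigD1 j)//= (bigD1 (l j)) ?lP//= big1 => [|i /andP[ij il]].
      by rewrite /c eqxx (negbTE (lP j)) eqxx addr0; ring.
    by rewrite /c (negbTE ij) (negbTE il).
  have Eb y i : (dot (a i) y <= s^-1) = (0 <= bary y i).
    by rewrite /a dotNl /bary pmulr_rge0// -subr_ge0 opprK addrC.
  have : conv_pts v (\sum_i c i *: v i).
    rewrite E /= => i ij; rewrite Eb bary_comb// /c (negbTE ij).
    by case: ifP.
  rewrite simplex_halfspaces /= => /(_ j); rewrite Eb bary_comb// /c eqxx.
  by rewrite lerNr oppr0 ler10.
Qed.

Section face.
Variable k : nat.
Hypothesis kd : (k < d)%N.
Let w (i : 'I_k.+1) := v (inord i).
Let F := conv_pts w.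

Let inord_tail (i : 'I_k.+1) : (inord i : 'I_d.+1) = i :> nat.
Proof. by rewrite inordK// (leq_trans (ltn_ord i))// ltnS ltnW. Qed.

Lemma face_dot y (j : 'I_d.+1) : (k < j)%N -> F y -> dot (v j) y = - s^-1.
Proof.
move=> kj [c [c0 c1 ->]]; rewrite dot_sumr.
rewrite (eq_bigr (fun i => c i * - s^-1)) => [|i _]; first by rewrite -mulr_suml c1 mul1r.
rewrite dotZr vv; case: eqVneq => [ji|_]; last by rewrite mul0r addr0.
by move: kj; rewrite ji inord_tail ltnNge -ltnS ltn_ord.
Qed.

Lemma face_vertex i : F (w i).
Proof.
exists (fun l => (l == i)%:R); split.
- by move=> l; exact: ler0n.
- by rewrite (bigD1 i)//= eqxx big1 ?addr0// => l /negbTE ->.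
- by rewrite (bigD1 i)//= eqxx scale1r big1 ?addr0// => l /negbTE ->; rewrite scale0r.
Qed.

Lemma face_sub y : F y -> conv_pts v y.
Proof.
rewrite simplex_halfspaces => -[c [c0 c1 ->]] j /=; rewrite dot_sumr.
rewrite -[leRHS]mul1r -c1 mulr_suml; apply: ler_sum => i _.
rewrite dotZr ler_wpM2l// /a dotNl vv opprD opprK gerDl oppr_le0.
by apply: divr_ge0; [exact: ler0n|exact: ltW].
Qed.

(** Uniqueness of irredundant representations is bypassed: any representation shows that a relative
    interior point of F moved by a small multiple of u stays in P, and this is then read off from
    the inequalities - <v_j, y> <= 1 / s. *)
Lemma tangent_coneE :
  tangent_cone F (conv_pts v) = [set u | forall j : 'I_d.+1, (k < j)%N -> 0 <= dot (v j) u].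
Proof.
apply/seteqP; split => u /=.
- move=> [m [a' [b' [[PE _ _] hu]]]].
  (* The centroid of [F] satisfies strictly every inequality that is not an equality on [F]. *)
  pose c := \sum_i (k.+1%:R^-1 : R) *: w i.
  have Fc : F c.
    exists (fun=> k.+1%:R^-1); split => //.
    by rewrite sumr_const card_ord -[_^-1 *+ _]mulr_natr mulVf.
  have wP i r : dot (a' r) (w i) <= b' r.
    by have := face_sub (face_vertex i); rewrite PE; apply.
  have slack r : dot (a' r) c < b' r \/ dot (a' r) u <= 0.
    have [|] := boolP [forall i, dot (a' r) (w i) == b' r].
      move=> /forallP h; right; apply: hu => y [e [e0 e1 ->]].
      rewrite dot_sumr (eq_bigr (fun i => e i * b' r)) -?mulr_suml ?e1 ?mul1r//.
      by move=> i _; rewrite dotZr (eqP (h i)).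
    rewrite negb_forall => /existsP[i hi]; left.
    have -> : b' r = \sum_(i < k.+1) k.+1%:R^-1 * b' r.
      by rewrite -mulr_suml sumr_const card_ord -[_^-1 *+ _]mulr_natr mulVf// mul1r.
    rewrite dot_sumr [ltLHS](bigD1 i)//= [ltRHS](bigD1 i)//= ltr_leD//.
      by rewrite dotZr ltr_pM2l ?invr_gt0// lt_neqAle hi wP.
    by apply: ler_sum => l _; rewrite dotZr ler_wpM2l// invr_ge0.
  (* A step of length 1 / M respects every constraint with slack at the centroid. A constraint
     without slack contributes 0, its quotient being a division by zero; the leading 1 makes M
     positive. *)
  pose M := 1 + \sum_r `|dot (a' r) u / (b' r - dot (a' r) c)|.
  have M0 : 0 < M by rewrite ltr_pwDl// sumr_ge0.
  have cP : conv_pts v (c + M^-1 *: u).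
    rewrite PE /= => r; rewrite dotDr dotZr; case: (slack r) => [h|h]; last first.
      rewrite -[leRHS]addr0 lerD ?mulr_ge0_le0 ?invr_ge0 ?(ltW M0)//.
      by have := face_sub Fc; rewrite PE; apply.
    rewrite -lerBrDl mulrC ler_pdivrMr// mulrC -ler_pdivrMr ?subr_gt0//.
    apply: (le_trans (ler_norm _)); rewrite /M (bigD1 r)//= addrCA lerDl.
    by rewrite addr_ge0// sumr_ge0.
  move=> j kj; move: cP; rewrite simplex_halfspaces /= => /(_ j).
  rewrite dotDr /a dotNl face_dot// opprK -subr_ge0 opprD addNKr oppr_ge0 dotZr.
  by rewrite pmulr_rle0 ?invr_gt0// dotNl oppr_le0.
- move=> h; exists d.+1, a, (fun=> s^-1); split; first exact: simplex_irredundant.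
  move=> r hr; rewrite /a dotNl oppr_le0; apply: h.
  rewrite ltnNge; apply/negP => rk.
  have := hr _ (face_vertex (inord r)); rewrite /w inordK ?ltnS// inord_val /a dotNl vv eqxx.
  rewrite opprD opprK => /eqP; rewrite -subr_eq0 addrAC addrN add0r oppr_eq0 mul1r invr_eq0.
  by rewrite gt_eqF.
Qed.

Let h (i : 'I_(d - k)) : 'I_d.+1 := inord (k.+1 + i).

Let h_val i : h i = (k.+1 + i)%N :> nat.
Proof. by rewrite inordK// addSn ltnS -ltn_subRL. Qed.

Let h_inj : injective h.
Proof. by move=> i j /(congr1 val) /=; rewrite !h_val => /addnI/val_inj. Qed.

(* The rows are the g_x-gradients of the facet functionals [- v j] scaled by [tau j]; the common
   factor [1 + kappa |x|^2] of the inverse metric is normalized away. *)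
Lemma normal_rows kappa x : klein_ball kappa x -> F x ->
  let b := \row_i tau (h i) in let q := (kappa - s) / s ^+ 2 in
  exists B : 'M[R]_(d - k, d),
    [/\ B *m klein_gram kappa x *m B^T = 1%:M + q *: (b^T *m b),
        0 < 1 + q * \sum_i b 0 i ^+ 2 &
        tangent_cone F (conv_pts v) =
          [set u | forall i, bform (klein_gram kappa x) (row i B) u <= 0]].
Proof.
move=> bx Fx b q; have w0 := klein_factor_gt0 bx; have GM := klein_gramK bx.
(* Two factors c in the Gram matrix cancel the factor 1 + kappa |x|^2 of the inverse metric. *)
pose c := (Num.sqrt (1 + kappa * dot x x))^-1.
have c0 : 0 < c by rewrite invr_gt0 sqrtr_gt0.
pose S := scaled_rows h.
pose B := (- c) *: (S *m klein_gram_inv kappa x).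
have BG : B *m klein_gram kappa x = (- c) *: S.
  by rewrite -scalemxAl -mulmxA (mulmx1C GM) mulmx1.
(* As x lies in F, <v_j, x> = - 1 / s for every j > k. The rank-one term of the inverse metric
   therefore contributes kappa / s^2, whatever x is, and with the - 1 / s of the Euclidean Gram
   matrix this gives q = (kappa - s) / s^2. *)
have Sx : S *m x^T = - s^-1 *: b^T.
  apply/matrixP => i j; rewrite ord1 [RHS]mxE !mxE.
  rewrite -(@face_dot x (h i)) ?h_val ?leq_addr// mulrC mulr_sumr.
  by apply: eq_bigr => l _; rewrite !mxE mulrA.
have gram : B *m klein_gram kappa x *m B^T = 1%:M + q *: (b^T *m b).
  rewrite BG linearZ /= -scalemxAl -scalemxAr scalerA mulrNN trmx_mul mulmxA.
  have -> : (klein_gram_inv kappa x)^T = klein_gram_inv kappa x.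
    by rewrite /klein_gram_inv linearZ linearD linearZ /= trmx1 trmx_mul trmxK.
  rewrite /klein_gram_inv -scalemxAr -scalemxAl scalerA mulmxDr mulmx1 mulmxDl -scalemxAr -scalemxAl.
  have -> : S *m (x^T *m x) *m S^T = s^-2 *: (b^T *m b).
    rewrite mulmxA -mulmxA -[x in x *m S^T]trmxK -trmx_mul Sx linearZ /= trmxK.
    by rewrite -scalemxAl -scalemxAr scalerA mulrNN -expr2 exprVn.
  rewrite scaled_rows_gram// -addrA scalerA -scalerDl (_ : c * c * _ = 1) ?scale1r; last first.
    by rewrite -invfM -expr2 sqr_sqrtr ?mulVf ?gt_eqF// ltW.
  by congr (_ + _ *: _); rewrite /q; field.
have t0 : 0 < \sum_i b 0 i ^+ 2.
  have dk0 : (0 < d - k)%N by rewrite subn_gt0.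
  rewrite (bigD1 (Ordinal dk0))//= ltr_wpDr ?sumr_ge0// => [i _|]; first exact: sqr_ge0.
  by rewrite mxE.
(* Evaluating the positive definite Gram matrix at b itself gives t + q t^2 > 0 with t = |b|^2 >
   0. *)
have qt : 0 < 1 + q * \sum_i b 0 i ^+ 2.
  have Minvu : klein_gram_inv kappa x \in unitmx by have /mulmx1_unit[] := GM.
  have fB : row_free B.
    have cn0 : - c != 0 by rewrite oppr_eq0 gt_eqF.
    rewrite /row_free (eqmx_scale _ cn0) mxrankMfree ?row_free_unit//.
    apply: (@scaled_rows_free _ h ord0) => // i.
    by rewrite -val_eqE /= h_val.
  have b0 : b != 0.
    apply: contraTneq t0 => ->; rewrite big1 ?ltxx// => i _.
    by rewrite mxE expr0n.
  have := (posdef_congr (posdef_klein bx) fB).2 _ b0.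
  rewrite gram gauss_quad_gram /gauss_quad /lin_form.
  rewrite (eq_bigr (fun j => b 0 j ^+ 2)) => [|j _]; last by rewrite expr2.
  set t := \sum_i _ in t0 *.
  have -> : t + q * t ^+ 2 = t * (1 + q * t) by ring.
  by rewrite pmulr_rgt0.
exists B; split => //.
have rowE i u : bform (klein_gram kappa x) (row i B) u = - (c * tau (h i)) * dot (v (h i)) u.
  rewrite /bform -row_mul BG mxE mulr_sumr; apply: eq_bigr => l _.
  by rewrite !mxE; ring.
rewrite tangent_coneE; apply/seteqP; split => u /= hu.
  move=> i; rewrite rowE mulNr oppr_le0 mulr_ge0//; last by rewrite hu// h_val leq_addr.
  by rewrite mulr_ge0// ltW.
move=> j kj.
have jd : (j - k.+1 < d - k)%N by rewrite ltn_subLR// addSn subnKC ?(ltnW kd) ?ltn_ord.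
have := hu (Ordinal jd); rewrite rowE mulNr oppr_le0 pmulr_rge0 ?mulr_gt0//.
by rewrite (_ : h _ = j)//; apply: val_inj; rewrite /= h_val /= subnKC.
Qed.

End face.
End simplex.

(** * Orthocentric cones and the isometry types of normal and tangent cones *)

Section orthocentric.
Context {R : realType}.

(** Scaling the generators by b_i = sqrt(lambda_i) does not change the cone and turns the Gram
    entries into those of 1 + b^T b / lambda_0. *)
Lemma orthocentric_coneE m (l0 : R) (b : 'rV[R]_m) N (C : set 'rV[R]_N) :
  (forall i, 0 < b 0 i) ->
  orthocentric_cone l0 (fun i => b 0 i ^+ 2) (fun=> 1) C ->
  exists2 V : 'M[R]_(m, N), V *m V^T = 1%:M + l0^-1 *: (b^T *m b) &
    C = [set y *m V | y in half_box xpredT].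
Proof.
move=> b0 [l00 _ _ [w [_ ww ->]]].
pose V := \matrix_(i, l) (b 0 i * w i 0 l).
have rV i : row i V = b 0 i *: w i by apply/rowP => l; rewrite !mxE.
exists V.
  apply/matrixP => i j; rewrite -[X in X *m _^T]mulmx1 -bform_row -dotE !rV.
  rewrite dotZr dotC dotZr dotC ww !mxE big_ord1 !mxE.
  case: (eqVneq i j) => [<-|_]; last by rewrite mul0r addr0 add0r; ring.
  by rewrite (_ : ord0 = 0)//; field; rewrite l00 gt_eqF.
apply/seteqP; split => y /=.
  move=> [c c0 ->]; exists (\row_i (c i / b 0 i)).
    by move=> i _; rewrite mxE divr_ge0// ltW.
  rewrite mulmx_sum_row; apply: eq_bigr => i _.
  by rewrite mxE rV scalerA divfK ?gt_eqF// scale1r.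
move=> [z z0 <-]; exists (fun i => z 0 i * b 0 i).
  by move=> i; rewrite mulr_ge0 ?(ltW (b0 i))//; exact: z0.
rewrite mulmx_sum_row; apply: eq_bigr => i _.
by rewrite rV scalerA scale1r.
Qed.

Lemma orthocentric_cone_exists m (l0 : R) (b : 'rV[R]_m) :
  l0 != 0 -> (forall i, 0 < b 0 i) -> posdef (1%:M + l0^-1 *: (b^T *m b)) ->
  exists N (C : set 'rV[R]_N), orthocentric_cone l0 (fun i => b 0 i ^+ 2) (fun=> 1) C.
Proof.
move=> l00 b0 /gram_realization[V fV VV].
pose w i := (b 0 i)^-1 *: row i V.
exists m, (pos_pts (fun i => 1 *: w i)); split => //.
- by move=> i; rewrite expf_neq0// gt_eqF.
- by move=> i; left.
exists w; split => //.
  have -> : codom w = [tuple w i | i < m] by rewrite codomE.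
  apply/freeP => c c0 i.
  have : (\row_i (c i / b 0 i)) *m V = 0.
    rewrite mulmx_sum_row -[RHS]c0; apply: eq_bigr => j _.
    by rewrite -tnth_nth tnth_mktuple mxE /w scalerA.
  move=> h; have : \row_i (c i / b 0 i) = 0 by apply: (row_free_inj fV); rewrite mul0mx.
  by move/rowP/(_ i)/eqP; rewrite !mxE mulf_eq0 invr_eq0 (gt_eqF (b0 i)) orbF => /eqP.
move=> i j; rewrite dotZr dotC dotZr dotC dotE bform_row mulmx1 VV !mxE big_ord1 !mxE.
case: (eqVneq i j) => [<-|_]; last by rewrite mul0r add0r addr0; field; rewrite l00 !gt_eqF.
by field; rewrite l00 gt_eqF.
Qed.

End orthocentric.

Section isometry_types.
Context {R : realType} {n k m : nat}.
Variables (G : 'M[R]_n) (B : 'M[R]_(m, n)) (b : 'rV[R]_m) (q : R).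
Hypotheses (Gp : posdef G) (nkm : n = (k + m)%N).
Hypothesis gram : B *m G *m B^T = 1%:M + q *: (b^T *m b).
Hypothesis qt : 0 < 1 + q * \sum_j b 0 j ^+ 2.
Let T := [set u : 'rV[R]_n | forall i, bform G (row i B) u <= 0].
Let N := [set v : 'rV[R]_n | forall u, T u -> bform G v u <= 0].

Let half_box_delta p (J : pred 'I_p) i : half_box J (delta_mx 0 i : 'rV[R]_p).
Proof. by move=> j _; rewrite mxE /=; case: (_ == _). Qed.

Let fB : row_free B := row_free_gram (gram_unit gram qt).

Lemma normal_isometric p (V : 'M[R]_(m, p)) : V *m V^T = 1%:M + q *: (b^T *m b) ->
  isometric (bform G) N (@dot R p) [set y *m V | y in half_box xpredT].
Proof.
move=> VV; apply: (@isometric_gram _ _ G _ B _ V (half_box xpredT)) => //.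
  by rewrite gram VV.
exact: polar_polar nkm gram qt.
Qed.

Lemma posdef_normal : posdef (1%:M + q *: (b^T *m b)).
Proof. by rewrite -gram; exact: posdef_congr. Qed.

Let q' := q / (1 + q * \sum_j b 0 j ^+ 2).

(** This is the lower right block of the Gram matrix of the independent rows [polar_rows]; it
    guarantees that the orthocentric cone describing the tangent cone exists. *)
Lemma posdef_tangent : posdef (1%:M + (- q') *: (b^T *m b)).
Proof.
have [E EE EB] := orthonormal_complement Gp fB nkm.
have M := polar_rows_gram Gp gram qt EE EB.
have fM : row_free (polar_rows B b q E).
  apply: (row_free_gram (G := G)); rewrite M unitmxE det_ublock det1 mul1r -unitmxE.
  by have /mulmx1_unit[] := gram_rank_one_unit qt.
pose C := row_mx 0 1%:M : 'M[R]_(m, k + m).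
have CT : C^T = col_mx 0 1%:M by rewrite tr_row_mx trmx0 trmx1.
have fC : row_free C.
  apply: (row_free_gram (G := 1%:M)).
  by rewrite mulmx1 CT mul_row_col mul0mx add0r mulmx1 unitmx1.
have := posdef_congr (posdef_congr Gp fM) fC.
by rewrite M CT mul_row_block !mul0mx !mul1mx !add0r mul_row_col mul0mx add0r mulmx1 scaleNr.
Qed.

Lemma tangent_isometric p (V : 'M[R]_(m, p)) : V *m V^T = 1%:M + (- q') *: (b^T *m b) ->
  isometric (bform G) T (@dot R (k + p))
    (orth_sum [set: 'rV[R]_k] [set y *m V | y in half_box xpredT]).
Proof.
move=> VV; have [E EE EB] := orthonormal_complement Gp fB nkm.
have M := polar_rows_gram Gp gram qt EE EB.
pose W := block_mx 1%:M 0 0 V : 'M[R]_(k + m, k + p).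
have WW : W *m W^T = block_mx 1%:M 0 0 (1%:M - q' *: (b^T *m b)).
  rewrite /W tr_block_mx mulmx_block trmx1 !trmx0 !mulmx0 !mul0mx !mulmx1 !addr0 !add0r VV.
  by rewrite scaleNr.
apply: (@isometric_gram _ _ G _ (polar_rows B b q E) _ W (half_box (fun j : 'I_(k + m) => k <= j)%N)) => //.
- apply: (row_free_gram (G := G)); rewrite M unitmxE det_ublock det1 mul1r -unitmxE.
  by have /mulmx1_unit[] := gram_rank_one_unit qt.
- by rewrite M WW.
- exact: polar_cone nkm gram qt _ EE EB.
apply/seteqP; split => y /=.
  move=> [a [_ [_ [z z0 <-] ->]]]; exists (row_mx a z).
    move=> j; case: (split_ordP j) => i -> /=; first by rewrite leqNgt ltn_ord.
    by move=> _; rewrite row_mxEr; exact: z0.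
  by rewrite mul_row_block !mulmx0 mulmx1 addr0 add0r.
move=> [z z0 <-]; exists (lsubmx z), (rsubmx z *m V); split => //.
  exists (rsubmx z) => // i _; rewrite mxE; apply: z0 => /=.
  by rewrite leq_addr.
by rewrite -{1}(hsubmxK z) mul_row_block !mulmx0 mulmx1 addr0 add0r.
Qed.

Lemma normal_angle (c : R[i]) : c ^+ 2 = (- q / (1 + q * \sum_j b 0 j ^+ 2))%:C ->
  (solid_angle (bform G) N)%:C = Phi_gauss_integral xpredT (fun j => c * (b 0 j)%:C).
Proof. exact: solid_angle_gauss Gp gram qt (polar_polar Gp nkm gram qt). Qed.

(** The tangent parameter - q' satisfies 1 - q' |b|^2 = 1 / (1 + q |b|^2), so applying the
    transformation to it gives back q as the square of c. The first k coordinates are unrestricted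
    and contribute no factor Phi. *)
Lemma tangent_angle (c : R[i]) : c ^+ 2 = q%:C ->
  (solid_angle (bform G) T)%:C = Phi_gauss_integral xpredT (fun j => c * (b 0 j)%:C).
Proof.
move=> cE; have [E EE EB] := orthonormal_complement Gp fB nkm.
have := polar_rows_rank_one Gp gram qt EE EB; rewrite /=; set b' := row_mx 0 b => M.
have bb : \sum_j b' 0 j ^+ 2 = \sum_j b 0 j ^+ 2.
  rewrite big_split_ord /= big1 ?add0r => [|i _]; last by rewrite row_mxEl mxE expr0n.
  by apply: eq_bigr => i _; rewrite row_mxEr.
have inv : 1 + - q' * \sum_j b' 0 j ^+ 2 = (1 + q * \sum_j b 0 j ^+ 2)^-1.
  by rewrite bb /q'; field; rewrite gt_eqF.
rewrite (@solid_angle_gauss _ _ G _ _ b' _ _ _ c Gp M _ (polar_cone Gp nkm gram qt EE EB)).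
- congr (_ * cintegral _ _); apply/funext => y; congr (_ * _).
  rewrite big_split_ord /= big_pred0 ?mul1r => [|i]; last by rewrite leqNgt ltn_ord.
  rewrite (eq_bigl xpredT) => [|i]; last by rewrite leq_addr.
  by apply: eq_bigr => i _; rewrite row_mxEr.
- by rewrite inv invr_gt0.
- by rewrite inv cE opprK invrK /q' divfK// gt_eqF.
Qed.

End isometry_types.

(** * Continuity at the orthant *)

Section Phi_bounds.
Context {R : realType}.
Local Notation leb := (@lebesgue_measure R).
Local Notation LR := (measurableTypeR R).
Implicit Types z w : R[i].

Lemma Phi0 : Phi (0 : R[i]) = 2^-1.
Proof.
have := PhiN (0 : R[i]); rewrite oppr0 -mulr2n => h.
by apply: (@mulIf _ 2%:R); rewrite ?pnatr_eq0// mulr_natr h mulVf// pnatr_eq0.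
Qed.

Lemma cnorm_half : cnorm (2^-1 : R[i]) = 2^-1 :> R.
Proof. by rewrite chalf cnorm_real ger0_norm// invr_ge0. Qed.

(** On the segment the integrand is at most |z| exp(|z|^2 / 2). The 2 is the one of [cnorm_cint_le],
    and 1 / sqrt(2 pi) <= 1. *)
Lemma Phi_sub_half z : cnorm (Phi z - 2^-1) <= 2 * (cnorm z * expR (cnorm z ^+ 2 / 2)).
Proof.
rewrite /Phi addrAC subrr add0r cnormM cintegral_indic//.
have pi1 : (1 : R) <= 2 * pi by have := @pi_ge2 R; lra.
have k1 : cnorm ((Num.sqrt (2 * pi))^-1%:C : R[i]) <= 1.
  rewrite cnorm_real ger0_norm ?invr_ge0 ?sqrtr_ge0// invf_le1 ?sqrtr_gt0 ?(lt_le_trans _ pi1)//.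
  by rewrite -[leLHS]sqrtr1 ler_wsqrtr.
pose h (t : LR) : R := \1_`[0, 1] t * (cnorm z * expR (cnorm z ^+ 2 / 2)).
set f := fun t : R => _.
have mf : cmeasurable (f : LR -> R[i]).
  apply: cmeasurableM; first by apply: cmeasurable_real; exact: measurable_indic.
  apply: cmeasurableM; first exact: cmeasurable_cst.
  apply: cmeasurable_cexp; apply: cmeasurableN; apply: cmeasurableM; last exact: cmeasurable_cst.
  have m : cmeasurable (fun t : LR => z * t%:C).
    by apply: cmeasurableM; [exact: cmeasurable_cst|exact: cmeasurable_real].
  exact: (cmeasurableM m m).
have ih0 : leb.-integrable setT (EFin \o (\1_`[0, 1] : LR -> R)) by exact: (integrable_indic01 (R := R)).1.
have ih : leb.-integrable setT (EFin \o h).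
  have := integrableZl measurableT (cnorm z * expR (cnorm z ^+ 2 / 2)) ih0.
  by apply: eq_integrable => // t _ /=; rewrite /h -EFinM mulrC.
have fh t : cnorm (f t) <= h t.
  rewrite /f /h; have := cnorm_cexp (- ((z * t%:C) ^+ 2 / 2)); move: (cexp _) => w wE.
  rewrite !cnormM wE cnorm_real indicE.
  case: (boolP (t \in _)) => tI; last by rewrite normr0 !mul0r.
  rewrite normr1 !mul1r ler_wpM2l ?cnorm_ge0// ler_expR.
  move: tI; rewrite mem_setE in_itv /= => /andP[t0 t1].
  apply: (le_trans (ler_norm _)); apply: (le_trans (normRe_le _)).
  have -> : (z * t%:C) ^+ 2 / 2 = (z * t%:C) * (z * t%:C) * (2^-1 : R)%:C by rewrite -chalf expr2.
  rewrite cnormN !cnormM !cnorm_real (ger0_norm t0) ger0_norm ?invr_ge0//.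
  rewrite -expr2 ler_wpM2r ?invr_ge0// exprMn ler_piMr ?sqr_ge0//.
  by rewrite expr_le1.
have hE : Rintegral leb setT h = cnorm z * expR (cnorm z ^+ 2 / 2).
  have -> : h = fun t : LR => cnorm z * expR (cnorm z ^+ 2 / 2) * \1_`[0, 1] t.
    by apply/funext => t; rewrite /h mulrC.
  have m1 : leb (`[0%R, 1%R]%classic : set R) = 1%E.
    by rewrite lebesgue_measure_itv /= lte_fin ltr01 oppr0 adde0.
  rewrite RintegralZl//.
  have -> : Rintegral leb setT (\1_`[0, 1] : LR -> R) = 1; last by rewrite mulr1.
  rewrite /Rintegral integral_indic// setIT.
  exact: (congr1 fine m1).
have := cnorm_cint_le mf ih fh; rewrite hE => H.
apply: le_trans H; rewrite -[leRHS]mul1r; apply: ler_wpM2r => //; exact: cnorm_ge0.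
Qed.

(** Telescoping: replacing one factor at a time costs e B times a product of bounded factors. *)
Lemma cnorm_prod_sub (I : Type) (r : seq I) (x y : I -> R[i]) (e B : R) :
  0 <= e -> 1 <= B -> (forall i, cnorm (x i) <= B) -> (forall i, cnorm (y i) <= B) ->
  (forall i, cnorm (x i - y i) <= e * B) ->
  cnorm (\prod_(i <- r) x i - \prod_(i <- r) y i) <= e * (size r)%:R * B ^+ size r.
Proof.
move=> e0 B1 xB yB xyB; have B0 : 0 <= B by exact: le_trans B1.
have pB s : cnorm (\prod_(i <- s) x i) <= B ^+ size s.
  rewrite cnorm_prod; elim: s => [|i s IH] /=; first by rewrite big_nil expr0.
  by rewrite big_cons exprS ler_pM ?cnorm_ge0// prodr_ge0// => j _; exact: cnorm_ge0.
elim: r => [|i r IH] /=.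
  by rewrite !big_nil subrr -[0]/(0%:C) cnorm_real normr0 mulr0 mul0r.
rewrite !big_cons; set X := \prod_(_ <- _) x _; set Y := \prod_(_ <- _) y _.
have -> : x i * X - y i * Y = (x i - y i) * X + y i * (X - Y) by ring.
apply: (le_trans (cnormD _ _)); rewrite !cnormM.
have -> : e * (size r).+1%:R * B ^+ (size r).+1 =
    (e * B) * B ^+ size r + B * (e * (size r)%:R * B ^+ size r).
  by rewrite -natr1 exprS; ring.
apply: lerD; apply: ler_pM; rewrite ?cnorm_ge0//.
exact: pB.
Qed.

End Phi_bounds.

Lemma cintB {R : realType} d (T : measurableType d) (mu : {measure set T -> \bar R})
  (f g : T -> R[i]) : cintegrable mu f -> cintegrable mu g ->
  cint mu (fun x => f x + -1 * g x) = cint mu f - cint mu g.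
Proof.
move=> cf cg; rewrite (cintD cf (cintegrableZ (-1) cg)) (cintZ _ cg).
by rewrite mulN1r.
Qed.

Section Phi_gauss_continuity.
Context {R : realType} {n : nat}.
Local Notation leb := (@lebesgue_measure R).
Local Notation LR := (measurableTypeR R).
Variables (J : pred 'I_n) (b : 'I_n -> R).
Let t := \sum_j b j ^+ 2.

Let t0 : 0 <= t. Proof. by apply: sumr_ge0 => j _; exact: sqr_ge0. Qed.

(** [gauss_massE] read backwards: by the involution, q = - r / (1 + r t) is the parameter whose Phi
    arguments have factor c with c^2 = r. The bound on |r| ensures 1 + r t > 0 for either sign. *)
Lemma cintegrable_Phi_prod (c : R[i]) (r : R) : c ^+ 2 = r%:C -> `|r| * t < 1 ->
  cintegrable leb (Phi_prod J (fun j => c * (b j)%:C)).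
Proof.
move=> cE rt.
have rt1 : 0 < 1 + r * t.
  have : - r * t <= `|r| * t by apply: ler_wpM2r => //; rewrite -normrN ler_norm.
  by rewrite mulNr; lra.
pose q := - r / (1 + r * t).
have qt : 1 + q * t = (1 + r * t)^-1 by rewrite /q; field; rewrite gt_eqF.
have qt0 : 0 < 1 + q * t by rewrite qt invr_gt0.
pose sigma := Num.sqrt (1 + q * t).
have sigma0 : 0 < sigma by rewrite sqrtr_gt0.
pose z := c * sigma%:C.
have zE : z ^+ 2 = (- q)%:C.
  rewrite /z exprMn cE -rmorphXn -rmorphM /= sqr_sqrtr ?(ltW qt0)// qt.
  by rewrite /q mulNr opprK.
have [_ ] := gauss_massE J qt0 zE (Re_sqr_mul_lt1 zE t0 qt0).
have -> : (fun j => z * (b j)%:C / (Num.sqrt (1 + q * \sum_j b j ^+ 2))%:C) =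
    (fun j => c * (b j)%:C); last by [].
apply/funext => j; rewrite /z -/t -/sigma mulrAC mulfK//.
by rewrite (inj_eq (@complexI R) sigma 0) gt_eqF.
Qed.

Let gauss8 : leb.-integrable setT (fun y : LR => (expR (- (y ^+ 2 / 8)))%:E).
Proof.
have [[ig _] _] := cint_gauss (0 : R[i]).
have ig' : leb.-integrable setT (fun y : LR => (expR (- (y ^+ 2 / 2)))%:E).
  apply: eq_integrable ig => // y _.
  by rewrite [(_ \o _) y]/comp [(_ \o _) y]/comp mul0r cexp0 mulr1 cRe_real.
have h2 : (2^-1 : R) != 0 by rewrite invr_eq0 pnatr_eq0.
have := integrable_affine 0 h2 ig'.
apply: eq_integrable => // y _ /=; congr (expR _)%:E; by field.
Qed.

(** For small c the difference of the two integrands is at most |c| times a fixed multiple of exp(-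
    y^2 / 8), so integrating the bound suffices. *)
Lemma Phi_gauss_lipschitz0 : exists K delta : R, [/\ 0 <= K, 0 < delta &
  forall (c : R[i]) (r : R), c ^+ 2 = r%:C -> cnorm c <= delta ->
  cnorm (Phi_gauss_integral J (fun j => c * (b j)%:C) - Phi_gauss_integral J (fun=> 0)) <=
    K * cnorm c].
Proof.
pose rho := 1 + \sum_j `|b j|.
have rho1 : 1 <= rho by rewrite lerDl sumr_ge0.
have brho j : `|b j| <= rho.
  by rewrite /rho (bigD1 j)//= addrCA lerDl addr_ge0// sumr_ge0.
pose N := n.+1%:R : R.
have N1 : 1 <= N by rewrite ler1n.
(* Chosen so that delta^2 t < 1, for integrability, and 2 N delta rho <= 1, which makes the
   quadratic growth of the n factors at most a quarter of the Gaussian exponent. *)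
pose delta := (2 * N * rho * (1 + t))^-1.
have den : 1 <= 2 * N * rho * (1 + t).
  have : 1 <= N * rho by rewrite mulr_ege1.
  move=> h; have : 1 <= N * rho * (1 + t) by rewrite mulr_ege1// lerDl.
  lra.
have delta0 : 0 < delta by rewrite invr_gt0 (lt_le_trans _ den).
have dD X : X <= 2 * N * rho * (1 + t) -> delta * X <= 1.
  move=> h; rewrite /delta mulrC ler_pdivrMr ?mul1r//.
  exact: lt_le_trans den.
have t1 : 1 <= 1 + t by rewrite lerDl.
have d1 : delta <= 1 by have := dD 1 den; rewrite mulr1.
have dt : delta ^+ 2 * t < 1.
  have : delta * (2 * (1 + t)) <= 1.
    apply: dD; rewrite -!mulrA ler_pM2l// mulrA ler_peMl ?mulr_ege1//.
    exact: le_trans t1.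
  have : delta ^+ 2 * t <= delta * t by rewrite expr2 -mulrA ler_piMl// mulr_ge0// ltW.
  by lra.
have dr : delta * rho * (2 * N) <= 1.
  rewrite -mulrA; apply: dD; rewrite [rho * _]mulrC ler_peMr//.
  by rewrite !mulr_ge0 ?(le_trans _ N1)// (le_trans _ rho1).
have drN : n%:R * (delta * rho) ^+ 2 <= 4^-1.
  have nN : n%:R <= N by rewrite ler_nat.
  have N0 : 0 < N by rewrite (lt_le_trans _ N1).
  have p0 : 0 <= delta * rho by rewrite mulr_ge0 ?(ltW delta0)// (le_trans _ rho1).
  have p1 : 0 <= delta * rho * (2 * N).
    by apply: mulr_ge0 => //; apply: mulr_ge0 => //; exact: ltW.
  have s1 : (delta * rho * (2 * N)) ^+ 2 <= 1 by rewrite expr_le1.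
  have s2 : n%:R * (delta * rho) ^+ 2 <= N * (N * (delta * rho) ^+ 2).
    by apply: ler_pM => //; [exact: sqr_ge0|apply: ler_peMl => //; exact: sqr_ge0].
  by move: s1 s2; rewrite exprMn exprMn; lra.
(* The exponent to control is n |y| + y^2 / 8 - y^2 / 2. From N |y| <= y^2 / 4 + N^2 it is at most
   N^2 - y^2 / 8, hence at most 2 N^2 - y^2 / 8. *)
pose C0 := n%:R * (1 + 2 * rho) ^+ n * expR (2 * N ^+ 2).
pose h (y : LR) := C0 * expR (- (y ^+ 2 / 8)).
have ih : leb.-integrable setT (EFin \o h).
  rewrite (_ : _ \o _ = fun y : LR => (C0%:E * (expR (- (y ^+ 2 / 8)))%:E)%E); last first.
    by apply/funext => y /=; rewrite EFinM.
  exact: integrableZl.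
pose k := cnorm ((Num.sqrt (2 * pi))^-1%:C : R[i]).
have C00 : 0 <= C0.
  rewrite /C0 !mulr_ge0 ?expR_ge0 ?exprn_ge0// addr_ge0// mulr_ge0//; exact: le_trans rho1.
exists (k * (2 * Rintegral leb setT h)), delta; split => //.
  rewrite !mulr_ge0 ?cnorm_ge0//.
  apply: Rintegral_ge0 => // y _; rewrite mulr_ge0 ?expR_ge0//.
move=> c r cE cd.
have rE : `|r| = cnorm c ^+ 2 by rewrite -cnorm_real -cE expr2 cnormM.
have c0 := cnorm_ge0 c.
have rt : `|r| * t < 1.
  apply: le_lt_trans dt; rewrite rE ler_wpM2r// ler_pXn2r ?nnegrE//; exact: ltW.
have i1 := cintegrable_Phi_prod cE rt.
have i0 : cintegrable leb (Phi_prod J (fun j => 0 * (b j)%:C)).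
  by apply: (@cintegrable_Phi_prod 0 0); rewrite ?expr0n// normr0 mul0r.
have id := cintegrableD i1 (cintegrableZ (-1) i0).
have a0E : (fun=> 0) = (fun j => 0 * (b j)%:C) by apply/funext => j; rewrite mul0r.
have PE a : Phi_gauss_integral J a = (Num.sqrt (2 * pi))^-1%:C * cint leb (Phi_prod J a) by [].
rewrite a0E !PE -mulrBr -(cintB i1 i0).
have bound y : cnorm (Phi_prod J (fun j => c * (b j)%:C) y + -1 * Phi_prod J (fun j => 0 * (b j)%:C) y)
    <= cnorm c * h y.
  have r0 : 0 <= rho by exact: le_trans rho1.
  (* The linear factor |y| of the estimate on Phi is absorbed into exp(|y|), so that one exponential
     bounds each factor and each difference. *)
  pose E := expR (`|y| + (delta * rho) ^+ 2 * y ^+ 2 / 2).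
  have E1 : 1 <= E.
    by rewrite -expR0 ler_expR addr_ge0// divr_ge0// mulr_ge0// sqr_ge0.
  have E0 : 0 <= E by exact: le_trans E1.
  pose B := (1 + 2 * rho) * E.
  have B1 : 1 <= B by rewrite mulr_ege1// lerDl mulr_ge0.
  have zb j : cnorm (Phi (c * (b j)%:C * y%:C) - 2^-1) <= cnorm c * (2 * rho * E).
    apply: (le_trans (Phi_sub_half _)); rewrite !cnormM !cnorm_real.
    have le1 : cnorm c * `|b j| * `|y| <= cnorm c * rho * `|y|.
      by rewrite ler_wpM2r// ler_wpM2l.
    have le2 : cnorm c * rho * `|y| <= delta * rho * `|y|.
      by rewrite !ler_wpM2r.
    have le3 : expR ((cnorm c * `|b j| * `|y|) ^+ 2 / 2) <= expR ((delta * rho) ^+ 2 * y ^+ 2 / 2).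
      rewrite ler_expR ler_wpM2r ?invr_ge0// -[y ^+ 2]real_normK ?num_real// -exprMn.
      by rewrite ler_pXn2r ?nnegrE ?mulr_ge0// ?(ltW delta0)// (le_trans le1).
    have -> : cnorm c * (2 * rho * E) =
        2 * (cnorm c * rho * expR `|y| * expR ((delta * rho) ^+ 2 * y ^+ 2 / 2)).
      by rewrite /E expRD; ring.
    rewrite ler_wpM2l// ler_pM ?expR_ge0 ?mulr_ge0//.
    apply: (le_trans le1); rewrite ler_wpM2l ?mulr_ge0//.
    by have := expR_ge1Dx `|y|; lra.
  pose x i := if J i then Phi (c * (b i)%:C * y%:C) else 1.
  pose x0 i : R[i] := if J i then 2^-1 else 1.
  have x0B i : cnorm (x0 i) <= B.
    apply: le_trans B1; rewrite /x0; case: (J i); rewrite ?cnorm_half ?invf_le1 ?ler1n//.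
    by rewrite -[1]/(1%:C) cnorm_real normr1.
  have xx0 i : cnorm (x i - x0 i) <= cnorm c * (2 * rho * E).
    rewrite /x /x0; case: (J i) => //; rewrite subrr -[0]/(0%:C) cnorm_real normr0.
    by rewrite !mulr_ge0.
  have xB i : cnorm (x i) <= B.
    have [Ji|Ji] := boolP (J i); last first.
      by have := x0B i; rewrite /x /x0 (negbTE Ji).
    rewrite -[x i](subrK (x0 i)); apply: (le_trans (cnormD _ _)).
    have -> : B = 2 * rho * E + E by rewrite /B; ring.
    apply: lerD.
      apply: (le_trans (xx0 i)); rewrite ler_piMl ?mulr_ge0//; exact: le_trans d1.
    by apply: le_trans E1; rewrite /x0 Ji cnorm_half invf_le1 ?ler1n.
  have xe i : cnorm (x i - x0 i) <= cnorm c * B.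
    by apply: (le_trans (xx0 i)); rewrite ler_wpM2l// ler_wpM2r// lerDr.
  have := cnorm_prod_sub (index_enum 'I_n) c0 B1 xB x0B xe.
  have -> : size (index_enum 'I_n) = n by rewrite -[RHS]size_enum_ord enumT.
  move=> H.
  have -> : Phi_prod J (fun j => c * (b j)%:C) y + -1 * Phi_prod J (fun j => 0 * (b j)%:C) y =
      (\prod_i x i - \prod_i x0 i) * (expR (- (y ^+ 2 / 2)))%:C.
    rewrite /Phi_prod mulN1r mulrBl; congr (_ * _ - _ * _).
      exact: big_mkcond.
    rewrite [LHS]big_mkcond; apply: eq_bigr => j _.
    by rewrite /x0; case: (J j) => //; rewrite mul0r mul0r Phi0.
  rewrite cnormM cnorm_real (ger0_norm (expR_ge0 _)).
  apply: (le_trans (ler_wpM2r (expR_ge0 _) H)).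
  rewrite /h /C0 /B exprMn -!mulrA ler_wpM2l// ler_wpM2l// ler_wpM2l ?exprn_ge0 ?addr_ge0 ?mulr_ge0//.
  rewrite /E -expRM_natl -!expRD ler_expR.
  have y0 : 0 <= `|y| by [].
  have yy : y ^+ 2 = `|y| ^+ 2 by rewrite real_normK// num_real.
  have nN : n%:R * `|y| <= N * `|y| by rewrite ler_wpM2r// ler_nat.
  have sq : 0 <= (`|y| / 2 - N) ^+ 2 by exact: sqr_ge0.
  have N2 : 0 <= N ^+ 2 by exact: sqr_ge0.
  have yN : n%:R * (delta * rho) ^+ 2 * `|y| ^+ 2 <= 4^-1 * `|y| ^+ 2.
    by rewrite ler_wpM2r// exprn_ge0.
  have -> : y * (y / 2) = `|y| ^+ 2 / 2 by rewrite mulrA -expr2 yy.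
  have -> : y * (y / 8) = `|y| ^+ 2 / 8 by rewrite mulrA -expr2 yy.
  rewrite yy; move: nN sq yN N2; set Y := `|y|.
  have -> : n%:R * (Y + (delta * rho) ^+ 2 * Y ^+ 2 / 2) =
    n%:R * Y + n%:R * (delta * rho) ^+ 2 * Y ^+ 2 / 2 by ring.
  set A := n%:R * Y; set A2 := n%:R * (delta * rho) ^+ 2 * Y ^+ 2.
  have -> : (Y / 2 - N) ^+ 2 = 4^-1 * Y ^+ 2 - N * Y + N ^+ 2 by field.
  by lra.
have ich : leb.-integrable setT (EFin \o (fun y : LR => cnorm c * h y)).
  rewrite (_ : _ \o _ = fun y : LR => ((cnorm c)%:E * (EFin \o h) y)%E); first exact: integrableZl.
  by apply/funext => y /=; rewrite EFinM.
rewrite cnormM -mulrA ler_wpM2l ?cnorm_ge0//.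
apply: (le_trans (cnorm_cint_le (cintegrable_cmeasurable id) ich bound)).
by rewrite RintegralZl// [cnorm c * _]mulrC mulrA.
Qed.

End Phi_gauss_continuity.

(** * Evaluation of the angle formulas and the limit at kappa = s *)

Section angle_formulas.
Context {R : realType}.

Lemma csqrtM (a r : R) : 0 < a -> csqrt (a ^+ 2 * r) = a%:C * csqrt r.
Proof.
move=> a0; rewrite /csqrt pmulr_rge0 ?exprn_gt0//.
case: ifPn => r0.
  by rewrite sqrtrM ?sqr_ge0// sqrtr_sqr gtr0_norm// rmorphM.
rewrite -mulrN sqrtrM ?sqr_ge0// sqrtr_sqr gtr0_norm//.
by apply: complexP => /=; ring.
Qed.

(** Taking sqrt(lambda_j) out of the complex root leaves one common factor c, the form produced by
    the angle computation. *)
Lemma g_funE m (l0 : R) (b : 'rV[R]_m) : (forall i, 0 < b 0 i) ->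
  g_fun l0 (fun i => b 0 i ^+ 2) (fun=> 1) =
  Phi_gauss_integral xpredT (fun j => csqrt l0^-1 * (b 0 j)%:C).
Proof.
move=> b0; rewrite /g_fun; congr Phi_gauss_integral; apply/funext => j.
by rewrite mul1r csqrtM// mulrC.
Qed.

Lemma Phi_gauss_integral_tail d k (a : 'I_d.+1 -> R[i]) :
  Phi_gauss_integral (fun j : 'I_d.+1 => (k < j)%N) a =
  Phi_gauss_integral xpredT (fun i : 'I_(d - k) => a (inord (k.+1 + i))).
Proof.
congr (_ * cintegral _ _); apply/funext => y; congr (_ * _).
exact: big_ord_tail.
Qed.

Lemma Phi_gauss_integral0 m :
  Phi_gauss_integral (xpredT : pred 'I_m) (fun=> 0 : R[i]) = (2 ^+ m)^-1%:C.
Proof.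
have [cf ce] := cint_gauss (0 : R[i]).
have E : cint (@lebesgue_measure R) (Phi_prod (xpredT : pred 'I_m) (fun=> 0)) =
    2^-1 ^+ m * (Num.sqrt (2 * pi))%:C.
  transitivity (cint (@lebesgue_measure R)
      (fun y => 2^-1 ^+ m * ((expR (- (y ^+ 2 / 2)))%:C * cexp (0 * y%:C)))).
    apply: eq_cint => y; rewrite mul0r cexp0 mulr1 /Phi_prod; congr (_ * _).
    rewrite (eq_bigr (fun=> 2^-1)) => [|j _]; last by rewrite mul0r Phi0.
    by rewrite prodr_const card_ord.
  by rewrite cintZ// ce expr0n /= mul0r cexp0 mulr1.
have -> : Phi_gauss_integral (xpredT : pred 'I_m) (fun=> 0 : R[i]) =
  (Num.sqrt (2 * pi))^-1%:C * cint (@lebesgue_measure R) (Phi_prod (xpredT : pred 'I_m) (fun=> 0)) by [].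
have p0 : Num.sqrt (2 * pi) != 0 :> R by rewrite gt_eqF// sqrtr_gt0 mulr_gt0// pi_gt0.
rewrite E mulrCA -rmorphM mulVf// mulr1 chalf -rmorphXn /=.
by rewrite exprVn.
Qed.

(** Continuity of the root c is not at issue: |c|^2 = |r| = O(|x - s|) already forces c to 0,
    whichever branch is taken on each side of s. *)
Lemma Phi_gauss_integral_cvg0 n (J : pred 'I_n) (b : 'I_n -> R) (s eta M : R)
    (c : R -> R[i]) (r : R -> R) :
  0 < eta -> (forall x, c x ^+ 2 = (r x)%:C) ->
  (forall x, x != s -> `|x - s| < eta -> `|r x| <= M * `|x - s|) ->
  ((fun x => Phi_gauss_integral J (fun j => c x * (b j)%:C)) : R -> R[i]^o) x @[x --> s^'] -->
    (Phi_gauss_integral J (fun=> 0) : R[i]^o).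
Proof.
move=> eta0 cr rM; have [K [delta [K0 delta0 lip]]] := Phi_gauss_lipschitz0 J b.
apply/cvgrPdist_le => /= e e0.
(* Positivity in [R[i]] includes being real. *)
have [e1 eE] : 0 < cRe e /\ e = (cRe e)%:C.
  by move: e0; case: (e) => a f; rewrite ltcE /= => /andP[/eqP -> a0].
pose rho := Order.min delta (cRe e / (K + 1)).
have rho0 : 0 < rho by rewrite lt_min delta0 divr_gt0// ltr_wpDl.
(* Ensures M |x - s| <= rho^2, that is |c x| <= rho, where rho is small enough for the Lipschitz
   estimate to give at most e. *)
pose eta' := Order.min eta (rho ^+ 2 / (`|M| + 1)).
have eta'0 : 0 < eta' by rewrite lt_min eta0 divr_gt0 ?exprn_gt0// ltr_wpDl.
rewrite near_withinE; apply/nbhs_ballP; exists eta' => //= x.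
rewrite /ball /= distrC lt_min => /andP[x1 x2] xs.
have crho : cnorm (c x) <= rho.
  rewrite -(@ler_pXn2r _ 2) ?nnegrE ?cnorm_ge0 ?(ltW rho0)//.
  rewrite expr2 -cnormM -expr2 cr cnorm_real; apply: (le_trans (rM _ xs x1)).
  have M1 : 0 < `|M| + 1 by rewrite ltr_wpDl.
  move: x2; rewrite ltr_pdivlMr// => x2; apply: le_trans (ltW x2).
  rewrite mulrC ler_wpM2l//; apply: (le_trans (ler_norm _)).
  by rewrite lerDl.
have := lip _ _ (cr x); rewrite (le_trans crho) ?ge_min ?lexx// => /(_ isT) H.
rewrite distrC eE; suff : cnorm (Phi_gauss_integral J (fun j => c x * (b j)%:C) -
    Phi_gauss_integral J (fun=> 0)) <= cRe e by rewrite -lecR cnormE.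
apply: (le_trans H); apply: (le_trans (ler_wpM2l K0 crho)).
have K1 : 0 < K + 1 by rewrite ltr_wpDl.
have : rho * (K + 1) <= cRe e by rewrite -ler_pdivlMr// ge_min lexx orbT.
by apply: le_trans; rewrite mulrC ler_wpM2l ?(ltW rho0)// lerDl.
Qed.

End angle_formulas.

Theorem theorem4p1 (R : realType) (kappa : R) (d : nat)
    (tau : 'I_d.+1 -> R) (v : 'I_d.+1 -> 'rV[R]_d) (k : nat) (x : 'rV[R]_d) :
  let s := \sum_(j < d.+1) tau j ^+ 2 in
  let P := conv_pts v in
  let F := conv_pts (fun i : 'I_k.+1 => v (inord i)) in
  let T := tangent_cone F P in
  let N := normal_cone kappa x F P in
  let gx := @klein_metric R kappa d x in
  let sk := \sum_(j < d.+1 | (k < j)%N) tau j ^+ 2 in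
  let lambda := fun i : 'I_(d - k) => tau (inord (k.+1 + i)) ^+ 2 in
  let one := fun _ : 'I_(d - k) => 1 : R in
  let ext_int := fun kappa' : R =>
    Phi_gauss_integral (fun j : 'I_d.+1 => (k < j)%N)
      (fun j => (tau j)%:C / csqrt (- (s ^+ 2 / (kappa' - s)) - sk)) in
  let int_int := fun kappa' : R =>
    Phi_gauss_integral (fun j : 'I_d.+1 => (k < j)%N)
      (fun j => (tau j)%:C * csqrt (kappa' - s) / s%:C) in
  let zero_int :=
    Phi_gauss_integral (fun j : 'I_d.+1 => (k < j)%N) (fun=> 0 : R[i]) in
  (2 <= d)%N -> (k < d)%N ->
  (forall j, 0 < tau j) ->
  (forall j, closure (@klein_ball R kappa d) (v j)) ->
  (forall j l, j != l -> dot (v j) (v l) = - s^-1) ->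
  (forall j, enorm (v j) ^+ 2 = - s^-1 + (tau j ^+ 2)^-1) ->
  relint F x -> klein_ball kappa x ->
  (kappa != s ->
     [/\ for_orthocentric_cone (s ^+ 2 / (kappa - s)) lambda one
           (fun p (C : set 'rV[R]_p) => isometric gx N (@dot R p) C),
         [/\ g_admissible (- (s ^+ 2 / (kappa - s)) - sk) lambda,
             (solid_angle gx N)%:C =
               g_fun (- (s ^+ 2 / (kappa - s)) - sk) lambda one &
             (solid_angle gx N)%:C = ext_int kappa],
         for_orthocentric_cone (- (s ^+ 2 / (kappa - s)) - sk) lambda one
           (fun p (C : set 'rV[R]_p) =>
              isometric gx T (@dot R (k + p)) (orth_sum [set: 'rV[R]_k] C)) &
         [/\ g_admissible (s ^+ 2 / (kappa - s)) lambda,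
             (solid_angle gx T)%:C =
               g_fun (s ^+ 2 / (kappa - s)) lambda one &
             (solid_angle gx T)%:C = int_int kappa]]) /\
  (kappa = s ->
     [/\ isometric gx N (@dot R (d - k)) (@orthant R (d - k)) /\
         isometric gx T (@dot R (k + (d - k)))
           (orth_sum [set: 'rV[R]_k] (@orthant R (d - k))),
         solid_angle gx N = (2 ^+ (d - k))^-1 /\
         solid_angle gx T = (2 ^+ (d - k))^-1,
         (solid_angle gx N)%:C = zero_int /\
         (solid_angle gx T)%:C = zero_int &
         (ext_int : R -> R[i]^o) kappa' @[kappa' --> s^'] -->
           ((solid_angle gx N)%:C : R[i]^o) /\
         (int_int : R -> R[i]^o) kappa' @[kappa' --> s^'] -->
           ((solid_angle gx T)%:C : R[i]^o)]).
Proof.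
move=> s P F T N gx sk lambda one ext_int int_int zero_int _ kd tau0 _ vij vjj Fx bx.
have d0 : (0 < d)%N by exact: leq_ltn_trans kd.
have vv j l : dot (v j) (v l) = - s^-1 + (j == l)%:R / tau j ^+ 2.
  case: (eqVneq j l) => [<-|jl]; last by rewrite mul0r addr0 vij.
  by rewrite -enorm_sqr vjj mul1r.
have s0 : 0 < s by rewrite /s (bigD1 ord0)//= ltr_wpDr ?exprn_gt0// sumr_ge0// => j _; exact: sqr_ge0.
have sn0 : s != 0 by rewrite gt_eqF.
have [B] := normal_rows d0 tau0 vv kd bx Fx.1.
set b := \row_i _; rewrite -/s; set q := (kappa - s) / s ^+ 2.
rewrite -/F -/P -/T => -[gram qt TE].
have nkm : d = (k + (d - k))%N by rewrite subnKC// ltnW.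
have Gp := posdef_klein bx.
have gxE : gx = bform (klein_gram kappa x) by exact: klein_metricE.
have NE : N = [set w | forall u, [set u | forall i, bform (klein_gram kappa x) (row i B) u <= 0] u ->
    bform (klein_gram kappa x) w u <= 0] by rewrite /N /normal_cone -/gx gxE -/T TE.
have b0 i : 0 < b 0 i by rewrite mxE.
have lambdaE : lambda = fun i => b 0 i ^+ 2 by apply/funext => i; rewrite mxE.
have skE : sk = \sum_i b 0 i ^+ 2.
  by rewrite /sk big_ord_tail; apply: eq_bigr => i _; rewrite mxE.
have sk0 : 0 < sk.
  have dk : (0 < d - k)%N by rewrite subn_gt0.
  rewrite skE (bigD1 (Ordinal dk))//= ltr_wpDr ?exprn_gt0// sumr_ge0// => i _; exact: sqr_ge0.
have extE kappa' : ext_int kappa' = Phi_gauss_integral (fun j : 'I_d.+1 => (k < j)%N)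
    (fun j => (csqrt (- (s ^+ 2 / (kappa' - s)) - sk))^-1 * (tau j)%:C).
  by congr Phi_gauss_integral; apply/funext => j; rewrite mulrC.
have intE kappa' : int_int kappa' = Phi_gauss_integral (fun j : 'I_d.+1 => (k < j)%N)
    (fun j => csqrt (kappa' - s) / s%:C * (tau j)%:C).
  by congr Phi_gauss_integral; apply/funext => j; rewrite [RHS]mulrC mulrA.
have tailE c : Phi_gauss_integral (fun j : 'I_d.+1 => (k < j)%N) (fun j => c * (tau j)%:C) =
    Phi_gauss_integral xpredT (fun j => c * (b 0 j)%:C).
  rewrite Phi_gauss_integral_tail; congr Phi_gauss_integral; apply/funext => j.
  by rewrite mxE.
have sC : s%:C != 0 :> R[i] by rewrite (inj_eq (@complexI R) s 0).
have ext_sqr kappa' : (csqrt (- (s ^+ 2 / (kappa' - s)) - sk))^-1 ^+ 2 =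
    ((- (s ^+ 2 / (kappa' - s)) - sk)^-1)%:C.
  by rewrite exprVn csqrt_sqr fmorphV.
have int_sqr kappa' : (csqrt (kappa' - s) / s%:C) ^+ 2 = ((kappa' - s) / s ^+ 2)%:C.
  by rewrite exprMn csqrt_sqr exprVn -rmorphXn -fmorphV -rmorphM.
have normal_iso := normal_isometric Gp nkm gram qt.
have tangent_iso := tangent_isometric Gp nkm gram qt.
have normal_ang := normal_angle Gp nkm gram qt.
have tangent_ang := tangent_angle Gp nkm gram qt.
have normal_pos := posdef_normal Gp gram qt.
have tangent_pos := posdef_tangent Gp nkm gram qt.
rewrite -NE -gxE in normal_iso normal_ang; rewrite -TE -gxE in tangent_iso tangent_ang.
rewrite -skE in qt tangent_iso normal_ang tangent_pos.
split=> ks.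
- have ks0 : kappa - s != 0 by rewrite subr_eq0.
  have q0 : q != 0 by rewrite mulf_neq0// invr_eq0 expf_neq0.
  have lE : s ^+ 2 / (kappa - s) = q^-1 by rewrite invf_div.
  have lV : (s ^+ 2 / (kappa - s))^-1 = q by rewrite lE invrK.
  (* The shifted parameter is the inverse of - q / (1 + q sk), so normal and tangent cone are
     exchanged by the involution on parameters. *)
  have tE : - (s ^+ 2 / (kappa - s)) - sk = - ((1 + q * sk) / q).
    by rewrite lE; field.
  have tV : (- (s ^+ 2 / (kappa - s)) - sk)^-1 = - (q / (1 + q * sk)).
    by rewrite tE invrN invf_div.
  have t0 : - (s ^+ 2 / (kappa - s)) - sk != 0.
    by rewrite tE oppr_eq0 mulf_neq0 ?invr_eq0// gt_eqF.
  have lambda_sum : \sum_i lambda i = sk by rewrite lambdaE skE.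
  have lambda0 i : 0 < lambda i by rewrite lambdaE exprn_gt0.
  have t_inv : 0 < (1 + q * sk)^-1 by rewrite invr_gt0.
  split.
  + split; rewrite lambdaE.
      apply: orthocentric_cone_exists => //; first by rewrite lE invr_eq0.
      by rewrite lV.
    move=> p C /(orthocentric_coneE b0)[V VV ->]; apply: normal_iso.
    by rewrite VV lV.
  + split.
    * split => //; rewrite lambda_sum; case: (ltgtP q 0) q0 => // qs _.
        left; rewrite tE oppr_gt0.
        by rewrite pmulr_rlt0// invr_lt0.
      right; rewrite ltrBlDr addNr lE oppr_lt0 invr_gt0.
      by [].
    * rewrite lambdaE g_funE//; apply: normal_ang.
      by rewrite csqrt_sqr tV mulNr.
    (* For a negative parameter, the inverse of its [csqrt] is the opposite of the [csqrt] of its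
       inverse; both have the required square. *)
    * rewrite extE tailE; apply: normal_ang.
      by rewrite ext_sqr tV mulNr.
  + split; rewrite lambdaE.
      apply: orthocentric_cone_exists => //.
      by rewrite tV.
    move=> p C /(orthocentric_coneE b0)[V VV ->]; apply: tangent_iso.
    by rewrite VV tV.
  + split.
    * split => //; rewrite lambda_sum lE; case: (ltgtP q 0) q0 => // qs _.
        (* For q < 0, multiplication by q turns q^-1 < - sk into 1 + q sk > 0. *)
        right; rewrite -(ltr_nM2l qs) mulfV ?ltr0_neq0// mulrN.
        by lra.
      by left; rewrite invr_gt0.
    * rewrite lambdaE g_funE//; apply: tangent_ang.
      by rewrite csqrt_sqr lV.
    * rewrite intE tailE; apply: tangent_ang.
      by rewrite int_sqr.
- have q0 : q = 0 by rewrite /q ks subrr mul0r.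
  have one_orthant : [set y *m (1%:M : 'M[R]_(d - k)) | y in half_box xpredT] = @orthant R (d - k).
    apply/seteqP; split => y /=.
      by move=> [z z0 <-] i; rewrite mulmx1; exact: z0.
    by move=> y0; exists y; rewrite ?mulmx1// => i _; exact: y0.
  have zN : (solid_angle gx N)%:C = Phi_gauss_integral (xpredT : pred 'I_(d - k)) (fun=> 0).
    rewrite (normal_ang 0); last by rewrite q0 expr0n oppr0 mul0r.
    by congr Phi_gauss_integral; apply/funext => j; rewrite mul0r.
  have zT : (solid_angle gx T)%:C = Phi_gauss_integral (xpredT : pred 'I_(d - k)) (fun=> 0).
    rewrite (tangent_ang 0); last by rewrite q0 expr0n.
    by congr Phi_gauss_integral; apply/funext => j; rewrite mul0r.
  have zE : zero_int = Phi_gauss_integral (xpredT : pred 'I_(d - k)) (fun=> 0).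
    exact: Phi_gauss_integral_tail.
  split.
  + rewrite -one_orthant; split; first by apply: normal_iso; rewrite trmx1 mulmx1 q0 scale0r addr0.
    by apply: tangent_iso; rewrite trmx1 mulmx1 q0 mul0r oppr0 scale0r addr0.
  + by split; apply: (@complexI R); rewrite ?zN ?zT Phi_gauss_integral0.
  + by rewrite zN zT zE.
  + rewrite zN zT -zE; split.
      rewrite (funext extE).
      (* For |e| < s^2 / (2 sk) one has s^2 / |e| >= 2 sk, so the denominator is at least s^2 / |e|
         - sk >= s^2 / (2 |e|), which gives the constant 2 / s^2. *)
      apply: (@Phi_gauss_integral_cvg0 _ _ _ _ _ (s ^+ 2 / (2 * sk)) (2 / s ^+ 2) _ _ _ ext_sqr).
        by rewrite divr_gt0 ?exprn_gt0// mulr_gt0.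
      move=> y ys; set e := y - s; move=> ye.
      have e0 : 0 < `|e| by rewrite normr_gt0 subr_eq0.
      have s20 : 0 < s ^+ 2 by rewrite exprn_gt0.
      have le1 : 2 * sk <= s ^+ 2 / `|e|.
        by rewrite ler_pdivlMr// mulrC -ler_pdivlMr ?mulr_gt0// ltW.
      have le2 : s ^+ 2 / `|e| - sk <= `|- (s ^+ 2 / e) - sk|.
        rewrite -opprD normrN; apply: le_trans (lerB_normD _ _).
        by rewrite normrM normfV (ger0_norm (ltW s20)) (ger0_norm (ltW sk0)).
      have le3 : (2 / s ^+ 2 * `|e|)^-1 <= `|- (s ^+ 2 / e) - sk|.
        apply: le_trans le2; rewrite !invfM invrK mulrAC -mulrA mulrC.
        by lra.
      rewrite normfV -[leRHS]invrK lef_pV2// posrE ?invr_gt0 ?mulr_gt0 ?invr_gt0//.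
      by apply: lt_le_trans le3; rewrite invr_gt0 !mulr_gt0 ?invr_gt0.
    rewrite (funext intE).
    (* Here r is linear in kappa', so the bound is an equality and the radius 1 is arbitrary. *)
    apply: (@Phi_gauss_integral_cvg0 _ _ _ _ _ 1 (s ^+ 2)^-1 _ _ _ int_sqr) => //.
    by move=> y _ _; rewrite normrM mulrC [`|_^-1|]ger0_norm// invr_ge0 sqr_ge0.
Qed.
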